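(* Let $\beta\ge5$ and $\epsilon_1,\epsilon_2\in\{1,-1\}$. Let $\Gamma_3$ be the quotient of $[2^{\beta-1},2^\beta,2^{\beta-1}]^+$ by the relations $\sigma_2^{-1}\sigma_1=\sigma_1^{-1+2^{\beta-2}}\sigma_2^{-3+\epsilon_12^{\beta-2}}$, $\sigma_2\sigma_1^{-1}=\sigma_1^{1+2^{\beta-2}}\sigma_2^{3+\epsilon_12^{\beta-2}}$, $\sigma_3^{-1}\sigma_2=\sigma_2^{3+\epsilon_22^{\beta-2}}\sigma_3^{1+2^{\beta-2}}$, $\sigma_3\sigma_2^{-1}=\sigma_2^{-3+\epsilon_22^{\beta-2}}\sigma_3^{-1+2^{\beta-2}}$. Then $\Gamma_3$ is the automorphism group, with standard generators $\sigma_1,\sigma_2,\sigma_3$, of an atomic chiral $4$-polytope of type $\{2^{\beta-1},2^\beta,2^{\beta-1}\}$.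
   Context: $[p,q,r]^+=\langle\sigma_1,\sigma_2,\sigma_3\mid\sigma_1^p=\sigma_2^q=\sigma_3^r=(\sigma_1\sigma_2)^2=(\sigma_2\sigma_3)^2=(\sigma_1\sigma_2\sigma_3)^2=1\rangle$. Standard generators of a chiral polytope with base flag $\Phi$: $\Phi\sigma_i=\Phi^{i(i-1)}$, $\Phi^j$ the flag differing from $\Phi$ only in its $j$-face. Tight: type $\{p,q,r\}$ with exactly $2pqr$ flags. A tight chiral $4$-polytope is atomic if it does not properly cover any tight chiral polytope. *)

(* Defs.v *)
From HB Require Import structures.
From mathcomp Require Import all_boot all_order all_algebra all_fingroup.
Set Implicit Arguments. Unset Strict Implicit. Unset Printing Implicit Defensive.

Local Open Scope group_scope.

Definition zexpg (G : groupType) (x : G) (z : int) : G :=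
  match z with Posz n => x ^+ n | Negz n => x ^- n.+1 end.

Definition rot_rel (G : groupType) (p q r : nat) (s1 s2 s3 : G) : Prop :=
  [/\ s1 ^+ p = 1, s2 ^+ q = 1 & s3 ^+ r = 1] /\
  [/\ (s1 * s2) ^+ 2 = 1, (s2 * s3) ^+ 2 = 1 & (s1 * s2 * s3) ^+ 2 = 1].

Definition gamma3_rel (b : nat) (e1 e2 : int) (G : groupType) (s1 s2 s3 : G)
  : Prop :=
  let k : int := (2 ^ (b - 2))%N in
  [/\ rot_rel (2 ^ (b - 1)) (2 ^ b) (2 ^ (b - 1)) s1 s2 s3,
      s2^-1 * s1 = zexpg s1 (-1 + k)%R * zexpg s2 (-3 + e1 * k)%R,
      s2 * s1^-1 = zexpg s1 (1 + k)%R * zexpg s2 (3 + e1 * k)%R,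
      s3^-1 * s2 = zexpg s2 (3 + e2 * k)%R * zexpg s3 (1 + k)%R &
      s3 * s2^-1 = zexpg s2 (-3 + e2 * k)%R * zexpg s3 (-1 + k)%R].

(* (A; s1, s2, s3) is (a copy of) the group Gamma_3 with its distinguished
   generators: A is generated by s1 s2 s3, they satisfy the relations, and
   the universal property of the presentation holds (for every group H and
   elements t1 t2 t3 of H satisfying the relations there is a homomorphism
   A -> H with s_i |-> t_i).  Composition in {perm F} is "first g then h",
   i.e. right action, matching the notation Phi sigma_i of the paper. *)
Definition presents_gamma3 (b : nat) (e1 e2 : int) (gT : finGroupType)
  (A : {set gT}) (s1 s2 s3 : gT) : Prop :=
  [/\ A = <<[set s1; s2; s3]>>,
      gamma3_rel b e1 e2 s1 s2 s3 &
      forall (H : groupType) (t1 t2 t3 : H), gamma3_rel b e1 e2 t1 t2 t3 ->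
        exists f : gT -> H,
          [/\ {in A &, {morph f : x y / x * y}}, f s1 = t1, f s2 = t2 & f s3 = t3]].

Local Close Scope group_scope.

(* A polytope is given by a finite type of faces F, an incidence (partial
   order) le, and a rank function rk, where rk x = (rank of x) + 1, so that
   the ranks -1,0,...,4 are stored as 0,1,...,5. *)
Section Polytopes.
Variables (F : finType) (le : rel F) (rk : F -> nat).

Definition plt (x y : F) := (x != y) && le x y.

Definition is_chain (A : {set F}) :=
  [forall x in A, forall y in A, le x y || le y x].

Definition is_flag (A : {set F}) :=
  is_chain A && [forall B : {set F}, (A \proper B) ==> ~~ is_chain B].

Definition jadj (j : nat) (A B : {set F}) :=
  [&& is_flag A, is_flag B, A != B & A :\: B \subset [set x | rk x == j.+1]].

Definition adjacent (A B : {set F}) :=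
  [&& is_flag A, is_flag B & #|A :\: B| == 1].

Definition partial_order : Prop :=
  [/\ (forall x, le x x),
      (forall x y, le x y -> le y x -> x = y) &
      (forall x y z, le x y -> le y z -> le x z)].

Definition polytope4 : Prop :=
  [/\ partial_order,
      (forall x y, plt x y -> rk x < rk y) /\ (forall x, rk x <= 5),
      (exists m, forall x, le m x) /\ (exists M, forall x, le x M),
      (forall A, is_flag A -> #|A| = 6) /\
      (forall x y, plt x y -> rk y = (rk x).+2 ->
                   #|[set z | plt x z && plt z y]| = 2) &
      (forall A B, is_flag A -> is_flag B ->
         connect (fun C D => [&& adjacent C D, A :&: B \subset C
                                 & A :&: B \subset D]) A B)].

Definition paut : {set {perm F}} :=
  [set g : {perm F} | [forall x, forall y, le (g x) (g y) == le x y]].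

Definition same_orbit (A B : {set F}) :=
  exists2 g, g \in paut & g @: A = B.

Definition chiral : Prop :=
  (forall A B, adjacent A B -> ~ same_orbit A B) /\
  (forall A B C, is_flag A -> is_flag B -> is_flag C ->
     [\/ same_orbit A B, same_orbit A C | same_orbit B C]).

(* Schlafli type {p,q,r}: every 2-face is a p-gon, every section F_3/F_0
   is a q-gon, every section F_4/F_1 is an r-gon *)
Definition sect_count (i : nat) (x y : F) :=
  #|[set z | [&& le x z, le z y & rk z == i]]|.

Definition type4 (p q r : nat) : Prop :=
  [/\ (forall x y, le x y -> rk x = 0 -> rk y = 3 -> sect_count 1 x y = p),
      (forall x y, le x y -> rk x = 1 -> rk y = 4 -> sect_count 2 x y = q) &
      (forall x y, le x y -> rk x = 2 -> rk y = 5 -> sect_count 3 x y = r)].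

Definition nflags := #|[set A : {set F} | is_flag A]|.

Definition tight : Prop :=
  exists p q r, type4 p q r /\ nflags = 2 * p * q * r.

(* standard generators with respect to the base flag Phi:
   Phi sigma_i = (Phi^i)^(i-1), i = 1,2,3 *)
Definition std_gens (Phi : {set F}) (s1 s2 s3 : {perm F}) : Prop :=
  [/\ is_flag Phi, [/\ s1 \in paut, s2 \in paut & s3 \in paut] &
      [/\ exists2 P, jadj 1 Phi P & jadj 0 P (s1 @: Phi),
          exists2 P, jadj 2 Phi P & jadj 1 P (s2 @: Phi) &
          exists2 P, jadj 3 Phi P & jadj 2 P (s3 @: Phi)]].

End Polytopes.

Definition covering (F : finType) (le : rel F) (rk : F -> nat)
  (F' : finType) (le' : rel F') (rk' : F' -> nat) (c : F -> F') : Prop :=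
  [/\ (forall y, exists x, c x = y),
      (forall x, rk' (c x) = rk x),
      (forall x y, le x y -> le' (c x) (c y)) &
      (forall j A B, jadj le rk j A B -> jadj le' rk' j (c @: A) (c @: B))].

(* a proper covering is one that is not an isomorphism *)
Definition properly_covers (F : finType) (le : rel F) (rk : F -> nat)
  (F' : finType) (le' : rel F') (rk' : F' -> nat) : Prop :=
  exists c : F -> F', covering le rk le' rk' c /\ ~ injective c.

Definition atomic (F : finType) (le : rel F) (rk : F -> nat) : Prop :=
  [/\ tight le rk, chiral le &
      forall (F' : finType) (le' : rel F') (rk' : F' -> nat),
        polytope4 le' rk' -> chiral le' -> tight le' rk' ->
        ~ properly_covers le rk le' rk'].

(* Main.v *)
(* Write a, x, y for sigma_1, sigma_2, sigma_3 and k = 2^(b-2).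

   The relations imply a^k x a^k = x^(1+2k) and y^k x y^k = x^(1+2k), that x^4
   is nearly central, and y a y^-1 = x^-1 a^-1 x; hence every element has the
   form a^i y^l x^j.  Conversely the coset action on the points <a> y^l x^j is
   given by maps of Z/2k x Z/4k that are affine up to multiples of k which only
   depend on residues modulo 8, so each relation is a finite check, uniform in
   b.  Thus the group has order 2k * 4k * 2k, the form a^i y^l x^j is unique,
   and the universal property and the intersection property follow.

   The polytope is the coset geometry of the stabilizers <x,y>, <ax,y>, <a,xy>,
   <a,x>.  A symmetry taking the base flag to its 1-adjacent flag would conjugate
   a, x to a^-1, x^-1; then the relations force x^(2k) = 1, which is false, so
   the polytope is chiral.

   A covered tight chiral polytope gives a quotient of the group.  If the orders
   of the generators drop, then x^(2k) = 1 in the quotient by the first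
   identities above; modulo x^(2k) the relations are invariant under the mirror
   (a, x, y) -> (a^-1, x^-1, x^2 y), and tightness makes the mirror descend to
   the quotient, which is then regular.  If no order drops, tightness makes the
   covering bijective. *)

From Stdlib Require Import ZArith Lia.
Require Import Defs.
From mathcomp Require Import all_boot all_order all_algebra all_fingroup.
From mathcomp Require Import cyclic ssrZ zify.

Set Implicit Arguments.
Unset Strict Implicit.
Unset Printing Implicit Defensive.

Import GRing.Theory.

(** * Flags of polytopes *)

(** Two difficulties shape the proof. The groups have unbounded order, so their existence cannot be
    settled by enumeration. With [k = 8 * m], points are carried as linear forms in their unknown
    quotients by 8, and each relation becomes 64 symbolic comparisons for each choice of signs. The
    bound on $\beta$ makes [k] divisible by 8, so corrections by multiples of [k] never disturb the
    residues modulo 8 that index the tables. The other difficulty is to exclude smaller chiral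
    quotients that are not known explicitly. The mirror is the trace of a reflection: if
    $\sigma_i=\rho_{i-1}\rho_i$, then conjugation by $\rho_1$ inverts $\sigma_1$ and $\sigma_2$ and
    sends $\sigma_3$ to $\rho_1\rho_2\rho_1\rho_3=\sigma_2^2\sigma_3$. It descends to a tight
    quotient because there a relation $a^iy^lx^j=1$ forces each of its three factors to be trivial,
    and the mirror image of each factor is its inverse or a conjugate of its inverse. *)

Definition prepolytope (F : finType) (le : rel F) (rk : F -> nat) : Prop :=
  [/\ partial_order le,
      (forall x y, plt le x y -> rk x < rk y) /\ (forall x, rk x <= 5),
      (exists m, forall x, le m x) /\ (exists M, forall x, le x M) &
      (forall A, is_flag le A -> #|A| = 6) /\
      (forall x y, plt le x y -> rk y = (rk x).+2 ->
                   #|[set z | plt le x z && plt le z y]| = 2)].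

(** A total choice of the $j$-adjacent flag; by [jadj_adj] the default [A] is never returned for a
    flag and [j < 4]. *)
Definition adj (F : finType) (le : rel F) (rk : F -> nat) j (A : {set F}) :=
  odflt A [pick B | jadj le rk j A B].

Section Flags.
Variables (F : finType) (le : rel F) (rk : F -> nat).
Hypothesis preP : prepolytope le rk.

Let lexx x : le x x. Proof. by case: preP => -[]. Qed.
Let le_anti x y : le x y -> le y x -> x = y.
Proof. by case: preP => -[_ h _] _ _ _; apply: h. Qed.
Let le_trans x y z : le x y -> le y z -> le x z.
Proof. by case: preP => -[_ _ h] _ _ _; apply: h. Qed.
Let plt_rk x y : plt le x y -> rk x < rk y.
Proof. by case: preP => _ [h _] _ _; apply: h. Qed.
Let rk_le5 x : rk x <= 5. Proof. by case: preP => _ [_ h]. Qed.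

Let lt4_lt6 j : j < 4 -> [/\ j < 6, j.+1 < 6 & j.+2 < 6].
Proof. by case: j => [|[|[|[|]]]]. Qed.

Lemma le_rk x y : le x y -> rk x <= rk y.
Proof.
move=> lxy; have [->//|nxy] := eqVneq x y.
by apply: ltnW; apply: plt_rk; rewrite /plt nxy.
Qed.

Lemma is_chainP (A : {set F}) :
  reflect {in A &, forall x y, le x y || le y x} (is_chain le A).
Proof.
apply: (iffP 'forall_in_'forall_in_idP) => h x y; last by move=> hx hy; apply: h.
by move=> hx; apply: h.
Qed.

Lemma chain_rk_inj (A : {set F}) : is_chain le A -> {in A &, injective rk}.
Proof.
move=> /is_chainP cA x y Ax Ay e; apply/eqP; apply: contraT => nxy.
wlog l : x y Ax Ay e nxy / le x y.
  move=> h; case/orP: (cA x y Ax Ay) => l; first exact: h l.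
  by apply: (h y x) => //; rewrite eq_sym.
by have := @plt_rk x y; rewrite /plt nxy l e ltnn => /(_ isT).
Qed.

Lemma chain_le_rk (A : {set F}) x y :
  is_chain le A -> x \in A -> y \in A -> rk x <= rk y -> le x y.
Proof.
move=> cA Ax Ay; move: (is_chainP _ cA x y Ax Ay) => /orP[//|lyx] lr.
suff -> : x = y by [].
by apply: (chain_rk_inj cA) => //; apply/eqP; rewrite eqn_leq lr le_rk.
Qed.

Let ork (x : F) : 'I_6 := inord (rk x).
Let orkE x : ork x = rk x :> nat. Proof. by rewrite inordK // ltnS. Qed.

Lemma ork_chain_inj (A : {set F}) : is_chain le A -> {in A &, injective ork}.
Proof.
by move=> cA x y Ax Ay /(congr1 val); rewrite /= !orkE; exact: chain_rk_inj cA _ _ Ax Ay.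
Qed.

Lemma card_chain (A : {set F}) : is_chain le A -> #|A| <= 6.
Proof.
move=> cA; rewrite -(card_in_imset (ork_chain_inj cA)).
by rewrite (leq_trans (max_card _)) // card_ord.
Qed.

(** Six stored ranks bound the length of a chain, so maximality becomes a count, which is easy to
    transport along injective maps. *)
Lemma flagE (A : {set F}) : is_flag le A = is_chain le A && (#|A| == 6).
Proof.
apply/idP/andP => [fA|[cA /eqP sA]].
  split; first by case/andP: fA.
  by apply/eqP; case: preP => _ _ _ [h _]; apply: h.
rewrite /is_flag cA; apply/forallP => B; apply/implyP => /proper_card.
by rewrite sA => h; apply/negP => /card_chain; rewrite leqNgt h.
Qed.

Lemma flag_chain (A : {set F}) : is_flag le A -> is_chain le A.
Proof. by case/andP. Qed.

Lemma flag_card (A : {set F}) : is_flag le A -> #|A| = 6.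
Proof. by rewrite flagE => /andP[_ /eqP]. Qed.

Lemma flag_le (A : {set F}) x y :
  is_flag le A -> x \in A -> y \in A -> rk x <= rk y -> le x y.
Proof. by move/flag_chain; apply: chain_le_rk. Qed.

Lemma flag_rk_inj (A : {set F}) : is_flag le A -> {in A &, injective rk}.
Proof. by move/flag_chain/chain_rk_inj. Qed.

Lemma flag_face (A : {set F}) i :
  is_flag le A -> i < 6 -> exists2 x, x \in A & rk x = i.
Proof.
move=> fA li; have: Ordinal li \in ork @: A.
  have/eqP: #|ork @: A| = #|[set: 'I_6]|.
    by rewrite (card_in_imset (ork_chain_inj (flag_chain fA))) flag_card // cardsT card_ord.
  by move=> e; rewrite (_ : ork @: A = setT) ?inE //; apply/eqP; rewrite eqEcard subsetT (eqP e) /=.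
by case/imsetP => x Ax /(congr1 val) /=; rewrite orkE => ->; exists x.
Qed.

Lemma chain_sub_flag (A : {set F}) :
  is_chain le A -> exists2 B, is_flag le B & A \subset B.
Proof.
move=> cA; have [B /maxsetP[cB mB] sAB] := maxset_exists cA.
exists B => //; rewrite /is_flag cB; apply/forallP => C; apply/implyP => pBC.
apply/negP => cC; have := mB C cC (proper_sub pBC) => e.
by move: pBC; rewrite e properxx.
Qed.

Lemma flag_of_le x y : le x y -> exists A, [/\ is_flag le A, x \in A & y \in A].
Proof.
move=> lxy; have [|A fA sA] := @chain_sub_flag [set x; y].
  by apply/is_chainP => u v /set2P[]-> /set2P[]->; rewrite ?lexx ?lxy ?orbT.
by exists A; split=> //; apply: (subsetP sA); rewrite !inE eqxx ?orbT.
Qed.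

Lemma flag_of x : exists2 A, is_flag le A & x \in A.
Proof. by have [A [fA Ax _]] := flag_of_le (lexx x); exists A. Qed.

Lemma flag_sub_eq (A B : {set F}) :
  is_flag le A -> is_flag le B -> A \subset B -> A = B.
Proof. by move=> fA fB s; apply/eqP; rewrite eqEcard s !flag_card. Qed.

(** Both flags have one face of each rank, so a face of [B] outside [A] has the rank of some face of
    [A] outside [B]. *)
Lemma jadj_sym j (A B : {set F}) : jadj le rk j A B -> jadj le rk j B A.
Proof.
case/and4P => fA fB nAB /subsetP s; apply/and4P; split=> //; first by rewrite eq_sym.
apply/subsetP => x /setDP[Bx nAx].
have [y Ay ry] := flag_face fA (rk_le5 x : rk x < 6).
have nBy : y \notin B.
  apply: contra nAx => By.
  by rewrite -(flag_rk_inj fB By Bx ry).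
by have := s y; rewrite !inE Ay nBy ry => /(_ isT).
Qed.

Lemma jadj_mem j (A B : {set F}) x :
  jadj le rk j A B -> x \in A -> rk x != j.+1 -> x \in B.
Proof.
case/and4P => _ _ _ /subsetP s Ax; apply: contraNT => nBx.
by have := s x; rewrite !inE Ax nBx => /(_ isT).
Qed.

Lemma jadj_flagl j (A B : {set F}) : jadj le rk j A B -> is_flag le A.
Proof. by case/and4P. Qed.
Lemma jadj_flagr j (A B : {set F}) : jadj le rk j A B -> is_flag le B.
Proof. by case/and4P. Qed.

Lemma jadj_nmem j (A B : {set F}) x :
  jadj le rk j A B -> x \in A -> rk x = j.+1 -> x \notin B.
Proof.
move=> jAB Ax rx; apply/negP => Bx.
case/and4P: (jAB) => fA fB /eqP[]; apply: flag_sub_eq => //.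
apply/subsetP => z Az; have [rz|] := eqVneq (rk z) j.+1; last exact: jadj_mem jAB Az.
by rewrite (flag_rk_inj fA Az Ax) // rz.
Qed.

Let flag_plt (A : {set F}) x y :
  is_flag le A -> x \in A -> y \in A -> rk x < rk y -> plt le x y.
Proof.
move=> fA Ax Ay l; rewrite /plt (flag_le fA) ?(ltnW l) // andbT.
by apply: contraTneq l => ->; rewrite ltnn.
Qed.

(** The diamond condition: only two faces lie between the faces of stored ranks [j] and [j.+2], and
    one of them belongs to [A]. *)
Lemma jadj_uniq j (A B C : {set F}) :
  j < 4 -> jadj le rk j A B -> jadj le rk j A C -> B = C.
Proof.
move=> j4 jB jC; have fA := jadj_flagl jB.
have [fB fC] := (jadj_flagr jB, jadj_flagr jC).
have [j0 j1 j2] := lt4_lt6 j4.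
have [x Ax rx] := flag_face fA j1.
have [y Ay ry] := flag_face fA j0.
have [z Az rz] := flag_face fA j2.
have [xB xBB rB] := flag_face fB j1.
have [xC xCC rC] := flag_face fC j1.
have card2 : #|[set t | plt le y t && plt le t z]| = 2.
  case: preP => _ _ _ [_]; apply; last by rewrite ry rz.
  by apply: (flag_plt fA) => //; rewrite ry rz.
have mB : forall D xD, jadj le rk j A D -> xD \in D -> rk xD = j.+1 ->
    xD \in [set t | plt le y t && plt le t z] :\ x.
  move=> D xD jD DxD rD; have fD := jadj_flagr jD.
  rewrite !inE; apply/and3P; split.
  - apply: contraTneq DxD => ->; exact: jadj_nmem jD Ax rx.
  - apply: (flag_plt fD) => //; last by rewrite ry rD.
    by apply: jadj_mem jD Ay _; rewrite ry neq_ltn ltnS leqnn.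
  - apply: (flag_plt fD) => //; last by rewrite rz rD.
    by apply: jadj_mem jD Az _; rewrite rz neq_ltn ltnS leqnn orbT.
have c1 : #|[set t | plt le y t && plt le t z] :\ x| = 1.
  have := cardsD1 x [set t | plt le y t && plt le t z].
  rewrite card2 !inE (flag_plt fA) //= ?(flag_plt fA) //= ?rx ?ry ?rz //.
  by rewrite add1n => -[].
have exy : xB = xC.
  move/eqP/cards1P: c1 => [w ew].
  have := mB B xB jB xBB rB; have := mB C xC jC xCC rC.
  by rewrite ew !inE => /eqP-> /eqP->.
apply: flag_sub_eq => //; apply/subsetP => t Bt.
have [rt|nt] := eqVneq (rk t) j.+1.
  by rewrite (flag_rk_inj fB Bt xBB) ?rt ?rB // exy.
apply: (jadj_mem jC) (nt); exact: (jadj_mem (jadj_sym jB)).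
Qed.

(** The other face of the diamond replaces [x]; it is comparable with the rest of the flag through
    the neighbours [y] and [z]. *)
Lemma jadj_adj j (A : {set F}) :
  is_flag le A -> j < 4 -> jadj le rk j A (adj le rk j A).
Proof.
move=> fA j4; rewrite /adj; case: pickP => //= no.
have [j0 j1 j2] := lt4_lt6 j4.
have [x Ax rx] := flag_face fA j1.
have [y Ay ry] := flag_face fA j0.
have [z Az rz] := flag_face fA j2.
have card2 : #|[set t | plt le y t && plt le t z]| = 2.
  case: preP => _ _ _ [_]; apply; last by rewrite ry rz.
  by apply: (flag_plt fA) => //; rewrite ry rz.
have /eqP/cards1P[x' ex'] : #|[set t | plt le y t && plt le t z] :\ x| = 1.
  have := cardsD1 x [set t | plt le y t && plt le t z].
  rewrite card2 !inE (flag_plt fA) //= ?(flag_plt fA) //= ?rx ?ry ?rz //.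
  by rewrite add1n => -[].
have: x' \in [set x'] by rewrite inE.
rewrite -ex' !inE => /and3P[nx' lyx' lx'z].
have rx' : rk x' = j.+1.
  by apply/eqP; rewrite eqn_leq -ltnS -{1}rz plt_rk //= -ry plt_rk.
have nAx' : x' \notin A.
  by apply: contra nx' => Ax'; rewrite (flag_rk_inj fA Ax' Ax) // rx rx'.
have lyx : le y x' by case/andP: lyx'.
have lxz : le x' z by case/andP: lx'z.
have cmp u : u \in A -> u != x -> le u x' || le x' u.
  move=> Au nu; have [ru|ru] := leqP (rk u) j.
    by rewrite (le_trans _ lyx) // (flag_le fA) // ry.
  rewrite (@le_trans x' z u) ?orbT // (flag_le fA) // rz ltn_neqAle ru andbT.
  by apply: contraNneq nu => e; rewrite (flag_rk_inj fA Au Ax) // rx.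
have fB : is_flag le (x' |: (A :\ x)).
  rewrite flagE cardsU1 !inE (negPf nAx') andbF.
  have := cardsD1 x A; rewrite Ax (flag_card fA) add1n => -[<-] /=; rewrite andbT.
  apply/is_chainP => u v /setU1P[->|/setD1P[nu Au]] /setU1P[->|/setD1P[nv Av]].
  - by rewrite lexx.
  - by rewrite orbC cmp.
  - by rewrite cmp.
  - exact: (is_chainP _ (flag_chain fA)).
have := no (x' |: (A :\ x)); rewrite /jadj fA fB /= => /negbT.
rewrite negb_and negbK => /orP[/eqP e|/negP[]].
  by move: Ax; rewrite e !inE eqxx orbF => /eqP e'; move: nx'; rewrite e' eqxx.
apply/subsetP => u /setDP[Au]; rewrite !inE Au andbT negb_or negbK.
by case/andP => _ /eqP->; rewrite rx.
Qed.

Lemma adjE j (A B : {set F}) : j < 4 -> jadj le rk j A B -> adj le rk j A = B.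
Proof.
move=> j4 jB; apply: (jadj_uniq j4) (jB).
by apply: jadj_adj => //; apply: jadj_flagl jB.
Qed.

Lemma adj_flag j (A : {set F}) : is_flag le A -> j < 4 -> is_flag le (adj le rk j A).
Proof. by move=> fA j4; apply: jadj_flagr (jadj_adj fA j4). Qed.

Lemma adjK j (A : {set F}) :
  is_flag le A -> j < 4 -> adj le rk j (adj le rk j A) = A.
Proof. by move=> fA j4; apply: adjE => //; apply/jadj_sym/jadj_adj. Qed.

Lemma adj_mem j (A : {set F}) x :
  is_flag le A -> j < 4 -> x \in A -> rk x != j.+1 -> x \in adj le rk j A.
Proof. by move=> fA j4; apply: jadj_mem (jadj_adj fA j4). Qed.

Lemma jadj_adjacent j (A B : {set F}) : jadj le rk j A B -> adjacent le A B.
Proof.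
move=> jAB; rewrite /adjacent (jadj_flagl jAB) (jadj_flagr jAB) /=.
case/and4P: (jAB) => fA fB nAB /subsetP s.
have [x] : exists x, x \in A :\: B.
  apply/set0Pn; apply: contra nAB; rewrite setD_eq0 => sAB.
  by apply/eqP; apply: flag_sub_eq.
move=> xD; suff -> : A :\: B = [set x] by rewrite cards1.
apply/setP => y; rewrite inE; apply/idP/eqP => [yD|->//].
have := s y yD; have := s x xD; rewrite !inE => /eqP rx /eqP ry.
by case/setDP: yD => Ay _; case/setDP: xD => Ax _; apply: (flag_rk_inj fA); rewrite ?rx.
Qed.

(** Faces of stored rank 0 or 5 are the least and the greatest one and lie in every flag, so the
    differing face has stored rank 1 to 4. *)
Lemma adjacent_jadj (A B : {set F}) :
  adjacent le A B -> exists2 j, j < 4 & jadj le rk j A B.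
Proof.
case/and3P => fA fB /cards1P[x eD].
have /setDP[Ax nBx] : x \in A :\: B by rewrite eD inE.
have [[m hm] [M hM]] : (exists m, forall x, le m x) /\ (exists M, forall x, le x M).
  by case: preP.
have [y By ry] := flag_face fB (rk_le5 x : rk x < 6).
have r0 : 0 < rk x.
  rewrite lt0n; apply: contra nBx => /eqP r0.
  suff e : forall z, rk z = 0 -> z = m by rewrite (e x r0) -(e y) // ry.
  move=> z rz; apply: le_anti => //; have := @plt_rk m z.
  rewrite /plt hm rz ltn0 andbT; case: eqP => [->//|_ /(_ isT)//].
have r5 : rk x < 5.
  rewrite ltn_neqAle rk_le5 andbT; apply: contra nBx => /eqP r5.
  suff e : forall z, rk z = 5 -> z = M by rewrite (e x r5) -(e y) // ry.
  move=> z rz; apply: le_anti => //; have := @plt_rk z M.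
  rewrite /plt hM rz ltnNge rk_le5 andbT; case: eqP => [->//|_ /(_ isT)//].
case e: (rk x) r0 r5 => [//|j] _ j4; exists j => //.
rewrite /jadj fA fB eD sub1set !inE e eqxx andbT /=.
by apply: contraNneq nBx => <-.
Qed.

(** Automorphisms are only required to preserve the order; this count expresses the rank by the
    order, so that they preserve ranks too. *)
Lemma rkE (A : {set F}) x :
  is_flag le A -> x \in A -> rk x = #|[set z in A | plt le z x]|.
Proof.
move=> fA Ax; have -> : [set z in A | plt le z x] = [set z in A | rk z < rk x].
  apply/setP => z; rewrite !inE; case Az: (z \in A) => //=.
  by apply/idP/idP => [/plt_rk//|]; apply: flag_plt fA Az Ax.
rewrite -(card_in_imset (f := ork)); last first.
  move=> u v; rewrite !inE => /andP[Au _] /andP[Av _].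
  exact: ork_chain_inj (flag_chain fA) _ _ Au Av.
have -> : ork @: [set z in A | rk z < rk x] = [set i : 'I_6 | i < rk x].
  apply/setP => i; rewrite inE; apply/imsetP/idP => [[z]|li].
    by rewrite inE => /andP[Az lz] ->; rewrite orkE.
  have [z Az rz] := flag_face fA (ltn_ord i).
  by exists z; [rewrite inE Az rz|apply: val_inj; rewrite /= orkE].
rewrite -sum1dep_card -(big_ord_widen 6 (fun=> 1)) ?sum1_card ?card_ord //.
exact: leq_trans (rk_le5 x) _.
Qed.

Lemma pautP (g : {perm F}) :
  reflect (forall x y, le (g x) (g y) = le x y) (g \in paut le).
Proof.
rewrite inE; apply: (iffP forallP) => [h x y|h x]; first exact/eqP/(forallP (h x)).
by apply/forallP => y; rewrite h.
Qed.

Lemma paut1 : 1%g \in paut le.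
Proof. by apply/pautP => x y; rewrite !perm1. Qed.

Lemma pautM (g h : {perm F}) : g \in paut le -> h \in paut le -> (g * h)%g \in paut le.
Proof. by move=> /pautP hg /pautP hh; apply/pautP => x y; rewrite !permM hh hg. Qed.

Lemma paut_group_set : group_set (paut le).
Proof. by apply/group_setP; split; [exact: paut1|move=> g h; exact: pautM]. Qed.

Canonical paut_group := Group paut_group_set.

Lemma imset_permM (g h : {perm F}) (A : {set F}) : (g * h)%g @: A = h @: (g @: A).
Proof.
rewrite -imset_comp; apply: eq_imset => x /=; exact: permM.
Qed.

Lemma imset_perm1 (A : {set F}) : (1%g : {perm F}) @: A = A.
Proof. by rewrite -[RHS]imset_id; apply: eq_imset => x; exact: perm1. Qed.

Lemma imset_permK (g : {perm F}) (A : {set F}) : (g^-1)%g @: (g @: A) = A.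
Proof. by rewrite -imset_permM mulgV imset_perm1. Qed.

Lemma paut_flag (g : {perm F}) (A : {set F}) :
  g \in paut le -> is_flag le A -> is_flag le (g @: A).
Proof.
move=> /pautP hg fA; rewrite flagE card_imset ?flag_card //; last exact: perm_inj.
rewrite andbT; apply/is_chainP => _ _ /imsetP[x Ax ->] /imsetP[y Ay ->].
by rewrite !hg; apply: (is_chainP _ (flag_chain fA)).
Qed.

Lemma paut_plt (g : {perm F}) x y : g \in paut le -> plt le (g x) (g y) = plt le x y.
Proof. by move=> /pautP hg; rewrite /plt hg (inj_eq perm_inj). Qed.

Lemma paut_rk (g : {perm F}) x : g \in paut le -> rk (g x) = rk x.
Proof.
move=> hg; have [A fA Ax] := flag_of x.
rewrite (rkE fA Ax) (rkE (paut_flag hg fA)) ?imset_f //.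
rewrite -[RHS](card_imset _ (@perm_inj _ g)); congr #|pred_of_set _|; apply/setP => z.
rewrite inE; apply/andP/imsetP => [[/imsetP[u Au ->]]|[u]].
  by rewrite paut_plt // => l; exists u; rewrite // inE Au.
by rewrite inE => /andP[Au l] ->; rewrite imset_f // paut_plt.
Qed.

Lemma paut_jadj (g : {perm F}) j (A B : {set F}) :
  g \in paut le -> jadj le rk j A B -> jadj le rk j (g @: A) (g @: B).
Proof.
move=> hg /and4P[fA fB nAB /subsetP s]; apply/and4P; split; try exact: paut_flag.
  by rewrite (inj_eq (imset_inj (@perm_inj _ g))).
apply/subsetP => _ /setDP[/imsetP[x Ax ->]].
rewrite mem_imset; last exact: perm_inj.
by move=> nBx; have := s x; rewrite !inE Ax nBx paut_rk // => /(_ isT).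
Qed.

Lemma paut_adj (g : {perm F}) j (A : {set F}) : g \in paut le -> is_flag le A -> j < 4 ->
  adj le rk j (g @: A) = g @: adj le rk j A.
Proof. by move=> hg fA j4; apply: adjE => //; apply: paut_jadj (jadj_adj _ _). Qed.

Lemma same_orbit_sym (A B : {set F}) : same_orbit le A B -> same_orbit le B A.
Proof.
by case=> g hg <-; exists g^-1%g; [exact: groupVr|rewrite imset_permK].
Qed.

Lemma same_orbit_trans (A B C : {set F}) :
  same_orbit le A B -> same_orbit le B C -> same_orbit le A C.
Proof.
by case=> g hg <- [h hh <-]; exists (g * h)%g; [exact: groupM|rewrite imset_permM].
Qed.

Lemma same_orbit_refl (A : {set F}) : same_orbit le A A.
Proof. by exists 1%g; [exact: group1|rewrite imset_perm1]. Qed.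

End Flags.

Lemma polytope4_pre (F : finType) (le : rel F) rk :
  polytope4 le rk -> prepolytope le rk.
Proof. by case. Qed.

(** Strong flag-connectedness as an induction principle. The path stays above [A :&: B], so its
    moves avoid the ranks of the common faces. *)
Lemma flag_ind (F : finType) (le : rel F) rk (Q : {set F} -> Prop) A B :
  polytope4 le rk -> is_flag le A -> is_flag le B -> Q A ->
  (forall C j, is_flag le C -> A :&: B \subset C -> j < 4 ->
     (forall x, x \in A :&: B -> rk x != j.+1) -> Q C -> Q (adj le rk j C)) ->
  Q B.
Proof.
move=> polyP fA fB QA step; have preP := polytope4_pre polyP.
case: polyP => _ _ _ _ /(_ A B fA fB) /connectP[p pth ->].
suff gen C : is_flag le C -> Q C ->
    path (fun C D => [&& adjacent le C D, A :&: B \subset C & A :&: B \subset D]) C p ->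
    Q (last C p) by exact: gen pth.
elim: p C {pth} => //= D p IH C fC QC /andP[/and3P[aCD sC sD] pth].
have [j j4 jCD] := adjacent_jadj preP aCD.
apply: IH (pth); first exact: jadj_flagr jCD.
rewrite -(adjE preP j4 jCD); apply: step => // x xAB.
apply/negP => /eqP rx; have := jadj_nmem preP jCD (subsetP sC x xAB) rx.
by rewrite (subsetP sD).
Qed.

Lemma flag_ind_all (F : finType) (le : rel F) rk (Q : {set F} -> Prop) A :
  polytope4 le rk -> is_flag le A -> Q A ->
  (forall C j, is_flag le C -> j < 4 -> Q C -> Q (adj le rk j C)) ->
  forall B, is_flag le B -> Q B.
Proof.
by move=> polyP fA QA step B fB; apply: (flag_ind polyP fA fB QA) => C j fC _ j4 _; apply: step.
Qed.

(** * Maps of faces that commute with the moves on flags *)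

Section Coverings.
Variables (F F' : finType) (le : rel F) (le' : rel F') (rk : F -> nat) (rk' : F' -> nat).
Hypotheses (polyP : polytope4 le rk) (polyP' : polytope4 le' rk').
Let preP := polytope4_pre polyP.
Let preP' := polytope4_pre polyP'.
Local Notation adjF := (adj le rk).
Local Notation adjF' := (adj le' rk').

(** Common to automorphisms and coverings, so that rigidity applies to their composites as well. *)
Definition flag_hom (c : F -> F') :=
  (forall x, rk' (c x) = rk x) /\
  (forall j A B, jadj le rk j A B -> jadj le' rk' j (c @: A) (c @: B)).

Lemma flag_hom_adj c j A : flag_hom c -> is_flag le A -> j < 4 ->
  c @: adjF j A = adjF' j (c @: A).
Proof. by move=> [_ h] fA j4; rewrite (adjE preP' j4 (h _ _ _ (jadj_adj preP fA j4))). Qed.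

Lemma flag_hom_flag c A : flag_hom c -> is_flag le A -> is_flag le' (c @: A).
Proof. by move=> [_ h] fA; apply: jadj_flagl (h _ _ _ (jadj_adj preP fA (isT : 0 < 4))). Qed.

(** Agreement on one flag spreads to all flags along the moves; within a flag, faces are told apart
    by their ranks. *)
Lemma flag_hom_rigid (c1 c2 : F -> F') A : flag_hom c1 -> flag_hom c2 ->
  is_flag le A -> c1 @: A = c2 @: A -> c1 =1 c2.
Proof.
move=> h1 h2 fA eA x; have [B fB Bx] := flag_of preP x.
have eB : c1 @: B = c2 @: B.
  apply: (flag_ind_all (Q := fun C => c1 @: C = c2 @: C) polyP fA eA _ fB) => C j fC j4 eC.
  by rewrite !flag_hom_adj // eC.
have: c1 x \in c2 @: B by rewrite -eB imset_f.
case/imsetP => y By e; rewrite e; congr c2; apply: (flag_rk_inj preP fB) => //.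
by case: h1 => r1 _; case: h2 => r2 _; rewrite -r2 -e r1.
Qed.

(** A path from [c @: A] to [B] that keeps [c x] lifts move by move to flags through [x]. *)
Lemma flag_hom_lift c A x B : flag_hom c -> is_flag le A -> x \in A ->
  is_flag le' B -> c x \in B ->
  exists A', [/\ is_flag le A', x \in A' & c @: A' = B].
Proof.
move=> hc fA Ax fB Bx.
apply: (flag_ind (Q := fun B => exists A', [/\ is_flag le A', x \in A' & c @: A' = B])
         polyP' (flag_hom_flag hc fA) fB); first by exists A.
move=> C j fC _ j4 nx [A' [fA' A'x <-]]; exists (adjF j A'); split.
- exact: adj_flag.
- apply: adj_mem => //; rewrite -(proj1 hc); apply: nx.
  by rewrite inE Bx andbT imset_f.
- exact: flag_hom_adj.
Qed.

End Coverings.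

Lemma paut_flag_hom (F : finType) (le : rel F) rk (g : {perm F}) :
  prepolytope le rk -> g \in paut le -> flag_hom le le rk rk g.
Proof. by move=> preP hg; split=> [x|j A B]; [apply: (paut_rk preP)|apply: paut_jadj]. Qed.

Lemma flag_hom_comp (F F' F'' : finType) (le : rel F) (le' : rel F') (le'' : rel F'')
    rk rk' rk'' (c : F -> F') (c' : F' -> F'') :
  flag_hom le le' rk rk' c -> flag_hom le' le'' rk' rk'' c' ->
  flag_hom le le'' rk rk'' (c' \o c).
Proof.
move=> [r h] [r' h']; split=> [x|j A B /h/h']; first by rewrite /= r' r.
by rewrite !(imset_comp c' c).
Qed.

Section Semiregular.
Variables (F : finType) (le : rel F) (rk : F -> nat).
Hypothesis polyP : polytope4 le rk.
Let preP := polytope4_pre polyP.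
Local Notation adjF := (adj le rk).

Lemma paut_rigid (g h : {perm F}) A : g \in paut le -> h \in paut le ->
  is_flag le A -> g @: A = h @: A -> g = h.
Proof.
move=> hg hh fA e; apply/permP.
by apply: (flag_hom_rigid polyP polyP _ _ fA e); apply: paut_flag_hom.
Qed.

(* Faces of rank i are the classes of flags connected by moves of rank <> i, so a
   map of flags commuting with all moves acts on the faces. *)
Lemma flag_map_paut (phi : {set F} -> {set F}) :
  (forall A, is_flag le A -> is_flag le (phi A)) ->
  (forall A j, is_flag le A -> j < 4 -> phi (adjF j A) = adjF j (phi A)) ->
  exists2 g : {perm F}, g \in paut le & forall A, is_flag le A -> g @: A = phi A.
Proof.
move=> phi_flag phi_adj.
have key x : exists y, forall A, is_flag le A -> x \in A -> y \in phi A /\ rk y = rk x.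
  have [A fA Ax] := flag_of preP x.
  have r6 : rk x < 6 by case: (polyP) => _ [_ h] _ _ _; rewrite ltnS.
  have [y yA ry] := flag_face preP (phi_flag _ fA) r6.
  exists y => B fB Bx; split=> //.
  apply: (flag_ind (Q := fun C => y \in phi C) polyP fA fB yA) => C j fC _ j4 nr yC.
  rewrite phi_adj //; apply: adj_mem; rewrite ?ry //; first exact: phi_flag.
  by apply: nr; rewrite inE Ax Bx.
have [g gP] := fin_all_exists key.
have phi_onto C : is_flag le C -> exists2 A, is_flag le A & phi A = C.
  have [[m _] _] : (exists m, forall x, le m x) /\ (exists M, forall x, le x M) by case: polyP.
  have [A fA _] := flag_of preP m.
  apply: (flag_ind_all (Q := fun C => exists2 A, is_flag le A & phi A = C)
            polyP (phi_flag _ fA)); first by exists A.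
  move=> D j fD j4 [B fB <-]; exists (adjF j B); last exact: phi_adj.
  exact: adj_flag.
have lift C y : is_flag le C -> y \in phi C -> exists2 x, x \in C & g x = y.
  move=> fC yC; have r6 : rk y < 6 by case: (polyP) => _ [_ h] _ _ _; rewrite ltnS.
  have [x Cx rx] := flag_face preP fC r6; exists x => //.
  have [gC rg] := gP x C fC Cx.
  by apply: (flag_rk_inj preP (phi_flag _ fC)); rewrite // rg rx.
have g_onto y : exists x, g x = y.
  have [C fC Cy] := flag_of preP y; have [A fA eA] := phi_onto C fC.
  by have [|x _ <-] := lift A y fA; [rewrite eA|exists x].
(* A section of [g] is injective, hence bijective on a finite type, and [g] is its inverse. *)
have g_inj : injective g.
  have [f fK] := fin_all_exists g_onto; have fK' : cancel f g by [].
  exact: (can_inj (canF_sym fK')).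
have le_g x y : le x y -> le (g x) (g y).
  move=> lxy; have [A [fA Ax Ay]] := flag_of_le preP lxy.
  have [[gx rx] [gy ry]] := (gP x A fA Ax, gP y A fA Ay).
  by apply: (flag_le preP (phi_flag _ fA)); rewrite ?rx ?ry ?(le_rk preP).
exists (perm g_inj).
  apply/pautP => x y; rewrite !permE; apply/idP/idP => [l|]; last exact: le_g.
  have [C [fC Cx Cy]] := flag_of_le preP l; have [A fA eA] := phi_onto C fC.
  have [|x' Ax' ex] := lift A (g x) fA; first by rewrite eA.
  have [|y' Ay' ey] := lift A (g y) fA; first by rewrite eA.
  rewrite -(g_inj _ _ ex) -(g_inj _ _ ey); apply: (flag_le preP fA) => //.
  have := le_rk preP l; rewrite -ex -ey.
  by have [_ ->] := gP x' A fA Ax'; have [_ ->] := gP y' A fA Ay'.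
move=> A fA; apply/eqP; rewrite eqEcard card_imset; last exact: perm_inj.
rewrite (flag_card preP fA) (flag_card preP (phi_flag _ fA)) leqnn andbT.
by apply/subsetP => _ /imsetP[x Ax ->]; rewrite permE; have [] := gP x A fA Ax.
Qed.

End Semiregular.

(** * Chiral polytopes and their coverings *)

Section Chiral.
Variables (F : finType) (le : rel F) (rk : F -> nat).
Hypotheses (polyP : polytope4 le rk) (chirP : chiral le).
Let preP := polytope4_pre polyP.
Local Notation adjF := (adj le rk).

Lemma chiral_adj j A : is_flag le A -> j < 4 -> ~ same_orbit le A (adjF j A).
Proof. by move=> fA j4; case: chirP => h _; apply: h; apply/jadj_adjacent/jadj_adj. Qed.

(** White flags are those in the orbit of [Phi]. There are two orbits and no move stays in one, so
    every move changes the colour. *)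
Lemma white_adj Phi j A : is_flag le Phi -> is_flag le A -> j < 4 ->
  same_orbit le Phi (adjF j A) <-> ~ same_orbit le Phi A.
Proof.
move=> fP fA j4; have nA := chiral_adj fA j4; split=> [w w'|nw].
  by apply: nA; apply: same_orbit_trans w; apply: same_orbit_sym.
by case: chirP => _ /(_ Phi A (adjF j A) fP fA (adj_flag preP fA j4)) [].
Qed.

Lemma white_or_black Phi A : is_flag le Phi -> is_flag le A ->
  same_orbit le Phi A \/ same_orbit le (adjF 1 Phi) A.
Proof.
move=> fP fA; have fP1 := adj_flag preP fP (isT : 1 < 4).
case: chirP => _ /(_ Phi (adjF 1 Phi) A fP fP1 fA) [].
- by move/(chiral_adj fP (isT : 1 < 4)).
- by left.
- by right.
Qed.

Lemma nflags_chiral Phi : is_flag le Phi -> nflags le = 2 * #|paut le|.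
Proof.
move=> fP; have fP1 := adj_flag preP fP (isT : 1 < 4).
pose orb (A : {set F}) := [set (g : {perm F}) @: A | g in paut le].
have card_orb A : is_flag le A -> #|orb A| = #|paut le|.
  move=> fA; apply: card_in_imset => g h hg hh; exact: paut_rigid polyP _ _ _ hg hh fA.
have -> : nflags le = #|orb Phi :|: orb (adjF 1 Phi)|.
  rewrite /nflags; congr #|pred_of_set _|; apply/setP => A; rewrite !inE.
  apply/idP/orP => [fA|[]/imsetP[g hg ->]]; try exact: (paut_flag preP).
  by case: (white_or_black fP fA) => -[g hg <-]; [left|right]; apply: imset_f.
rewrite cardsU !card_orb // (_ : _ :&: _ = set0) ?cards0 ?subn0 ?mul2n ?addnn //.
apply/setP => A; rewrite !inE; apply/negP => /andP[/imsetP[g hg ->] /imsetP[h hh e]].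
apply: (chiral_adj fP (isT : 1 < 4)); apply: (@same_orbit_trans _ _ _ (g @: Phi)).
  by exists g.
by apply: same_orbit_sym; exists h.
Qed.

(** The rotation [s] fixes the base faces outside stored ranks [i.+1] and [i.+2], and its powers act
    simply transitively on the faces of stored rank [i.+1] between [x] and [y]. *)
Lemma sect_count_flag Phi i (s : {perm F}) x y : is_flag le Phi -> i < 3 ->
  s \in paut le -> s @: Phi = adjF i (adjF i.+1 Phi) ->
  x \in Phi -> y \in Phi -> rk x = i -> rk y = i.+3 ->
  sect_count le rk i.+1 x y = #[s]%g.
Proof.
move=> fP i3 hs es Px Py rx ry.
have [i4 i14 i6 i7] : [/\ i < 4, i.+1 < 4, i.+1 < 6 & i < 6].
  by case: i i3 {es rx ry} => [|[|[|]]].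
have fP1 := adj_flag preP fP i14.
have sP : <[s]>%g \subset paut le by rewrite cycle_subG.
have hsg g : g \in <[s]>%g -> g \in paut le by move/(subsetP sP).
have [u Pu ru] := flag_face preP fP i6.
have es1 : adjF i.+1 Phi = s @: adjF i Phi.
  by rewrite -(paut_adj preP) // es adjK.
have fix_s z : z \in Phi -> rk z != i.+1 -> rk z != i.+2 -> s z = z.
  move=> Pz n1 n2; have zs : z \in s @: Phi.
    by rewrite es; apply: adj_mem => //; apply: adj_mem.
  have := imset_f s Pz => sz.
  by apply: (flag_rk_inj preP (paut_flag preP hs fP)); rewrite ?(paut_rk preP).
have fix_g g z : g \in <[s]>%g -> z \in Phi -> rk z != i.+1 -> rk z != i.+2 -> g z = z.
  move=> /cycleP[n ->] Pz n1 n2; elim: n => [|n IH]; first by rewrite expg0 perm1.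
  by rewrite expgS permM fix_s.
(* A power of [s] fixing [u] can move only one face of [Phi]; chirality forbids sending [Phi] to an
   adjacent flag, so the power is trivial. *)
have inj_u : {in <[s]>%g &, injective (fun g : {perm F} => g u)}.
  suff stab g : g \in <[s]>%g -> g u = u -> g = 1%g.
    move=> g h hg hh e; apply/eqP; rewrite eq_mulgV1; apply/eqP; apply: stab.
      by rewrite groupM ?groupV.
    by rewrite permM e permK.
  move=> hg gu; apply: (paut_rigid polyP (hsg _ hg) (paut1 _) fP).
  rewrite imset_perm1; apply/eqP; apply: contraT => ne.
  case: (chiral_adj fP i14); exists g; first exact: hsg.
  rewrite (adjE preP i14 (B := g @: Phi)) //.
  rewrite /jadj fP (paut_flag preP (hsg _ hg) fP) eq_sym ne /=.
  apply/subsetP => z /setDP[Pz nz]; rewrite inE; apply: contraNT nz => n2.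
  have [r1|n1] := eqVneq (rk z) i.+1; last first.
    by rewrite -(fix_g g z) // imset_f.
  by rewrite (flag_rk_inj preP fP Pz Pu) ?r1 ?ru // -gu imset_f.
rewrite /order -(card_in_imset inj_u) /sect_count; congr #|pred_of_set _|.
apply/setP => z; rewrite inE; apply/and3P/imsetP => [[lxz lzy /eqP rz]|[g hg ->]]; last first.
  rewrite (paut_rk preP) ?hsg // ru eqxx; split=> //.
    rewrite -(fix_g g x) ?rx ?neq_ltn ?ltnS ?leqnn //.
      by rewrite (pautP _ _ (hsg _ hg)) (flag_le preP fP) // rx ru.
    by rewrite leqnSn.
  rewrite -(fix_g g y) ?ry ?neq_ltn ?ltnS ?leqnn ?orbT //.
    by rewrite (pautP _ _ (hsg _ hg)) (flag_le preP fP) // ry ru ltnW.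
  by rewrite leqnSn orbT.
pose S := z |: [set t in Phi | (rk t != i.+1) && (rk t != i.+2)].
have le_tr a b c : le a b -> le b c -> le a c by case: (preP) => -[_ _ h] _ _ _; apply: h.
have cS : is_chain le S.
  have cz t : t \in Phi -> rk t != i.+1 -> rk t != i.+2 -> le t z || le z t.
    move=> Pt n1 n2; have [l|] := leqP (rk t) i.
      by rewrite (le_tr t x z) // (flag_le preP fP) // rx.
    rewrite leq_eqVlt eq_sym (negPf n1) /= leq_eqVlt eq_sym (negPf n2) /= => l.
    by rewrite (le_tr z y t) ?orbT // (flag_le preP fP) // ry.
  apply/is_chainP => a b /setU1P[->|]; last (rewrite inE => /and3P[Pa a1 a2]);
    move=> /setU1P[->|]; try (rewrite inE => /and3P[Pb b1 b2]).
  - by case: (preP) => -[-> ].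
  - by rewrite orbC cz.
  - exact: cz.
  - exact: (is_chainP _ _ (flag_chain fP)).
have [B fB sB] := chain_sub_flag cS.
have Bz : z \in B by apply: (subsetP sB); rewrite !inE eqxx.
(* Only the moves [i] and [i.+1] can occur on the way to [B]. Since
   [adjF i.+1 Phi = s @: adjF i Phi], both stay within the translates of [Phi] and [adjF i Phi] by
   powers of [s]. *)
have QB : exists2 g, g \in <[s]>%g & B = g @: Phi \/ B = g @: adjF i Phi.
  apply: (flag_ind (Q := fun B => exists2 g, g \in <[s]>%g &
            B = g @: Phi \/ B = g @: adjF i Phi) polyP fP fB).
    by exists 1%g; [exact: group1|left; rewrite imset_perm1].
  move=> C j fC _ j4 nj [g hg eC].
  have fPi := adj_flag preP fP i4.
  have /orP[/eqP ej|/eqP ej] : (j == i) || (j == i.+1).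
    apply: contraT; rewrite negb_or => /andP[ji ji1].
    have j6 : j.+1 < 6 by apply: ltn_trans (j4 : j.+1 < 5) _.
    have [t Pt rt] := flag_face preP fP j6.
    suff: rk t != j.+1 by rewrite rt eqxx.
    apply: nj; rewrite inE Pt; apply: (subsetP sB).
    by rewrite !inE Pt rt !eqSS ji ji1 orbT.
  - subst j; case: eC => ->; exists g => //; [right|left].
      by rewrite (paut_adj preP) // hsg.
    by rewrite (paut_adj preP) ?hsg ?adjK.
  - subst j; case: eC => ->.
      exists (s * g)%g; first by rewrite groupM ?cycle_id.
      by right; rewrite (paut_adj preP) ?hsg // es1 imset_permM.
    exists (s^-1 * g)%g; first by rewrite groupM ?groupV ?cycle_id.
    left; rewrite (paut_adj preP) ?hsg // imset_permM; congr imset.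
    rewrite -[adjF i Phi](imset_permK s) -es1 (paut_adj preP) ?adjK //.
    by rewrite groupV.
case: QB => g hg [eB|eB].
  exists g => //; apply: (flag_rk_inj preP fB) => //; first by rewrite eB imset_f.
  by rewrite (paut_rk preP) ?hsg ?ru.
exists (s^-1 * g)%g; first by rewrite groupM ?groupV ?cycle_id.
have hsg' : (s^-1 * g)%g \in <[s]>%g by rewrite groupM ?groupV ?cycle_id.
apply: (flag_rk_inj preP fB) => //; last by rewrite (paut_rk preP) ?hsg ?ru.
rewrite eB permM imset_f // -(imset_permK s (adjF i Phi)) -es1 imset_f //.
by apply: adj_mem; rewrite // ru neq_ltn ltnS leqnn.
Qed.

(** Of a flag through [x] and [y] and its [i.+1]-adjacent flag, which contains both faces too, one
    is white; a conjugate of [s] serves there as the rotation. *)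
Lemma sect_count_chiral Phi i (s : {perm F}) x y : is_flag le Phi -> i < 3 ->
  s \in paut le -> s @: Phi = adjF i (adjF i.+1 Phi) ->
  le x y -> rk x = i -> rk y = i.+3 -> sect_count le rk i.+1 x y = #[s]%g.
Proof.
move=> fP i3 hs es lxy rx ry.
have [i4 i14] : [/\ i < 4 & i.+1 < 4] by case: i i3 {es rx ry} => [|[|[|]]].
suff [g hg [Ax Ay]] : exists2 g, g \in paut le & x \in g @: Phi /\ y \in g @: Phi.
  rewrite -(orderJ s g); apply: (sect_count_flag (paut_flag preP hg fP)) => //.
    by rewrite groupJ.
  rewrite /conjg -!imset_permM mulKVg imset_permM es !(paut_adj preP) //.
  exact: adj_flag.
have [A [fA Ax Ay]] := flag_of_le preP lxy.
have fA' := adj_flag preP fA i14.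
case: chirP => _ /(_ Phi A _ fP fA fA') [[g hg e]|[g hg e]|/(chiral_adj fA i14)//];
  exists g; rewrite // e //.
by split; apply: adj_mem; rewrite // ?rx ?ry neq_ltn ?ltnS ?leqnSn ?leqnn ?orbT.
Qed.

End Chiral.

(** * Coverings between chiral polytopes and the induced quotient of groups *)

Section ChiralCovering.
Variables (F F' : finType) (le : rel F) (le' : rel F') (rk : F -> nat) (rk' : F' -> nat).
Hypotheses (polyP : polytope4 le rk) (polyP' : polytope4 le' rk').
Hypotheses (chirP : chiral le) (chirP' : chiral le').
Variables (c : F -> F') (Phi : {set F}).
Hypotheses (hc : flag_hom le le' rk rk' c) (c_onto : forall y, exists x, c x = y).
Hypothesis fP : is_flag le Phi.
Let preP := polytope4_pre polyP.
Let preP' := polytope4_pre polyP'.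
Local Notation adjF := (adj le rk).
Local Notation adjF' := (adj le' rk').
Let fP' : is_flag le' (c @: Phi) := flag_hom_flag polyP hc fP.

(** Every move changes the colour in both polytopes, so a covering preserves colours. *)
Lemma cover_white A : is_flag le A ->
  same_orbit le Phi A <-> same_orbit le' (c @: Phi) (c @: A).
Proof.
apply: (flag_ind_all (Q := fun A => same_orbit le Phi A <->
          same_orbit le' (c @: Phi) (c @: A)) polyP fP).
  by split=> _; apply: same_orbit_refl.
move=> C j fC j4 IH; rewrite (flag_hom_adj polyP polyP') //.
have fC' := flag_hom_flag polyP hc fC.
have := white_adj polyP chirP fP fC j4; have := white_adj polyP' chirP' fP' fC' j4.
by move: IH => [i1 i2] [h1 h2] [h3 h4]; split=> [/h3 n|/h1 n]; [apply: h2 => /i2|apply: h4 => /i1].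
Qed.

Lemma cover_flag_onto B : is_flag le' B -> exists2 A, is_flag le A & c @: A = B.
Proof.
apply: (flag_ind_all (Q := fun B => exists2 A, is_flag le A & c @: A = B) polyP' fP').
  by exists Phi.
move=> C j fC j4 [A fA <-]; exists (adjF j A); first exact: adj_flag.
exact: (flag_hom_adj polyP polyP').
Qed.

Lemma cover_intertwine (g : {perm F}) (g' : {perm F'}) :
  g \in paut le -> g' \in paut le' -> g' @: (c @: Phi) = c @: (g @: Phi) ->
  forall x, g' (c x) = c (g x).
Proof.
move=> hg hg' e; apply: (flag_hom_rigid polyP polyP' (A := Phi)) => //.
- by apply: (flag_hom_comp hc); apply: paut_flag_hom.
- by apply: flag_hom_comp hc; apply: paut_flag_hom.
- by rewrite (imset_comp g' c) (imset_comp c g).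
Qed.

Lemma cover_morphism : exists pi : {perm F} -> {perm F'},
  [/\ {in paut le &, {morph pi : g h / (g * h)%g}},
      pi @: paut le = paut le' &
      forall g, g \in paut le -> forall x, pi g (c x) = c (g x)].
Proof.
have key (g : {perm F}) : exists g' : {perm F'}, g \in paut le ->
    g' \in paut le' /\ forall x, g' (c x) = c (g x).
  (* The value at a permutation that is not an automorphism is a mere default. *)
  have [hg|] := boolP (g \in paut le); last by exists 1%g.
  have fg := paut_flag preP hg fP.
  have [|g' hg' e] := (cover_white fg).1; first by exists g.
  by exists g' => _; split=> //; apply: cover_intertwine.
have [pi piP] := fin_all_exists key; exists pi; split.
- move=> g h hg hh; apply/permP => y; have [x <-] := c_onto y.
  have [_ eg] := piP g hg; have [_ eh] := piP h hh.
  have [_ egh] := piP _ (pautM hg hh).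
  by rewrite egh !permM eg eh.
- apply/setP => g'; apply/imsetP/idP => [[g hg ->]|hg']; first by have [] := piP g hg.
  have [A fA eA] := cover_flag_onto (paut_flag preP' hg' fP').
  have [|g hg eg] := (cover_white fA).2; first by exists g'.
  exists g => //; have [hpg pg] := piP g hg.
  apply: (paut_rigid polyP' hg' hpg fP').
  rewrite -eA -eg -(imset_comp (pi g) c) -(imset_comp c g).
  by apply: eq_imset => x /=; rewrite pg.
- by move=> g hg; have [] := piP g hg.
Qed.

Section Morphism.
Variable pi : {perm F} -> {perm F'}.
Hypothesis piM : {in paut le &, {morph pi : g h / (g * h)%g}}.
Hypothesis pi_onto : pi @: paut le = paut le'.
Hypothesis piE : forall g, g \in paut le -> forall x, pi g (c x) = c (g x).

Lemma cover_intertwine_imset g (A : {set F}) : g \in paut le -> pi g @: (c @: A) = c @: (g @: A).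
Proof.
by move=> hg; rewrite -(imset_comp (pi g) c) -(imset_comp c g);
  apply: eq_imset => x /=; rewrite piE.
Qed.

Let pi_paut g : g \in paut le -> pi g \in paut le'.
Proof. by move=> hg; rewrite -pi_onto imset_f. Qed.

(** Equal orders make [pi] injective, hence [c] injective on white flags, then on all flags by a
    1-move. Two faces with the same image are compared by lifting a flag. *)
Lemma cover_inj : #|paut le'| = #|paut le| -> injective c.
Proof.
move=> ec; have pi_inj : {in paut le &, injective pi}.
  by apply/imset_injP; rewrite pi_onto ec.
have c_flag A B : is_flag le A -> is_flag le B -> c @: A = c @: B -> A = B.
  move=> fA fB; wlog [g hg eg] : A B fA fB / same_orbit le Phi A.
    move=> h e; have fA1 := adj_flag preP fA (isT : 1 < 4).
    have fB1 := adj_flag preP fB (isT : 1 < 4).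
    have [||w] : [\/ same_orbit le Phi A, same_orbit le Phi (adjF 1 A) | same_orbit le A (adjF 1 A)].
      by case: chirP => _; apply.
    - by move/h; apply.
    - move/h => /(_ _ fA1 fB1); rewrite !(flag_hom_adj polyP polyP') // e => /(_ erefl) e1.
      by rewrite -(adjK preP fA (isT : 1 < 4)) e1 adjK.
    - by case: (chiral_adj polyP chirP fA (isT : 1 < 4)).
  move=> e; have [|h hh eh] := (cover_white fB).2.
    by rewrite -e; apply/cover_white => //; exists g.
  rewrite -eg -eh; suff -> : g = h by []; apply: pi_inj => //.
  apply: (paut_rigid polyP' _ _ fP'); try exact: pi_paut.
  by rewrite !cover_intertwine_imset // eg eh.
move=> x y e; have [A fA Ax] := flag_of preP x; have [B fB By] := flag_of preP y.
have [||A' [fA' A'x eA']] := flag_hom_lift polyP polyP' hc fA Ax (B := c @: B).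
- exact: (flag_hom_flag polyP hc fB).
- by rewrite e imset_f.
have eAB := c_flag _ _ fA' fB eA'.
apply: (flag_rk_inj preP fB) => //; first by rewrite -eAB.
by rewrite -(proj1 hc x) e (proj1 hc).
Qed.

(* Mapping [pi g P'] to [tau g P1] and [pi g P1] to [tau g P'], where P' is the
   base flag and P1 its 1-adjacent flag, commutes with all moves, so it comes from
   a symmetry exchanging P' and P1. *)
Lemma cover_mirror (tau : {perm F} -> {perm F'}) (v : nat -> {perm F}) :
  {in paut le &, {morph tau : g h / (g * h)%g}} ->
  (forall g, g \in paut le -> tau g \in paut le') ->
  (forall g, g \in paut le -> pi g = 1%g -> tau g = 1%g) ->
  (forall j, j < 4 -> [/\ v j \in paut le, v j @: Phi = adjF 1 (adjF j Phi) &
                          tau (v j) = (pi (v j))^-1%g]) ->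
  False.
Proof.
move=> tauM tau_paut tau_ker vP.
have one4 : 1 < 4 by [].
have pi1 : pi 1%g = 1%g.
  have e := piM (paut1 le) (paut1 le); rewrite mulg1 in e.
  by apply: (mulgI (pi 1%g)); rewrite -e mulg1.
have piV g : g \in paut le -> pi g^-1%g = (pi g)^-1%g.
  by move=> hg; apply/eqP; rewrite eq_sym eq_invg_mul -piM ?groupV // mulgV pi1.
have tau1 : tau 1%g = 1%g by apply: tau_ker; rewrite ?paut1.
have tauV g : g \in paut le -> tau g^-1%g = (tau g)^-1%g.
  by move=> hg; apply/eqP; rewrite eq_sym eq_invg_mul -tauM ?groupV // mulgV tau1.
have tau_pi g h : g \in paut le -> h \in paut le -> pi g = pi h -> tau g = tau h.
  move=> hg hh e; apply/eqP; rewrite eq_mulgV1 -tauV // -tauM ?groupV //.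
  by apply/eqP; apply: tau_ker; rewrite ?groupM ?groupV // piM ?groupV // piV // e mulgV.
set P' := c @: Phi; set P1 := adjF' 1 P'.
have fP1 : is_flag le' P1 by apply: (adj_flag preP').
pose ex (A B : {set F'}) := [pick g in paut le | pi g @: A == B].
pose phi B := if ex P' B is Some g then tau g @: P1 else
              if ex P1 B is Some g then tau g @: P' else B.
have exP A B : is_flag le' A -> is_flag le' B ->
    if ex A B is Some g then g \in paut le /\ pi g @: A = B else ~ same_orbit le' A B.
  move=> fA fB; rewrite /ex; case: pickP => [g /andP[hg /eqP e]|no]; first by [].
  case=> g'; rewrite -pi_onto => /imsetP[g hg ->] e.
  by have := no g; rewrite hg e eqxx.
have phiW g : g \in paut le -> phi (pi g @: P') = tau g @: P1.
  move=> hg; rewrite /phi; have fg := paut_flag preP' (pi_paut hg) fP'.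
  have := exP P' _ fP' fg; case: (ex _ _) => [h [hh e]|[]]; last by exists (pi g); rewrite ?pi_paut.
  by rewrite (@tau_pi g h) //; apply: (paut_rigid polyP' _ _ fP'); rewrite ?pi_paut.
have phiB g : g \in paut le -> phi (pi g @: P1) = tau g @: P'.
  move=> hg; rewrite /phi; have fg := paut_flag preP' (pi_paut hg) fP1.
  have := exP P' _ fP' fg; case: (ex P' _) => [h [hh e]|_].
    case: (chiral_adj polyP' chirP' fP' one4).
    apply: (@same_orbit_trans _ _ _ (pi g @: P1)); first by exists (pi h); rewrite ?pi_paut.
    by apply: same_orbit_sym; exists (pi g); rewrite ?pi_paut.
  have := exP P1 _ fP1 fg; case: (ex P1 _) => [h [hh e]|[]]; last by exists (pi g); rewrite ?pi_paut.
  by rewrite (@tau_pi g h) //; apply: (paut_rigid polyP' _ _ fP1); rewrite ?pi_paut.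
have WB B : is_flag le' B -> exists2 g, g \in paut le & B = pi g @: P' \/ B = pi g @: P1.
  move=> fB; case: (white_or_black polyP' chirP' fP' fB) => -[g'];
    rewrite -pi_onto => /imsetP[g hg ->] <-; exists g => //; [by left|by right].
(* Together with [vB] this expresses move [j] by [pi (v j)] from [P'] and by its inverse from [P1].
   As [tau (v j)] is the inverse of [pi (v j)], [phi] exchanges the two rules. *)
have vW j : j < 4 -> adjF' j P' = pi (v j) @: P1.
  move=> j4; have [hv ev _] := vP j j4; have fj := adj_flag preP fP j4.
  rewrite -(paut_adj preP') ?pi_paut // cover_intertwine_imset // ev.
  by rewrite !(flag_hom_adj polyP polyP') // adjK //; apply: (adj_flag preP').
have vB j : j < 4 -> adjF' j P1 = (pi (v j))^-1%g @: P'.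
  move=> j4; have [hv ev _] := vP j j4.
  have eP : P' = adjF' j (pi (v j) @: P1) by rewrite -vW // adjK.
  rewrite eP -(paut_adj preP') ?groupV ?pi_paut ?imset_permK //.
  by apply: (paut_flag preP') => //; rewrite pi_paut.
have [||g' hg' eg'] := @flag_map_paut _ le' rk' polyP' phi.
- by move=> B /WB[g hg [->|->]]; rewrite ?phiW ?phiB //; apply: (paut_flag preP'); rewrite ?tau_paut.
- move=> B j /WB[g hg [->|->]] j4; have [hv ev tv] := vP j j4.
    rewrite phiW // !(paut_adj preP') ?pi_paut ?tau_paut //.
    by rewrite vW // -imset_permM -piM // phiB ?groupM // tauM // tv imset_permM vB.
  rewrite phiB // !(paut_adj preP') ?pi_paut ?tau_paut //.
  rewrite vB // -piV // -imset_permM -piM ?groupV // phiW ?groupM ?groupV //.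
  by rewrite tauM ?groupV // tauV // tv invgK imset_permM -vW.
apply: (chiral_adj polyP' chirP' fP' one4); exists g' => //.
by rewrite eg' // -[in LHS](imset_perm1 (c @: Phi)) -pi1 phiW ?paut1 // tau1 imset_perm1.
Qed.

End Morphism.
End ChiralCovering.

(** * Chirality from a group with two flag orbits and no mirror *)

Section ChiralCriterion.
Variables (F : finType) (le : rel F) (rk : F -> nat) (Phi : {set F}).
Variables (G : {group {perm F}}) (v : nat -> {perm F}).
Local Notation adjF := (adj le rk).
Hypotheses (polyP : polytope4 le rk) (fP : is_flag le Phi) (sG : G \subset paut le).
Hypothesis vP : forall j, j < 4 -> v j \in G /\ v j @: Phi = adjF 1 (adjF j Phi).
Hypothesis two_orbits : forall A, is_flag le A ->
  exists2 g, g \in G & A = g @: Phi \/ A = g @: adjF 1 Phi.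
Hypothesis no_mirror : forall f, f \in paut le -> f @: Phi <> adjF 1 Phi.
Let preP := polytope4_pre polyP.
Let fP1 : is_flag le (adjF 1 Phi) := adj_flag preP fP (isT : 1 < 4).
Let hG g : g \in G -> g \in paut le. Proof. by move/(subsetP sG). Qed.

Lemma criterion_paut : paut le = G.
Proof.
apply/eqP; rewrite eqEsubset sG andbT; apply/subsetP => h hh.
have [g hg [e|e]] := two_orbits (paut_flag preP hh fP).
  by rewrite (paut_rigid polyP hh (hG hg) fP e).
case: (@no_mirror (h * g^-1)%g); first by rewrite groupM ?groupV // hG.
by rewrite imset_permM e imset_permK.
Qed.

(** The elements [v j] write each move as a change between the two orbit representatives. A symmetry
    joining adjacent flags, translated by [G], would therefore take [Phi] to its 1-adjacent flag. *)
Lemma criterion_chiral : chiral le.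
Proof.
have vW j : j < 4 -> adjF j Phi = v j @: adjF 1 Phi.
  move=> j4; have [hv ev] := vP j4; rewrite -(paut_adj preP) ?hG // ev.
  by rewrite adjK //; apply: adj_flag.
have vB j : j < 4 -> adjF j (adjF 1 Phi) = (v j)^-1%g @: Phi.
  move=> j4; have [hv ev] := vP j4.
  have eP : Phi = adjF j (v j @: adjF 1 Phi) by rewrite -vW // adjK.
  rewrite {2}eP -(paut_adj preP) ?groupV ?hG ?imset_permK //.
  by apply: (paut_flag preP) => //; rewrite hG.
split=> [A B aAB [h hh e]|A B C fA fB fC].
  have [j j4 jAB] := adjacent_jadj preP aAB; have fA := jadj_flagl jAB.
  rewrite -(adjE preP j4 jAB) {B jAB aAB} in e; have [hv ev] := vP j4.
  have [g hg [eA|eA]] := two_orbits fA; rewrite eA in e.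
    case: (@no_mirror (g * h * (v j * g)^-1)%g).
      by rewrite !groupM ?groupV ?groupM // hG.
    rewrite !imset_permM e (paut_adj preP) ?hG // vW // -(imset_permM (v j) g).
    exact: imset_permK.
  case: (@no_mirror (g * h * ((v j)^-1 * g)^-1)%g).
    by rewrite !groupM ?groupV ?groupM ?groupV // hG.
  have hf : (g * h * ((v j)^-1 * g)^-1)%g \in paut le.
    by rewrite !groupM ?groupV ?groupM ?groupV // hG.
  rewrite -{1}(adjK preP fP (isT : 1 < 4)) -(paut_adj preP hf) //; congr adj.
  rewrite !imset_permM e (paut_adj preP) ?hG // vB // -(imset_permM (v j)^-1 g).
  exact: imset_permK.
have orb (D : {set F}) g h : g \in G -> h \in G -> same_orbit le (g @: D) (h @: D).
  move=> hg hh; exists (g^-1 * h)%g; first by rewrite groupM ?groupV ?hG.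
  by rewrite imset_permM imset_permK.
have [g hg [->|->]] := two_orbits fA; have [h hh [->|->]] := two_orbits fB;
  have [k hk [->|->]] := two_orbits fC;
  (by apply: Or31; apply: orb) || (by apply: Or32; apply: orb) || (by apply: Or33; apply: orb).
Qed.

(** Both [v j * f] and [f * (v j)^-1] take [Phi] to [adjF 1 (adjF j (adjF 1 Phi))], so rigidity
    identifies them. *)
Lemma mirror_conj f j : f \in paut le -> f @: Phi = adjF 1 Phi -> j < 4 ->
  (v j ^ f = (v j)^-1)%g.
Proof.
move=> hf ef j4; have [hv ev] := vP j4.
suff e : (v j * f = f * (v j)^-1)%g by rewrite conjgE e mulKg.
have fj := adj_flag preP fP j4.
apply: (paut_rigid polyP _ _ fP); try by rewrite groupM ?groupV // hG.
rewrite !imset_permM ev ef.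
have vV : (v j)^-1%g @: Phi = adjF j (adjF 1 Phi).
  rewrite -[in RHS](imset_permK (v j) (adjF 1 Phi)) -(paut_adj preP) ?hG // ev.
  rewrite adjK // (paut_adj preP) ?groupV ?hG //; congr imset.
  by rewrite adjK.
have one4 : 1 < 4 by [].
have hvV : (v j)^-1%g \in paut le by rewrite groupV hG.
by rewrite -(paut_adj preP hf fj one4) -(paut_adj preP hf fP j4) ef -(paut_adj preP hvV fP one4) vV.
Qed.

End ChiralCriterion.

(** The product map from [<[u]> x <[v]> x <[w]>] onto [K] is a surjection between sets of equal
    size, hence injective. This is how tightness enters the atomicity proof. *)
Lemma tight_triv (gT : finGroupType) (K : {set gT}) (u v w : gT) i l j :
  (forall g, g \in K -> exists i l j : nat, (g = u ^+ i * v ^+ l * w ^+ j)%g) ->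
  #|K| = (#[u]%g * #[v]%g * #[w]%g)%N -> (u ^+ i * v ^+ l * w ^+ j = 1)%g ->
  [/\ u ^+ i = 1, v ^+ l = 1 & w ^+ j = 1]%g.
Proof.
move=> hK cK e; pose D := setX (setX <[u]>%g <[v]>%g) <[w]>%g.
pose f (d : gT * gT * gT) := (d.1.1 * d.1.2 * d.2)%g.
have sK : K \subset f @: D.
  apply/subsetP => g /hK[i' [l' [j' ->]]]; apply/imsetP.
  by exists (u ^+ i', v ^+ l', w ^+ j')%g; rewrite // !inE /= !mem_cycle.
have cD : #|D| = (#[u]%g * #[v]%g * #[w]%g)%N by rewrite !cardsX.
have inj : {in D &, injective f}.
  apply/imset_injP; rewrite eqn_leq leq_imset_card /= cD -cK; exact: subset_leq_card.
have : (u ^+ i, v ^+ l, w ^+ j)%g = (1, 1, 1)%g.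
  by apply: inj; rewrite ?inE /= ?mem_cycle ?group1 // /f /= e !mulg1.
by case=> -> -> ->.
Qed.

(** * Coset geometries *)

Section CosetGeometry.
Variables (gT : finGroupType) (H : nat -> {group gT}).

Definition is_face (u : 'I_6 * {set gT}) := u.2 \in rcosets (H u.1) [set: gT].
Definition cface := {u : 'I_6 * {set gT} | is_face u}.

Definition crk (u : cface) : nat := (val u).1.
(** Cosets are incident when they meet, and the index orients the relation. The improper faces come
    from [H 0] and [H 5], which are assumed below to be the whole group. *)
Definition cle : rel cface := fun u v =>
  ((val u).1 <= (val v).1) && ((val u).2 :&: (val v).2 != set0).

Lemma face_subproof (i : 'I_6) (g : gT) : is_face (i, (H i :* g)%g).
Proof. by apply/rcosetsP; exists g. Qed.
Definition face (i : 'I_6) (g : gT) : cface := exist _ (i, (H i :* g)%g) (face_subproof i g).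

Lemma crk_face i g : crk (face i g) = i. Proof. by []. Qed.

Lemma face_mem (u : cface) g : g \in (val u).2 -> u = face (val u).1 g.
Proof.
case: u => [[i A] /= p] Ag; apply: val_inj => /=.
by case/rcosetsP: (p) Ag => h _ /= -> /rcoset_eqP ->.
Qed.

Lemma face_ex (u : cface) : exists g, u = face (val u).1 g.
Proof.
case: u => [[i A] p]; have /rcosetsP[g _ /= e] := p.
by exists g; apply: face_mem; rewrite /= e rcoset_refl.
Qed.

Lemma faceE i g h : (face i g = face i h) <-> (g * h^-1)%g \in H i.
Proof.
split=> [/(congr1 val) [] e|e].
  by rewrite -mem_rcoset -e rcoset_refl.
by apply: val_inj; congr (_, _); apply/rcoset_eqP; rewrite mem_rcoset.
Qed.

Lemma cleP u v : reflect (crk u <= crk v /\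
    exists g, u = face (val u).1 g /\ v = face (val v).1 g) (cle u v).
Proof.
apply: (iffP andP) => [[l /set0Pn[g /setIP[gu gv]]]|[l [g [eu ev]]]].
  by split=> //; exists g; split; apply: face_mem.
split=> //; apply/set0Pn; exists g; rewrite inE {1}eu ev /=.
by rewrite !rcoset_refl.
Qed.

Lemma cle_face (i j : 'I_6) g : i <= j -> cle (face i g) (face j g).
Proof. by move=> l; apply/cleP; split=> //; exists g. Qed.

Lemma cle_rk_eq u v : cle u v -> crk u = crk v -> u = v.
Proof.
by case/cleP => _ [g [eu ev]] /ord_inj e; rewrite eu ev e.
Qed.

Hypotheses (H0 : H 0 = [set: gT]%G) (H5 : H 5 = [set: gT]%G).
Hypothesis HT : forall i j k, i <= j -> j <= k -> k <= 5 ->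
  H j \subset ((H i :&: H j) * (H j :&: H k))%g.

(** If [g] represents [u] and [v], and [h] represents [v] and [w], then [HT] splits $gh^{-1}=st$,
    and $th=s^{-1}g$ represents all three faces. *)
Lemma cle_triple u v w : cle u v -> cle v w ->
  exists g, [/\ u = face (val u).1 g, v = face (val v).1 g & w = face (val w).1 g].
Proof.
case/cleP => luv [g [eu ev]] /cleP[lvw [h [ev' ew]]].
have gh : (g * h^-1)%g \in H (val v).1 by apply/faceE; rewrite -ev -ev'.
have k5 : (val w).1 <= 5 by rewrite -ltnS ltn_ord.
have /mulsgP[s t /setIP[su sv] /setIP[tv tw] e] := subsetP (HT luv lvw k5) _ gh.
exists (t * h)%g; split.
- rewrite {1}eu; apply/faceE.
  have -> : (g * (t * h)^-1)%g = s by rewrite invMg mulgA e mulgK.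
  exact: su.
- by rewrite {1}ev'; apply/faceE; rewrite invMg mulgA mulgV mul1g groupV.
- by rewrite {1}ew; apply/faceE; rewrite invMg mulgA mulgV mul1g groupV.
Qed.

Lemma cle_refl u : cle u u.
Proof. by have [g e] := face_ex u; apply/cleP; split=> //; exists g. Qed.

Lemma cle_trans u v w : cle u v -> cle v w -> cle u w.
Proof.
move=> luv lvw; have [g [eu _ ew]] := cle_triple luv lvw.
apply/cleP; split; last by exists g.
by case/cleP: luv => l _; case/cleP: lvw => l' _; apply: leq_trans l l'.
Qed.

Lemma cle_rk u v : cle u v -> crk u <= crk v. Proof. by case/cleP. Qed.

Lemma cle_po : partial_order cle.
Proof.
split; [exact: cle_refl| |exact: cle_trans].
move=> u v luv lvu; apply: cle_rk_eq => //.
by apply/eqP; rewrite eqn_leq !cle_rk.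
Qed.

Lemma crk_plt u v : plt cle u v -> crk u < crk v.
Proof.
case/andP => n l; rewrite ltn_neqAle cle_rk // andbT.
by apply: contra n => /eqP e; apply/eqP; apply: cle_rk_eq.
Qed.

Lemma crk_le5 u : crk u <= 5. Proof. by rewrite -ltnS ltn_ord. Qed.

Lemma face0 (i : 'I_6) g h : (i == 0 :> nat) || (i == 5 :> nat) -> face i g = face i h.
Proof. by case/orP => /eqP e; apply/faceE; rewrite e ?H0 ?H5 inE. Qed.

Lemma cle_min u : cle (face ord0 1) u.
Proof.
have [g e] := face_ex u; rewrite (face0 1 g) // e; exact: cle_face.
Qed.

Lemma cle_max u : cle u (face ord_max 1).
Proof.
have [g e] := face_ex u; rewrite (face0 1 g) // e; apply: cle_face.
by rewrite -ltnS ltn_ord.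
Qed.

Lemma cflag_max A v : is_flag cle A -> (forall u, u \in A -> cle u v || cle v u) -> v \in A.
Proof.
case/andP => cA /forallP/(_ (v |: A)) mA hv; apply: contraT => nv.
have pA : A \proper v |: A.
  by rewrite properE subsetUr /=; apply/subsetPn; exists v; rewrite ?setU11.
move: mA; rewrite pA /= => /negP[]; move/is_chainP: cA => cA.
apply/is_chainP => x y /setU1P[->|Ax] /setU1P[->|Ay].
- by rewrite cle_refl.
- by rewrite orbC hv.
- by rewrite hv.
- exact: cA.
Qed.

(** If rank [i] were missing, a common representative of the nearest faces of the flag below and
    above would give a face of rank [i] to insert. *)
Lemma cflag_card A : is_flag cle A -> #|A| = 6.
Proof.
move=> fA; have cA := is_chainP _ _ (flag_chain fA).
have rinj : {in A &, injective (fun u => (val u).1)}.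
  move=> u v Au Av e; have er : crk u = crk v by rewrite /crk e.
  by case/orP: (cA u v Au Av) => l; [|symmetry]; apply: cle_rk_eq.
rewrite -(card_in_imset rinj) -[RHS](card_ord 6) -cardsT.
congr #|pred_of_set _|; apply/setP => i; rewrite inE.
apply: contraT => /imsetP no.
have no' u : u \in A -> crk u != i.
  by move=> Au; apply/negP => /eqP/ord_inj e; apply: no; exists u.
have chle u v : u \in A -> v \in A -> crk u <= crk v -> cle u v.
  move=> Au Av l; case/orP: (cA u v Au Av) => // l'.
  have -> // : u = v; last exact: cle_refl.
  by symmetry; apply: cle_rk_eq => //; apply/eqP; rewrite eqn_leq l cle_rk.
have mA : face ord0 1 \in A by apply: (cflag_max fA) => u _; rewrite cle_min orbT.
have MA : face ord_max 1 \in A by apply: (cflag_max fA) => u _; rewrite cle_max.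
have i0 : 0 < i by rewrite lt0n; have := no' _ mA; rewrite crk_face eq_sym.
have i5 : i < 5.
  by rewrite ltn_neqAle -ltnS ltn_ord andbT; have := no' _ MA; rewrite crk_face eq_sym.
have Pm : (fun u => (u \in A) && (crk u < i)) (face ord0 1) by rewrite /= mA.
have PM : (fun u => (u \in A) && (i < crk u)) (face ord_max 1) by rewrite /= MA.
case: (@arg_maxnP _ (face ord0 1) (fun u => (u \in A) && (crk u < i)) crk Pm) => u /andP[Au ui] umax.
case: (@arg_minnP _ (face ord_max 1) (fun u => (u \in A) && (i < crk u)) crk PM) => w /andP[Aw wi] wmin.
have luw : cle u w by apply: chle => //; apply/ltnW/(ltn_trans ui).
case/cleP: (luw) => _ [g [eu ew]].
suff vA : face i g \in A by have := no' _ vA; rewrite crk_face eqxx.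
have luv : cle u (face i g) by rewrite eu; apply: cle_face; apply: ltnW.
have lvw : cle (face i g) w by rewrite ew; apply: cle_face; apply: ltnW.
apply: (cflag_max fA) => t At; have := no' t At; rewrite neq_ltn => /orP[ti|ti].
  rewrite (@cle_trans t u) //; apply: chle => //.
  by apply: umax; rewrite At.
rewrite orbC (@cle_trans _ w t) //; apply: chle => //.
by apply: wmin; rewrite At.
Qed.

Hypothesis HD : forall i, i < 4 -> exists d, [/\ d \in H i, d \in H i.+2, d \notin H i.+1 &
  forall g, g \in H i -> g \in H i.+2 -> (g \in H i.+1) || ((g * d^-1)%g \in H i.+1)].

(** With [g] representing [u] and [v], the two faces in between are those of [g] and [d * g], since
    two cosets cover the intersection of the outer stabilizers. *)
Lemma cdiamond u v : plt cle u v -> crk v = (crk u).+2 ->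
  #|[set z | plt cle u z && plt cle z v]| = 2.
Proof.
case/andP => nuv luv rv; case/cleP: (luv) => _ [g [eu ev]].
have i4 : crk u < 4 by rewrite -2!ltnS -rv ltnS crk_le5.
have [d [du dv dn dall]] := HD i4.
have i6 : (crk u).+1 < 6 by apply: ltn_trans (i4 : (crk u).+1 < 5) _.
pose i : 'I_6 := Ordinal i6.
have -> : [set z | plt cle u z && plt cle z v] = [set face i g; face i (d * g)%g].
  apply/setP => z; rewrite !inE; apply/andP/orP => [[puz pzv]|].
    have rz : (val z).1 = i.
      apply: val_inj => /=; apply/eqP; rewrite eqn_leq -[_ <= _.+1]ltnS -rv.
      by rewrite (crk_plt puz) (crk_plt pzv).
    case/andP: puz => _ luz; case/andP: pzv => _ lzv.
    have [h [eu' ez ev']] := cle_triple luz lzv.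
    have hu : (h * g^-1)%g \in H (crk u) by apply/faceE; rewrite -eu' -eu.
    have hv : (h * g^-1)%g \in H (crk u).+2 by rewrite -rv; apply/faceE; rewrite -ev' -ev.
    have /orP[h1|h1] := dall _ hu hv; [left|right]; apply/eqP; rewrite ez rz; apply/faceE => //.
    by rewrite invMg mulgA.
  have mid h : u = face (val u).1 h -> v = face (val v).1 h -> plt cle u (face i h) && plt cle (face i h) v.
    move=> eu' ev'; rewrite /plt {2}eu' {2}ev' !cle_face ?rv //=; last first.
      by rewrite -/(crk v) rv.
    by rewrite !andbT; apply/andP; split; apply/eqP => /(congr1 crk); rewrite crk_face ?rv /= => e;
      [move: (ltnSn (crk u)); rewrite {1}e ltnn|move: (ltnSn (crk u).+1); rewrite {1}e ltnn].
  case=> /eqP ->; apply/andP; apply: mid => //.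
    by rewrite {1}eu; apply/faceE; rewrite invMg mulgA mulgV mul1g groupV.
  by rewrite {1}ev; apply/faceE; rewrite invMg mulgA mulgV mul1g groupV -/(crk v) rv.
rewrite cards2; suff -> : face i g != face i (d * g)%g by [].
by apply/negP => /eqP/faceE; rewrite invMg mulgA mulgV mul1g groupV => dn'; rewrite dn' in dn.
Qed.

(** Separated from [cpolytope] because the proof of connectedness already uses adjacent flags. *)
Lemma cpre : prepolytope cle crk.
Proof.
split; first exact: cle_po.
- by split; [exact: crk_plt|exact: crk_le5].
- by split; [exists (face ord0 1); exact: cle_min|exists (face ord_max 1); exact: cle_max].
- by split; [exact: cflag_card|exact: cdiamond].
Qed.

Lemma cact_subproof (g : gT) (u : cface) : is_face ((val u).1, ((val u).2 :* g)%g).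
Proof.
case: u => [[i A] p]; have /rcosetsP[h _ /= ->] := p.
by apply/rcosetsP; exists (h * g)%g; rewrite // rcosetM.
Qed.
Definition cact_fun g (u : cface) : cface :=
  exist _ ((val u).1, ((val u).2 :* g)%g) (cact_subproof g u).

Lemma act_fun_face g i h : cact_fun g (face i h) = face i (h * g)%g.
Proof. by apply: val_inj => /=; rewrite -rcosetM. Qed.

Lemma cact_inj g : injective (cact_fun g).
Proof.
apply: (can_inj (g := cact_fun g^-1%g)) => u; have [h ->] := face_ex u.
by rewrite !act_fun_face mulgK.
Qed.

Definition cact g : {perm cface} := perm (@cact_inj g).

Lemma cact_face g i h : cact g (face i h) = face i (h * g)%g.
Proof. by rewrite permE act_fun_face. Qed.

Lemma cactM : {morph cact : g h / (g * h)%g}.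
Proof.
move=> g h; apply/permP => u; have [d ->] := face_ex u.
by rewrite permM !cact_face mulgA.
Qed.

Lemma cact_paut g : cact g \in paut cle.
Proof.
have hom h u v : cle u v -> cle (cact h u) (cact h v).
  by case/cleP => l [d [-> ->]]; rewrite !cact_face; apply: cle_face.
apply/pautP => u v; apply/idP/idP => [/(hom g^-1%g)|]; last exact: hom.
have [[d ->] [d' ->]] := (face_ex u, face_ex v).
by rewrite !cact_face !mulgK.
Qed.

Definition flagOf g : {set cface} := [set face i g | i : 'I_6].

Lemma face_flagOf i g : face i g \in flagOf g.
Proof. exact: imset_f. Qed.

Lemma flagOfP u g : u \in flagOf g -> u = face (val u).1 g.
Proof. by case/imsetP => i _ ->. Qed.

Lemma cact_flagOf g h : cact g @: flagOf h = flagOf (h * g)%g.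
Proof.
rewrite -imset_comp; apply: eq_imset => i /=; exact: cact_face.
Qed.

Lemma face_rk_flag (P : 'I_6 -> cface) : (forall i, crk (P i) = i) ->
  (forall i j : 'I_6, i < j -> cle (P i) (P j)) -> is_flag cle [set P i | i : 'I_6].
Proof.
move=> rP lP; rewrite (flagE cpre) card_imset ?card_ord ?eqxx ?andbT; last first.
  by move=> i j /(congr1 crk); rewrite !rP => /ord_inj.
apply/is_chainP => _ _ /imsetP[i _ ->] /imsetP[j _ ->].
by case: (ltngtP i j) => [/lP->|/lP->|/ord_inj->]; rewrite ?orbT ?cle_refl.
Qed.

Lemma flagOf_flag g : is_flag cle (flagOf g).
Proof. by apply: face_rk_flag => // i j /ltnW; apply: cle_face. Qed.

Lemma flag_triple A r1 r2 r3 : is_flag cle A -> r1 <= r2 -> r2 <= r3 -> r3 < 6 ->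
  exists g, forall u, u \in A -> [|| crk u == r1, crk u == r2 | crk u == r3] ->
    u = face (val u).1 g.
Proof.
move=> fA l12 l23 l6; have l26 := leq_ltn_trans l23 l6; have l16 := leq_ltn_trans l12 l26.
have [u1 A1 e1] := flag_face cpre fA l16.
have [u2 A2 e2] := flag_face cpre fA l26.
have [u3 A3 e3] := flag_face cpre fA l6.
have l1 : cle u1 u2 by apply: (flag_le cpre fA); rewrite ?e1 ?e2.
have l2 : cle u2 u3 by apply: (flag_le cpre fA); rewrite ?e2 ?e3.
have [g [h1 h2 h3]] := cle_triple l1 l2; exists g => u Au.
have inj := flag_rk_inj cpre fA.
by case/or3P => /eqP e; [rewrite (inj u u1)|rewrite (inj u u2)|rewrite (inj u u3)];
  rewrite // e.
Qed.

(** Apart from the improper faces and the one of stored rank [j.+1], a flag has three faces, and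
    these share a representative by [cle_triple]. *)
Lemma flag_white j A : is_flag cle A -> j < 4 ->
  exists g, A = flagOf g \/ adj cle crk j (flagOf g) = A.
Proof.
move=> fA j4.
have [g hg] : exists g, forall u, u \in A -> crk u != j.+1 -> u \in flagOf g.
  have [r1 [r2 [r3 [l1 l2 l3 hr]]]] : exists r1 r2 r3, [/\ r1 <= r2, r2 <= r3, r3 < 6 &
      forall i : 'I_6, i != j.+1 :> nat ->
        [|| (i == 0 :> nat) || (i == 5 :> nat) | [|| i == r1 :> nat, i == r2 :> nat | i == r3 :> nat]]].
    by case: j j4 => [|[|[|[|]]]] // _; [exists 2, 3, 4|exists 1, 3, 4|exists 1, 2, 4|exists 1, 2, 3];
      split=> // -[[|[|[|[|[|[|]]]]]]].
  have [g hg] := flag_triple fA l1 l2 l3; exists g => u Au nu.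
  have [h eh] := face_ex u.
  have /orP[e|e] := hr _ nu; last by rewrite (hg u) // face_flagOf.
  by rewrite eh (face0 h g e) face_flagOf.
exists g; have [->|ne] := eqVneq A (flagOf g); [by left|right].
apply: (adjE cpre j4); apply: (jadj_sym cpre); rewrite /jadj fA flagOf_flag ne /=.
apply/subsetP => u /setDP[Au nu]; rewrite inE; apply: contraNT nu; exact: hg.
Qed.

Variable W : nat -> nat -> gT.
Hypothesis HW : forall i j, i < j -> j < 4 ->
  [/\ forall l, l < 4 -> l != i -> l != j -> W i j \in H l.+1,
      W i j \notin H i.+1, W i j \notin H j.+1 &
      W i j \in (H j.+1 * H i.+1)%g].

(** The intermediate flag is [flagOf 1] with only its face of stored rank [j.+1] taken from [w].
    Writing $w=st$ as in [HW], the element [t] represents that face and the base face of stored rank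
    [i.+1], so they are incident. *)
Lemma W_jadj i j : i < j -> j < 4 ->
  exists2 P, jadj cle crk j (flagOf 1) P & jadj cle crk i P (flagOf (W i j)).
Proof.
move=> ij j4; have [W1 nWi nWj /mulsgP[s t Hs Ht eW]] := HW ij j4.
have i4 := ltn_trans ij j4; set w := W i j in W1 nWi nWj eW *.
pose P (l : 'I_6) := if l == j.+1 :> nat then face l w else face l 1.
have rP l : crk (P l) = l by rewrite /P; case: ifP.
have faceW (l : 'I_6) : l != j.+1 :> nat -> l != i.+1 :> nat -> face l 1 = face l w.
  move=> n1 n2; case: l n1 n2 => -[|l] l6 /= n1 n2; first exact: face0.
  have [l5|l5] := eqVneq l 4; first by apply: face0; rewrite /= l5.
  apply/faceE; rewrite mul1g groupV /=; apply: W1 => //.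
  by rewrite ltn_neqAle l5 -ltnS -ltnS.
have facet (l : 'I_6) : l = j.+1 :> nat -> face l w = face l t.
  by move=> e; apply/faceE; rewrite e eW mulgK.
have facet1 (l : 'I_6) : l = i.+1 :> nat -> face l 1 = face l t.
  by move=> e; apply/faceE; rewrite e mul1g groupV.
have lP (l l' : 'I_6) : l < l' -> cle (P l) (P l').
  move=> /ltnW ll; rewrite /P; case: eqP => e; case: eqP => e'.
  - exact: cle_face.
  - have [ei|ni] := eqVneq (l' : nat) i.+1.
      by rewrite (facet l e) (facet1 l' ei); apply: cle_face.
    by rewrite (faceW l') //; [apply: cle_face|apply/eqP].
  - have [ei|ni] := eqVneq (l : nat) i.+1.
      by rewrite (facet l' e') (facet1 l ei); apply: cle_face.
    by rewrite (faceW l) //; [apply: cle_face|apply/eqP].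
  - exact: cle_face.
have fP : is_flag cle [set P l | l : 'I_6] by apply: face_rk_flag.
have j6 : j.+1 < 6 by apply: ltn_trans (j4 : j.+1 < 5) _.
have i6 : i.+1 < 6 by apply: ltn_trans (i4 : i.+1 < 5) _.
exists [set P l | l : 'I_6]; rewrite /jadj fP flagOf_flag /=; apply/andP; split.
- apply/negP => /eqP e; have : face (Ordinal j6) w \in flagOf 1.
    by rewrite e; apply/imsetP; exists (Ordinal j6); rewrite // /P /= eqxx.
  by move/flagOfP => /faceE; rewrite invg1 mulg1 /= => h; rewrite h in nWj.
- apply/subsetP => _ /setDP[/imsetP[l _ ->]]; rewrite inE crk_face; apply: contraR => nl.
  by apply/imsetP; exists l; rewrite // /P (negPf nl).
- apply/negP => /eqP e; have : face (Ordinal i6) 1 \in flagOf w.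
    rewrite -e; apply/imsetP; exists (Ordinal i6); rewrite // /P /=.
    by rewrite eqSS (ltn_eqF ij).
  by move/flagOfP => /faceE; rewrite mul1g groupV /= => h; rewrite h in nWi.
- apply/subsetP => _ /setDP[/imsetP[l _ ->]]; rewrite inE rP; apply: contraR => nl.
  rewrite /P; case: eqP => [_|/eqP n]; first exact: face_flagOf.
  by rewrite faceW ?face_flagOf.
Qed.

Hypothesis HC : forall (I : pred nat) (K : {group gT}),
  (forall i j, i < j -> j < 4 -> ~~ I i -> ~~ I j -> W i j \in K) ->
  (exists2 i, i < 4 & ~~ I i) ->
  forall g, (forall i, i < 4 -> I i -> g \in H i.+1) -> g \in K.

(** With [I] the ranks of the common faces and [j] outside [I], a [j]-move turns both flags, where
    necessary, into [flagOf g] and [flagOf h]. Then [h * g^-1] stabilizes the base faces with rank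
    in [I], and [HC] writes it by rotations that use free ranks only. *)
Lemma cconnected A B : is_flag cle A -> is_flag cle B ->
  connect (fun C D => [&& adjacent cle C D, A :&: B \subset C & A :&: B \subset D]) A B.
Proof.
move=> fA fB; set S := A :&: B.
pose e : rel {set cface} := fun C D => [&& adjacent cle C D, S \subset C & S \subset D].
suff : connect e A B by [].
pose I i := [exists x in S, crk x == i.+1].
have [/forallP hI|] := boolP [forall i : 'I_4, I i].
  have -> : A = B; last exact: connect0.
  apply: (flag_sub_eq cpre) => //; apply/subsetP => u Au.
  have [g eg] := face_ex u.
  have u6 := ltn_ord (val u).1.
  have [v Bv rv] := flag_face cpre fB u6.
  have [/face0 fz|nz] := boolP (((val u).1 == 0 :> nat) || ((val u).1 == 5 :> nat)).
    have [h eh] := face_ex v; suff -> : u = v by [].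
    by rewrite eg eh (ord_inj rv) (fz g h).
  move: nz; rewrite negb_or => /andP[n0 n5].
  have r4 : (val u).1.-1 < 4 by move: n0 n5 u6; case: ((val u).1 : nat) => [|[|[|[|[|[|]]]]]].
  have /existsP[x /andP[/setIP[Ax Bx] /eqP rx]] := hI (Ordinal r4).
  rewrite (flag_rk_inj cpre fA Au Ax) // rx /= prednK //.
  by rewrite lt0n.
rewrite negb_forall => /existsP[[j j4] /= nIj].
have nS x : x \in S -> crk x != j.+1.
  by move=> Sx; apply: contra nIj => r; apply/existsP; exists x; rewrite Sx.
have e_sym (C D : {set cface}) : e C D -> e D C.
  case/and3P => aCD sC sD; rewrite /e sC sD !andbT.
  have [l l4 jl] := adjacent_jadj cpre aCD.
  exact: (jadj_adjacent cpre (jadj_sym cpre jl)).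
have step (C : {set cface}) : is_flag cle C -> S \subset C -> exists g, connect e C (flagOf g) /\
    connect e (flagOf g) C /\ S \subset flagOf g.
  move=> fC sC; have [g [eg|eg]] := flag_white fC j4.
    by exists g; rewrite -eg; split; [exact: connect0|split; [exact: connect0|]].
  have jg : jadj cle crk j C (flagOf g).
    by apply: (jadj_sym cpre); rewrite -eg; apply: jadj_adj; rewrite ?flagOf_flag //; exact: cpre.
  have sg : S \subset flagOf g.
    apply/subsetP => x Sx; apply: (jadj_mem jg) (nS _ Sx); exact: (subsetP sC).
  have eC : e C (flagOf g) by rewrite /e sC sg (jadj_adjacent cpre jg).
  by exists g; split; [|split]; rewrite ?connect1 // e_sym.
have [g [Ag [_ sg]]] := step A fA (subsetIl _ _).
have [h [_ [Bh sh]]] := step B fB (subsetIr _ _).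
apply: connect_trans Ag _; apply: connect_trans Bh.
pose eI : rel {set cface} := fun C D => [exists i : 'I_4, ~~ I i && jadj cle crk i C D].
have eI_e (C D : {set cface}) : S \subset C -> connect eI C D -> connect e C D.
  move=> sC /connectP[p pth ->]; elim: p C sC pth => [|D' p IH] C sC /=; first by rewrite connect0.
  case/andP => /existsP[i /andP[ni ji]] pth.
  have sD : S \subset D'.
    apply/subsetP => x Sx; apply: (jadj_mem ji); first exact: (subsetP sC).
    by apply: contra ni => r; apply/existsP; exists x; rewrite Sx.
  apply: connect_trans (IH _ sD pth); apply: connect1.
  by rewrite /e sC sD (jadj_adjacent cpre ji).
have eI_act d (C D : {set cface}) : connect eI C D -> connect eI (cact d @: C) (cact d @: D).
  move=> /connectP[p pth ->]; elim: p C pth => [|D' p IH] C /=; first by rewrite connect0.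
  case/andP => /existsP[i /andP[ni ji]] pth; apply: connect_trans (IH _ pth).
  apply: connect1; apply/existsP; exists i; rewrite ni; apply: (paut_jadj cpre) => //.
  exact: cact_paut.
apply: (eI_e _ _ sg).
(* Translation by [cact] preserves [eI], so this set is closed under products; by [W_jadj] it
   contains [W i l] for free ranks [i] and [l]. *)
pose K := [set d | connect eI (flagOf 1) (flagOf d)].
have gK : group_set K.
  apply/group_setP; split=> [|d d']; first by rewrite inE connect0.
  rewrite !inE => hd hd'; apply: connect_trans hd' _.
  by have := eI_act d' _ _ hd; rewrite !cact_flagOf mul1g.
have : (h * g^-1)%g \in Group gK.
  apply: (HC (I := I)).
  - move=> i l il l4 ni nl; rewrite inE; have [P jP iP] := W_jadj il l4.
    apply: (@connect_trans _ _ P); apply: connect1; apply/existsP.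
      by exists (Ordinal l4); rewrite nl.
    by exists (Ordinal (ltn_trans il l4)); rewrite ni.
  - by exists j.
  - move=> i i4 /existsP[x /andP[Sx /eqP rx]].
    have := flagOfP (subsetP sg x Sx); have := flagOfP (subsetP sh x Sx).
    by move=> {1}-> /faceE; rewrite -/(crk x) rx.
rewrite inE => /(eI_act g); by rewrite !cact_flagOf mul1g mulgVK.
Qed.

Lemma cpolytope : polytope4 cle crk.
Proof. by case: cpre => *; split=> //; exact: cconnected. Qed.

End CosetGeometry.

(** * Integer powers in a group *)

Section IntegerPowers.
Local Open Scope group_scope.
Local Notation "x ^^ n" := (zexpg x n%R) (at level 29, left associativity).

Section Zexpg.
Variable G : groupType.
Implicit Types (x y : G) (m n : int).

Lemma zexpg1r x : x ^^ 1 = x. Proof. by []. Qed.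

Lemma zexpgS x n : x ^^ (n + 1) = x ^^ n * x.
Proof.
case: n => [n|[|n]]; first by rewrite -expgSr -addn1.
  by rewrite /= expg1 mulVg.
have -> : (Negz n.+1 + 1 = Negz n)%R by lia.
by rewrite /= (expgS _ n.+1) invMg mulgVK.
Qed.

Lemma zexpgD x m n : x ^^ (m + n) = x ^^ m * x ^^ n.
Proof.
have pos k : x ^^ (m + k%:Z) = x ^^ m * x ^^ k%:Z.
  elim: k => [|k IH]; first by rewrite addr0 mulg1.
  by rewrite -(addn1 k) PoszD addrA !zexpgS IH mulgA.
case: n => [n|n]; first exact: pos.
apply: (mulIg (x ^+ n.+1)); rewrite -mulgA /= mulVg mulg1.
have neg k : x ^^ (m - k%:Z) * x ^+ k = x ^^ m.
  elim: k => [|k IH]; first by rewrite subr0 mulg1.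
  rewrite expgS mulgA -zexpgS -IH; congr (_ ^^ _ * _); lia.
by rewrite -[RHS](neg n.+1) NegzE.
Qed.

Lemma zexpgN x n : x ^^ (- n) = (x ^^ n)^-1.
Proof. by apply: (mulgI (x ^^ n)); rewrite -zexpgD subrr mulgV. Qed.

Lemma zexpgM x m n : x ^^ (m * n) = (x ^^ m) ^^ n.
Proof.
have pos k : x ^^ (m * k%:Z) = (x ^^ m) ^+ k.
  by elim: k => [|k IH]; rewrite ?mulr0 // expgSr -IH -zexpgD; congr zexpg; lia.
case: n => [n|n]; first by rewrite pos.
by rewrite NegzE mulrN !zexpgN pos.
Qed.

Lemma zexpg1n n : (1 : G) ^^ n = 1.
Proof. by case: n => n /=; rewrite expg1n ?invg1. Qed.

Lemma zexpg_conj x y n : (x ^^ n) ^ y = (x ^ y) ^^ n.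
Proof. by case: n => n /=; rewrite ?conjVg conjXg. Qed.

Lemma zexpgVl x n : x^-1 ^^ n = (x ^^ n)^-1.
Proof. by case: n => n /=; rewrite expVgn. Qed.

Lemma zexpg_eqmod x (N : nat) m n t :
  x ^+ N = 1 -> (m = n + N%:Z * t)%R -> x ^^ m = x ^^ n.
Proof. by move=> xN ->; rewrite zexpgD zexpgM /= xN zexpg1n mulg1. Qed.

Lemma zexpg_nat x (N : nat) m : 0 < N -> x ^+ N = 1 -> exists n : nat, x ^^ m = x ^+ n.
Proof.
move=> N0 xN; exists `|(m %% N)%Z|%N.
have e : (`|(m %% N)%Z|%N%:Z = (m %% N)%Z)%R by rewrite gez0_abs // modz_ge0 //; lia.
rewrite -[RHS]/(zexpg x `|(m %% N)%Z|%N) e.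
by apply: (zexpg_eqmod (t := (m %/ N)%Z) xN); rewrite {1}(divz_eq m N); lia.
Qed.

Lemma intertwine_zexpg u x y n : u * x = y * u -> u * x ^^ n = y ^^ n * u.
Proof.
move=> e; have -> : y = x ^ u^-1 by rewrite conjgE invgK mulgA e mulgK.
by rewrite -zexpg_conj conjgE invgK !mulgA mulgVK.
Qed.

End Zexpg.

End IntegerPowers.

(** * A permutation model of the group *)

Section PermutationModel.
Local Open Scope Z_scope.
#[local] Arguments Z.mul : simpl never.
#[local] Arguments Z.add : simpl never.
#[local] Arguments Z.sub : simpl never.
#[local] Arguments Z.modulo : simpl never.
#[local] Arguments Z.div : simpl never.
#[local] Arguments Z.even : simpl never.

Ltac euclid_lia := Z.to_euclidean_division_equations; lia.

(* Right multiplication of the cosets <a> y^l x^j by a and y.  The multiples of k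
   by which it deviates from the affine action were read off from coset
   enumerations for b = 5 and b = 6. *)
Section Tables.
Variables e1 e2 : Z.
Definition tab (t : seq Z) (r : Z) : Z := nth 0 t (Z.to_nat (r mod 8)).
Definition dlY := tab [:: 0; 0; 1; 1; 0; 0; 1; 1].
Definition djY j := e2 * tab [:: 0; 0; 3; 1; 2; 2; 1; 3] j.
Definition dlA := tab [:: 0; 1; 1; 0; 0; 1; 1; 0].
Definition rowA (l : Z) : seq Z :=
  match l mod 4 with
  | 0 => [:: 0; 0; 1; 3; 2; 2; 3; 1]
  | 1 => [:: 0; 3; 3; 0; 2; 1; 1; 2]
  | 2 => [:: 0; 2; 1; 1; 2; 0; 3; 3]
  | _ => [:: 0; 1; 3; 2; 2; 3; 1; 0]
  end.
Definition djA l j := e2 * tab [:: 0; 3; 1; 2; 2; 1; 3; 0] l + e1 * tab (rowA l) j.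

(* [OXn n0 n1] is x^(n0 + n1 k); [OAk], [OYk] are closed forms of a^k and y^k;
   [OA8], [OY8] of a^8 and y^8. *)
Inductive op := OA | OY | OXn of Z & Z | OAk | OYk | OA8 | OY8.

(** The affine parts hold up to multiples of [k] in the exponents: there $x^2$ commutes with $a$ and
    $y$, while $xa=a^{-1}x^{-1}$, $xy=y^{-1}x^{-1}$ and $ya=ax^2y$. Hence the distinction by the
    parity of [j]. *)
Definition sem (k : Z) (o : op) (w : Z * Z) : Z * Z :=
  let: (l, j) := w in
  match o with
  | OA => (l + k * dlA l, (if Z.even j then j + 2 * l else j - 2 - 2 * l) + k * djA l j)
  | OY => ((if Z.even j then l + 1 else l - 1) + k * dlY j,
           (if Z.even j then j else j - 2) + k * djY j)
  | OXn n0 n1 => (l, j + n0 + k * n1)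
  | OAk => (l, j + k * (if Z.even j == Z.even l then 0 else 2))
  | OYk => if Z.even j then (l + k, j) else (l - k, j - 2 * k)
  | OA8 => (l, if Z.even j then j + 16 * l else j - 16 - 16 * l)
  | OY8 => if Z.even j then (l + 8, j) else (l - 8, j - 16)
  end.

(* Linear forms c0 + 8 cu u + 8 cv v + 8 cm m, with l = r + 8 u, j = s + 8 v and
   k = 8 m; residues modulo 8 only depend on c0. *)
Definition form := (Z * Z * Z * Z)%type.
Definition feval (u v m : Z) (f : form) : Z :=
  let: (c0, cu, cv, cm) := f in c0 + 8 * (cu * u + cv * v + cm * m).
Definition fc0 (f : form) : Z := f.1.1.1.
Definition fadd (f g : form) : form :=
  let: (c0, cu, cv, cm) := f in let: (d0, du, dv, dm) := g in
  (c0 + d0, cu + du, cv + dv, cm + dm).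
Definition fscale (n : Z) (f : form) : form :=
  let: (c0, cu, cv, cm) := f in (n * c0, n * cu, n * cv, n * cm).
Definition fcst (n : Z) : form := (n, 0, 0, 0).
Definition fk (n : Z) : form := (0, 0, 0, n).

Definition sym (o : op) (w : form * form) : form * form :=
  let: (l, j) := w in
  let ev := Z.even (fc0 j) in
  match o with
  | OA => (fadd l (fk (dlA (fc0 l))),
           fadd (if ev then fadd j (fscale 2 l) else fadd (fadd j (fcst (-2))) (fscale (-2) l))
                (fk (djA (fc0 l) (fc0 j))))
  | OY => (fadd (if ev then fadd l (fcst 1) else fadd l (fcst (-1))) (fk (dlY (fc0 j))),
           fadd (if ev then j else fadd j (fcst (-2))) (fk (djY (fc0 j))))
  | OXn n0 n1 => (l, fadd (fadd j (fcst n0)) (fk n1))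
  | OAk => (l, fadd j (fk (if ev == Z.even (fc0 l) then 0 else 2)))
  | OYk => if ev then (fadd l (fk 1), j) else (fadd l (fk (-1)), fadd j (fk (-2)))
  | OA8 => (l, if ev then fadd j (fscale 16 l)
               else fadd (fadd j (fcst (-16))) (fscale (-16) l))
  | OY8 => if ev then (fadd l (fcst 8), j) else (fadd l (fcst (-8)), fadd j (fcst (-16)))
  end.

Definition run (k : Z) (s : seq op) (w : Z * Z) := foldl (fun w o => sem k o w) w s.
Definition srun (s : seq op) (w : form * form) := foldl (fun w o => sym o w) w s.

Definition fcong (n : Z) (f g : form) : bool :=
  let: (c0, cu, cv, cm) := f in let: (d0, du, dv, dm) := g in
  [&& c0 =? d0, cu =? du, cv =? dv & (cm - dm) mod n =? 0].

(** Runs both words on $l=r+8u$, $j=t+8v$ for symbolic [u], [v]. The moduli $2k$ for [l] and $4k$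
    for [j] are the intended orders of $y$ and $x$. *)
Definition check (s1 s2 : seq op) : bool :=
  all (fun r => all (fun t =>
    let w := ((Z.of_nat r, 1, 0, 0), (Z.of_nat t, 0, 1, 0)) in
    fcong 2 (srun s1 w).1 (srun s2 w).1 && fcong 4 (srun s1 w).2 (srun s2 w).2)
    (iota 0 8)) (iota 0 8).

Definition cong (k : Z) (w w' : Z * Z) : Prop :=
  (exists t, w.1 = w'.1 + 2 * k * t) /\ (exists t, w.2 = w'.2 + 4 * k * t).

Lemma feval_add u v m f g : feval u v m (fadd f g) = feval u v m f + feval u v m g.
Proof. case: f => [[[? ?] ?] ?]; case: g => [[[? ?] ?] ?] /=; ring. Qed.
Lemma feval_scale u v m n f : feval u v m (fscale n f) = n * feval u v m f.
Proof. case: f => [[[? ?] ?] ?] /=; ring. Qed.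
Lemma feval_cst u v m n : feval u v m (fcst n) = n.
Proof. rewrite /feval /=; ring. Qed.
Lemma feval_k u v m n : feval u v m (fk n) = 8 * m * n.
Proof. rewrite /feval /=; ring. Qed.
Definition fevalE := (feval_add, feval_scale, feval_cst, feval_k).

Lemma feval_mod8 u v m f : feval u v m f mod 8 = fc0 f mod 8.
Proof.
case: f => [[[c0 cu] cv] cm] /=.
by rewrite (Z.mul_comm 8) Z_mod_plus_full.
Qed.
Lemma mod8_even a b : a mod 8 = b mod 8 -> Z.even a = Z.even b.
Proof.
move=> h; rewrite (Z_div_mod_eq_full a 8) (Z_div_mod_eq_full b 8) h.
by rewrite !Z.even_add !Z.even_mul.
Qed.
Lemma mod8_mod4 a b : a mod 8 = b mod 8 -> a mod 4 = b mod 4.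
Proof. move=> h; euclid_lia. Qed.

Lemma feval_even u v m f : Z.even (feval u v m f) = Z.even (fc0 f).
Proof. exact/mod8_even/feval_mod8. Qed.
Lemma tab_feval t u v m f : tab t (feval u v m f) = tab t (fc0 f).
Proof. by rewrite /tab feval_mod8. Qed.
Lemma rowA_feval u v m f : rowA (feval u v m f) = rowA (fc0 f).
Proof. by rewrite /rowA (mod8_mod4 (feval_mod8 u v m f)). Qed.

Definition feval2 u v m (w : form * form) := (feval u v m w.1, feval u v m w.2).

(** All coefficients other than the constant one are multiplied by 8, so parities and table entries
    can be read off from [fc0]. *)
Lemma symP u v m o w : feval2 u v m (sym o w) = sem (8 * m) o (feval2 u v m w).
Proof.
case: w => l j; case: o => [||n0 n1||||];
  rewrite /feval2 /= /dlA /dlY /djA /djY ?tab_feval ?rowA_feval ?tab_feval ?feval_even;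
  repeat (case: ifP => _); rewrite /= ?fevalE; congr (_, _); ring.
Qed.

Lemma srunP u v m s w : feval2 u v m (srun s w) = run (8 * m) s (feval2 u v m w).
Proof. by elim: s w => //= o s IH w; rewrite IH symP. Qed.

Lemma fcongP u v m n f g : fcong n f g ->
  exists t, feval u v m f = feval u v m g + n * (8 * m) * t.
Proof.
case: f => [[[c0 cu] cv] cm]; case: g => [[[d0 du] dv] dm] /=.
case/and4P=> /Z.eqb_eq-> /Z.eqb_eq-> /Z.eqb_eq-> /Z.eqb_eq h; exists ((cm - dm) / n).
have -> : cm = dm + n * ((cm - dm) / n) by rewrite -(Z.add_0_r (n * _)) -h -Z_div_mod_eq_full; ring.
have -> : dm + n * ((cm - dm) / n) - dm = n * ((cm - dm) / n) by ring.
have [->|n0] := Z.eq_dec n 0; first by rewrite !Z.mul_0_l; ring.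
by rewrite (Z.mul_comm n) Z_div_mult_full //; ring.
Qed.

Lemma checkP m s1 s2 w : check s1 s2 -> cong (8 * m) (run (8 * m) s1 w) (run (8 * m) s2 w).
Proof.
case: w => l j h; pose r := Z.to_nat (l mod 8); pose t := Z.to_nat (j mod 8).
have hr : Z.of_nat r = l mod 8 by rewrite /r; euclid_lia.
have ht : Z.of_nat t = j mod 8 by rewrite /t; euclid_lia.
have ir : r \in iota 0 8 by rewrite mem_iota add0n leq0n; apply/ltP; euclid_lia.
have it : t \in iota 0 8 by rewrite mem_iota add0n leq0n; apply/ltP; euclid_lia.
have := allP (allP h r ir) t it => /=; set w := (_, _).
have -> : (l, j) = feval2 (l / 8) (j / 8) m w.
  rewrite /feval2 /w /feval /= hr ht [in LHS](Z_div_mod_eq_full l 8).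
  by rewrite [in LHS](Z_div_mod_eq_full j 8); congr (_, _); ring.
by case/andP => /(fcongP (l / 8) (j / 8) m) h1 /(fcongP (l / 8) (j / 8) m) h2;
  rewrite -!srunP; split; rewrite -?[8 * m]/(8 * m) /=.
Qed.

End Tables.

Definition OX := OXn 1 0.
Definition check_signs (s1 s2 : Z -> Z -> seq op) : bool :=
  all (fun e1 => all (fun e2 => check e1 e2 (s1 e1 e2) (s2 e1 e2)) [:: 1; -1]) [:: 1; -1].

Section ModelZ.
Variables e1 e2 m : Z.
Local Notation k := (8 * m).
Local Notation sem := (sem e1 e2 k).
Local Notation run := (run e1 e2 k).
Local Notation cong := (cong k).

Lemma cong_refl w : cong w w.
Proof. by split; exists 0; ring. Qed.

Lemma cong_trans w1 w2 w3 : cong w1 w2 -> cong w2 w3 -> cong w1 w3.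
Proof.
case: w1 w2 w3 => [? ?] [? ?] [? ?] [[t1 /= ->] [t2 /= ->]] [[t3 /= ->] [t4 /= ->]].
by split; [exists (t1 + t3)|exists (t2 + t4)] => /=; ring.
Qed.

(** Since 8 divides [k], shifting [l] by $2k$ or [j] by $4k$ changes no table entry, so the maps
    descend to $\mathbb Z/2k\times\mathbb Z/4k$. *)
Lemma sem_cong o w w' : cong w w' -> cong (sem o w) (sem o w').
Proof.
case: w => l j; case: w' => l' j' [[/= t ->] [/= u ->]].
have hl : (l' + 2 * k * t) mod 8 = l' mod 8.
  by rewrite (_ : 2 * k * t = (2 * m * t) * 8) ?Z_mod_plus_full //; ring.
have hj : (j' + 4 * k * u) mod 8 = j' mod 8.
  by rewrite (_ : 4 * k * u = (4 * m * u) * 8) ?Z_mod_plus_full //; ring.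
case: o => [||n0 n1||||] /=; rewrite /dlA /dlY /djA /djY /tab /rowA
  ?hl ?hj ?(mod8_mod4 hl) ?(mod8_even hl) ?(mod8_even hj); repeat (case: ifP => _);
  split=> /=; first [by exists t; ring | by exists u; ring | by exists (u + t); ring
   | by exists (u - t); ring | by exists (u + 8 * t); ring | by exists (u - 8 * t); ring
   | by exists 0; ring].
Qed.

Lemma run_cat s1 s2 w : run (s1 ++ s2) w = run s2 (run s1 w).
Proof. exact: foldl_cat. Qed.

Lemma run_cong s w w' : cong w w' -> cong (run s w) (run s w').
Proof. by elim: s w w' => //= o s IH w w' /(sem_cong o)/IH. Qed.

(** Eighth powers of the generators are affine without corrections by [k], so they can be iterated
    in closed form. This reaches exponents like [k] and [2 * k], which no word of fixed length
    does. *)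
Lemma run_nseq8 o o8 n w : check e1 e2 (nseq 8 o) [:: o8] ->
  cong (run (nseq (8 * n) o) w) (run (nseq n o8) w).
Proof.
move=> ch; elim: n w => [|n IH] w; first by rewrite muln0; apply: cong_refl.
rewrite mulnS nseqD run_cat; apply: cong_trans (IH _) _.
by rewrite [run (nseq n.+1 _) _]/=; apply: run_cong; apply: (checkP m w ch).
Qed.

Lemma run_A8 n l j : run (nseq n OA8) (l, j) =
  (l, if Z.even j then j + 16 * l * Z.of_nat n else j - 16 * (1 + l) * Z.of_nat n).
Proof.
elim: n j => [|n IH] j; first by case: ifP => _; congr (_, _); lia.
rewrite [LHS]/=; case ev: (Z.even j); rewrite IH.
  have -> : Z.even (j + 16 * l) by rewrite Z.even_add Z.even_mul ev.
  by congr (_, _); lia.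
have -> : Z.even (j - 16 - 16 * l) = false by rewrite !Z.even_sub Z.even_mul ev.
by congr (_, _); lia.
Qed.

Lemma run_Y8 n l j : run (nseq n OY8) (l, j) =
  if Z.even j then (l + 8 * Z.of_nat n, j) else (l - 8 * Z.of_nat n, j - 16 * Z.of_nat n).
Proof.
elim: n l j => [|n IH] l j; first by case: ifP => _; congr (_, _); lia.
rewrite [LHS]/=; case ev: (Z.even j); rewrite IH.
  by rewrite ev; congr (_, _); lia.
have -> : Z.even (j - 16) = false by rewrite Z.even_sub ev.
by congr (_, _); lia.
Qed.

End ModelZ.

Section ModelPerm.
Variables (b : nat) (e1 e2 : int) (z1 z2 : Z).
Hypothesis b5 : (5 <= b)%N.
Let m := (2 ^ (b - 5))%N.
Let k := (8 * m)%N.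
Let mz := Z.of_nat m.
Let kz := 8 * mz.
Hypotheses (hz1 : (e1 = 1%R /\ z1 = 1) \/ (e1 = (-1)%R /\ z1 = -1)).
Hypotheses (hz2 : (e2 = 1%R /\ z2 = 1) \/ (e2 = (-1)%R /\ z2 = -1)).
Local Notation sem := (sem z1 z2 kz).
Local Notation run := (run z1 z2 kz).
Local Notation cong := (cong kz).

Let m0 : (0 < m)%N. Proof. by rewrite expn_gt0. Qed.
Let p0 : (0 < 2 * k)%N. Proof. by rewrite !muln_gt0. Qed.
Let q0 : (0 < 4 * k)%N. Proof. by rewrite !muln_gt0. Qed.
Let pzE : Z.of_nat (2 * k) = 2 * kz.
Proof. by rewrite /kz /mz /k -!multE !Nat2Z.inj_mul. Qed.
Let qzE : Z.of_nat (4 * k) = 4 * kz.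
Proof. by rewrite /kz /mz /k -!multE !Nat2Z.inj_mul. Qed.
Let mz0 : 0 < mz. Proof. by rewrite /mz; have/ltP := m0; lia. Qed.

Lemma zmod_lt n z : (0 < n)%N -> (Z.to_nat (z mod Z.of_nat n) < n)%N.
Proof. by move=> /ltP n0; apply/ltP; have := Z.mod_pos_bound z (Z.of_nat n); lia. Qed.

Definition zord n (n0 : (0 < n)%N) z : 'I_n := Ordinal (zmod_lt z n0).

Lemma zord_cong n (n0 : (0 < n)%N) z z' t : z = z' + Z.of_nat n * t -> zord n0 z = zord n0 z'.
Proof. by move=> ->; apply: val_inj; rewrite /= (Z.mul_comm _ t) Z_mod_plus_full. Qed.

Lemma zordK n (n0 : (0 < n)%N) (i : 'I_n) : zord n0 (Z.of_nat i) = i.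
Proof.
apply: val_inj; rewrite /= Z.mod_small ?Nat2Z.id //.
by have /ltP := ltn_ord i; lia.
Qed.

Lemma zord_dvd n (n0 : (0 < n)%N) i : zord n0 (Z.of_nat i) = zord n0 0 -> (n %| i)%N.
Proof.
move=> /(congr1 val) /= h.
have/ltP n0' := n0; have := Z.mod_pos_bound (Z.of_nat i) (Z.of_nat n).
have := Z_div_mod_eq_full (Z.of_nat i) (Z.of_nat n).
have q0' := Z.div_pos (Z.of_nat i) (Z.of_nat n).
move=> h1 h2; apply/dvdnP; exists (Z.to_nat (Z.of_nat i / Z.of_nat n)).
apply: Nat2Z.inj; rewrite -multE Nat2Z.inj_mul Z2Nat.id; lia.
Qed.

Let Omega := ('I_(2 * k) * 'I_(4 * k))%type.
Let ofZ (w : Z * Z) : Omega := (zord p0 w.1, zord q0 w.2).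
Let toZ (w : Omega) : Z * Z := (Z.of_nat w.1, Z.of_nat w.2).

Let ofZ_cong w w' : cong w w' -> ofZ w = ofZ w'.
Proof.
move=> [[t h] [u h']]; congr (_, _).
  by apply: (@zord_cong _ _ _ _ t); rewrite h pzE.
by apply: (@zord_cong _ _ _ _ u); rewrite h' qzE.
Qed.

Let toZK w : ofZ (toZ w) = w.
Proof. by case: w => l j; rewrite /ofZ /= !zordK. Qed.

Let toZ_cong z : cong (toZ (ofZ z)) z.
Proof.
case: z => l j; split=> /=.
  exists (- (l / (2 * kz))); rewrite pzE Z2Nat.id; last first.
    by have := Z.mod_pos_bound l (2 * kz); rewrite /kz; lia.
  by have := Z_div_mod_eq_full l (2 * kz); lia.
exists (- (j / (4 * kz))); rewrite qzE Z2Nat.id; last first.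
  by have := Z.mod_pos_bound j (4 * kz); rewrite /kz; lia.
by have := Z_div_mod_eq_full j (4 * kz); lia.
Qed.

Let act o (w : Omega) : Omega := ofZ (sem o (toZ w)).

Let act_ofZ o z : act o (ofZ z) = ofZ (sem o z).
Proof. by apply: ofZ_cong; apply: sem_cong; apply: toZ_cong. Qed.

Let iter_act n o z : iter n (act o) (ofZ z) = ofZ (run (nseq n o) z).
Proof. by elim: n z => // n IH z; rewrite iterSr act_ofZ IH. Qed.

Let check_all s1 s2 : check_signs s1 s2 -> check z1 z2 (s1 z1 z2) (s2 z1 z2).
Proof.
rewrite /check_signs /= !andbT => /andP[/andP[h1 h2] /andP[h3 h4]].
by case: hz1 => -[_ ->]; case: hz2 => -[_ ->].
Qed.

Let iter_A n z : ofZ (run (nseq (8 * n) OA) z) = ofZ (run (nseq n OA8) z).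
Proof.
apply: ofZ_cong; apply: run_nseq8.
by apply: (@check_all (fun _ _ => nseq 8 OA) (fun _ _ => [:: OA8])); vm_compute.
Qed.

Let iter_Y n z : ofZ (run (nseq (8 * n) OY) z) = ofZ (run (nseq n OY8) z).
Proof.
apply: ofZ_cong; apply: run_nseq8.
by apply: (@check_all (fun _ _ => nseq 8 OY) (fun _ _ => [:: OY8])); vm_compute.
Qed.

Let iter_X n z : ofZ (run (nseq n OX) z) = ofZ (z.1, z.2 + Z.of_nat n).
Proof.
elim: n z => [|n IH] [l j]; first by rewrite Z.add_0_r.
by rewrite [run _ _]/= IH /=; congr (ofZ (_, _)); lia.
Qed.

Let act_Ap : iter (2 * k) (act OA) =1 id.
Proof.
move=> w; rewrite -(toZK w) iter_act (_ : (2 * k = 8 * (2 * m))%N); last by rewrite /k mulnCA.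
rewrite iter_A; case: (toZ w) => l j; rewrite run_A8; apply: ofZ_cong; split; first by exists 0; rewrite /=; ring.
rewrite -multE Nat2Z.inj_mul -/mz /= /kz; case: ifP => _; [exists l|exists (- (1 + l))]; ring.
Qed.

Let act_Yp : iter (2 * k) (act OY) =1 id.
Proof.
move=> w; rewrite -(toZK w) iter_act (_ : (2 * k = 8 * (2 * m))%N); last by rewrite /k mulnCA.
rewrite iter_Y; case: (toZ w) => l j; rewrite run_Y8; apply: ofZ_cong.
rewrite -multE Nat2Z.inj_mul -/mz /kz; case: ifP => _; split=> /=;
  first [by exists 1; ring | by exists 0; ring | by exists (-1); ring].
Qed.

Let act_Xq : iter (4 * k) (act OX) =1 id.
Proof.
move=> w; rewrite -(toZK w) iter_act iter_X qzE; apply: ofZ_cong.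
by split=> /=; [exists 0; ring|exists 1; ring].
Qed.

(** The periods are computed before the permutations are formed, because they supply injectivity. *)
Let iter_id_inj (T : Type) n (f : T -> T) : (0 < n)%N -> iter n f =1 id -> injective f.
Proof. by case: n => // n _ h x y e; rewrite -(h x) -(h y) !iterSr e. Qed.

Let pA : {perm Omega} := perm (iter_id_inj p0 act_Ap).
Let pY : {perm Omega} := perm (iter_id_inj p0 act_Yp).
Let pX : {perm Omega} := perm (iter_id_inj q0 act_Xq).

Let pAE z : pA (ofZ z) = ofZ (sem OA z). Proof. by rewrite permE act_ofZ. Qed.
Let pYE z : pY (ofZ z) = ofZ (sem OY z). Proof. by rewrite permE act_ofZ. Qed.
Let pXE z : pX (ofZ z) = ofZ (sem OX z). Proof. by rewrite permE act_ofZ. Qed.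

Let pA_n n z : (pA ^+ n)%g (ofZ z) = ofZ (run (nseq n OA) z).
Proof. by rewrite permX -iter_act; apply: eq_iter => w; rewrite permE. Qed.
Let pY_n n z : (pY ^+ n)%g (ofZ z) = ofZ (run (nseq n OY) z).
Proof. by rewrite permX -iter_act; apply: eq_iter => w; rewrite permE. Qed.
Let pX_n n z : (pX ^+ n)%g (ofZ z) = ofZ (z.1, (z.2 + Z.of_nat n)).
Proof. by rewrite -iter_X permX -iter_act; apply: eq_iter => w; rewrite permE. Qed.

(** The [m] eighth powers add $2kl$ to an even [j] and $-2k(1+l)$ to an odd one; modulo $4k$ this is
    0 exactly when [l] and [j] have equal parity. *)
Let pAk z : (pA ^+ k)%g (ofZ z) = ofZ (sem OAk z).
Proof.
rewrite pA_n /k iter_A; case: z => l j; rewrite run_A8 -/mz; apply: ofZ_cong.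
split=> /=; first by exists 0; ring.
rewrite /kz; case ej: (Z.even j); case el: (Z.even l) => /=.
- have [t ->] : exists t, l = (2 * t) by exists (l / 2); rewrite -Z_div_exact_full_2 ?Zmod_even ?el.
  by exists t; ring.
- have [t ->] : exists t, l = (2 * t + 1).
    by exists (l / 2); rewrite {1}(Z_div_mod_eq_full l 2) Zmod_even el.
  by exists t; ring.
- have [t ->] : exists t, l = (2 * t) by exists (l / 2); rewrite -Z_div_exact_full_2 ?Zmod_even ?el.
  by exists (- t - 1); ring.
- have [t ->] : exists t, l = (2 * t + 1).
    by exists (l / 2); rewrite {1}(Z_div_mod_eq_full l 2) Zmod_even el.
  by exists (- t - 1); ring.
Qed.

Let pYk z : (pY ^+ k)%g (ofZ z) = ofZ (sem OYk z).
Proof.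
rewrite pY_n /k iter_Y; case: z => l j; rewrite run_Y8 -/mz; apply: ofZ_cong.
by rewrite /kz /=; case: ifP => _; split; exists 0; rewrite /=; ring.
Qed.

Let i2z (n : int) : Z := match n with Posz n => Z.of_nat n | Negz n => - Z.of_nat n.+1 end.

Let pX_z (n : int) z : (zexpg pX n : {perm Omega}) (ofZ z) = ofZ (z.1, (z.2 + i2z n)).
Proof.
case: n => n /=; first exact: pX_n.
apply: (@perm_inj _ (pX ^+ n.+1)%g); rewrite -permM mulVg perm1 pX_n.
by case: z => l j; congr (ofZ (_, _)); rewrite /=; lia.
Qed.

Let k' : (2 ^ (b - 2) = k)%N.
Proof.
by rewrite /k /m -[8%N]/(2 ^ 3)%N -expnD; congr (2 ^ _)%N; rewrite addnBA // -subnBA.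
Qed.
Let p' : (2 ^ (b - 1) = 2 * k)%N.
Proof. by rewrite -k' -expnS; congr (2 ^ _)%N; rewrite -subnSK // (leq_trans _ b5). Qed.
Let q' : (2 ^ b = 4 * k)%N.
Proof.
by rewrite -k' -[4%N]/(2 ^ 2)%N -expnD; congr (2 ^ _)%N; rewrite subnKC // (leq_trans _ b5).
Qed.

Let pXk (n : int) n0 n1 z :
  i2z n = (n0 + kz * n1) -> (zexpg pX n : {perm Omega}) (ofZ z) = ofZ (sem (OXn n0 n1) z).
Proof. by move=> h; rewrite pX_z h; case: z => l j /=; congr (ofZ (_, _)); ring. Qed.

Let pAp : (pA ^+ (2 * k))%g = 1%g.
Proof. by apply/permP => w; rewrite perm1 permX -[RHS]act_Ap; apply: eq_iter => u; rewrite permE. Qed.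
Let pYp : (pY ^+ (2 * k))%g = 1%g.
Proof. by apply/permP => w; rewrite perm1 permX -[RHS]act_Yp; apply: eq_iter => u; rewrite permE. Qed.
Let pXq : (pX ^+ (4 * k))%g = 1%g.
Proof. by apply/permP => w; rewrite perm1 permX -[RHS]act_Xq; apply: eq_iter => u; rewrite permE. Qed.

Let i2zE n : i2z n = Z_of_int n. Proof. by case: n => n; rewrite /i2z; lia. Qed.

Let i2z_e1 (n : int) : i2z (n + e1 * k%:Z)%R = i2z n + kz * z1.
Proof. by rewrite !i2zE /kz /mz /k; case: hz1 => -[-> ->]; lia. Qed.

Let i2z_e2 (n : int) : i2z (n + e2 * k%:Z)%R = i2z n + kz * z2.
Proof. by rewrite !i2zE /kz /mz /k; case: hz2 => -[-> ->]; lia. Qed.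

Let pXV z : (pX^-1)%g (ofZ z) = ofZ (sem (OXn (-1) 0) z).
Proof. by rewrite -(pXk (n := (-1)%R)) // i2zE; lia. Qed.

Let word s1 s2 z : check_signs s1 s2 -> ofZ (run (s1 z1 z2) z) = ofZ (run (s2 z1 z2) z).
Proof. by move=> h; apply/ofZ_cong/checkP/check_all. Qed.

Let zV (g : {perm Omega}) : (g ^+ (2 * k) = 1)%g ->
  zexpg g (-1 + k%:Z)%R = ((g * g ^+ k)^-1)%g.
Proof.
move=> gk; have -> : (g * g ^+ k = zexpg g (1 + k%:Z)%R)%g by rewrite zexpgD.
by rewrite -zexpgN; apply: (zexpg_eqmod (t := 1%R) gk); lia.
Qed.

(** No operation stands for an inverse of [pA] or [pY], so each relation is first multiplied out
    until these occur with positive exponents only. *)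
Lemma model_rel : gamma3_rel b e1 e2 pA pX pY.
Proof.
rewrite /gamma3_rel /rot_rel k' p' q'.
have sq (g : {perm Omega}) : (forall z, g (g (ofZ z)) = ofZ z) -> (g ^+ 2 = 1)%g.
  by move=> h; apply/permP => w; rewrite -(toZK w) perm1 expg2 permM h.
split; [split; split=> //| | | |].
- apply: sq => z; rewrite !permM !(pAE, pXE).
  by apply: (@word (fun _ _ => [:: OA; OX; OA; OX]) (fun _ _ => [::])); vm_compute.
- apply: sq => z; rewrite !permM !(pYE, pXE).
  by apply: (@word (fun _ _ => [:: OX; OY; OX; OY]) (fun _ _ => [::])); vm_compute.
- apply: sq => z; rewrite !permM !(pAE, pYE, pXE).
  by apply: (@word (fun _ _ => [:: OA; OX; OY; OA; OX; OY]) (fun _ _ => [::])); vm_compute.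
- rewrite zV //; apply: (mulgI (pA * pA ^+ k)%g); rewrite mulKVg !mulgA.
  apply/permP => w; rewrite -(toZK w) !permM (pXk (n0 := -3) (n1 := z1)) ?i2z_e1 //.
  rewrite !(pAE, pAk, pXV).
  by apply: (@word (fun e1 _ => [:: OA; OAk; OXn (-1) 0; OA]) (fun e1 _ => [:: OXn (-3) e1]) (toZ w));
    vm_compute.
- apply: (mulIg pA); rewrite mulgVK zexpgD zexpg1r.
  apply/permP => w; rewrite -(toZK w) !permM pXE pAE (pAk (sem _ _)).
  rewrite (pXk (n0 := 3) (n1 := z1)) ?i2z_e1 // pAE.
  by apply: (@word (fun e1 _ => [:: OX]) (fun e1 _ => [:: OA; OAk; OXn 3 e1; OA]) (toZ w)); vm_compute.
- apply: (mulgI pY); rewrite mulKVg (zexpgD pY) zexpg1r.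
  apply/permP => w; rewrite -(toZK w) !permM pXE pYE.
  rewrite (pXk (n0 := 3) (n1 := z2)) ?i2z_e2 // pYE (pYk (sem _ _)).
  by apply: (@word (fun _ _ => [:: OX]) (fun _ e2 => [:: OY; OXn 3 e2; OY; OYk]) (toZ w)); vm_compute.
- rewrite zV //; apply: (mulIg (pY * pY ^+ k)%g); rewrite mulgVK !mulgA.
  apply/permP => w; rewrite -(toZK w) !permM (pXk (n0 := -3) (n1 := z2)) ?i2z_e2 //.
  rewrite !(pYE, pYk, pXV).
  by apply: (@word (fun _ e2 => [:: OY; OXn (-1) 0; OY; OYk]) (fun _ e2 => [:: OXn (-3) e2]) (toZ w));
    vm_compute.
Qed.

(** The point [(0, 0)] is the trivial coset: [pA] fixes it, and $y^lx^j$ takes it to [(l, j)], which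
    determines [l] and [j]. The order of [pA] must be seen at another point. *)
Lemma model_nf i l j : (pA ^+ i * pY ^+ l * pX ^+ j = 1)%g ->
  [/\ 2 ^ (b - 1) %| i, 2 ^ (b - 1) %| l & 2 ^ b %| j]%N.
Proof.
move=> e; have fixA n : (pA ^+ n)%g (ofZ (0, 0)) = ofZ (0, 0).
  elim: n => [|n IH]; first by rewrite expg0 perm1.
  by rewrite expgS permM pAE -[RHS]IH /= /djA /tab /rowA /= !Z.mul_0_r Z.add_0_r.
have Yn n : (pY ^+ n)%g (ofZ (0, 0)) = ofZ (Z.of_nat n, 0).
  elim: n => [|n IH]; first by rewrite expg0 perm1.
  rewrite expgSr permM IH pYE /= /djY /dlY /tab /= !Z.mul_0_r !Z.add_0_r.
  by congr (ofZ (_, _)); lia.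
have := congr1 (fun g : {perm Omega} => g (ofZ (0, 0))) e.
rewrite !permM fixA Yn pX_n perm1 Z.add_0_l => e0.
have hl := zord_dvd (congr1 fst e0 : zord p0 (Z.of_nat l) = zord p0 0).
have hj := zord_dvd (congr1 snd e0 : zord q0 (Z.of_nat j) = zord q0 0).
rewrite p' q'; split=> //; move: e.
move: hl hj => /dvdnP[u ->] /dvdnP[v ->].
rewrite (mulnC u) (mulnC v) (expgnA pY (2 * k)) (expgnA pX (4 * k)) pYp pXq !expg1n !mulg1 => e.
rewrite -p'; have /dvdn_pfactor : #[pA]%g %| (2 ^ (b - 1))%N by rewrite p' order_dvdn pAp.
case=> // c cb ec; have := order_dvdn pA i; rewrite e eqxx ec => h.
apply: dvdn_trans h; rewrite dvdn_exp2l //; case: ltngtP cb => // cb _.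
(* A smaller order, being a power of two, would divide [k]; but [pA ^+ k] takes [(1, 0)] to
   [(1, 2k)]. *)
have: (pA ^+ k = 1)%g.
  apply/eqP; rewrite -order_dvdn ec -k' dvdn_exp2l //.
  by rewrite -ltnS (leq_trans cb) // subnSK // (leq_trans _ b5).
move/(congr1 (fun g : {perm Omega} => g (ofZ (1, 0)))); rewrite pAk perm1 /=.
move/(congr1 snd)/(congr1 val)/(congr1 Z.of_nat); rewrite /= Z.add_0_l qzE Z2Nat.id.
  by rewrite Z.mod_small /kz; lia.
by have := Z.mod_pos_bound (kz * 2) (4 * kz); rewrite /kz; lia.
Qed.

End ModelPerm.

Lemma gamma_model (b : nat) (e1 e2 : int) : (5 <= b)%N ->
  (e1 = 1%R \/ e1 = (-1)%R) -> (e2 = 1%R \/ e2 = (-1)%R) ->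
  exists (gT : finGroupType) (a x y : gT), gamma3_rel b e1 e2 a x y /\
    forall i l j, (a ^+ i * y ^+ l * x ^+ j = 1)%g ->
      [/\ 2 ^ (b - 1) %| i, 2 ^ (b - 1) %| l & 2 ^ b %| j]%N.
Proof.
move=> b5 h1 h2.
have key (e : int) : e = 1%R \/ e = (-1)%R -> exists z : Z, (e = 1%R /\ z = 1) \/ (e = (-1)%R /\ z = -1).
  by case=> ->; [exists 1; left|exists (-1); right].
have [z1 hz1] := key _ h1; have [z2 hz2] := key _ h2.
do 4 eexists; split; first exact: (model_rel b5 hz1 hz2).
exact: model_nf.
Qed.

End PermutationModel.

(** * Consequences of the relations *)

From mathcomp Require Import ring.

Section Relations.
Local Open Scope group_scope.
Local Notation "x ^^ n" := (zexpg x n%R) (at level 29, left associativity).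

(** * The facet group of [a] and [x], later applied to [y] and [x] as well *)

Section Facet.
Variables (G : groupType) (a x : G) (k m : nat) (e t s : int).
Hypotheses (kE : k = (8 * m)%N) (m0 : 0 < m) (h3 : (3 * t = 1 + 4 * k%:Z * s)%R).
Hypothesis (e1 : e = 1%R \/ e = (-1)%R).
Hypotheses (ak : a ^+ (2 * k) = 1) (xk : x ^+ (4 * k) = 1) (ax : (a * x) ^+ 2 = 1).
Hypothesis R2 : x^-1 * a = a ^^ (-1 + k%:Z) * x ^^ (-3 + e * k%:Z).
Hypothesis R3 : x * a^-1 = a ^^ (1 + k%:Z) * x ^^ (3 + e * k%:Z).

Let kz : (k%:Z = 8 * m%:Z)%R. Proof. by rewrite kE; lia. Qed.
Let kz4 : ((4 * k)%N%:Z = 32 * m%:Z)%R. Proof. by rewrite kE; lia. Qed.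

Let axa : a * x * a = x^-1.
Proof. by apply: (mulIg x); rewrite mulVg -ax expg2 !mulgA. Qed.

Let aV : a ^^ (- k%:Z) = a ^^ k%:Z.
Proof. by apply: (zexpg_eqmod (t := (-1)%R) ak); lia. Qed.

(** [R3] computes $a^{-1}xa^{-1}$ and [R2] computes its inverse; comparing them gives
    $a^kx^{3+ek}=x^{3-ek}a^k$. It remains to separate $x^{ek}$. *)
Lemma facet_conj_x3 : a ^+ k * x ^^ 3 = x ^^ (3 + 2 * k%:Z) * a ^+ k.
Proof.
have key : a ^+ k * x ^^ (3 + e * k%:Z) = x ^^ (3 - e * k%:Z) * a ^+ k.
  have <- : a^-1 * x * a^-1 = a ^+ k * x ^^ (3 + e * k%:Z).
    by rewrite -mulgA R3 mulgA zexpgD zexpg1r mulgA mulVg mul1g.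
  have: a * x^-1 * a = a ^+ k * x ^^ (-3 + e * k%:Z).
    by rewrite -mulgA R2 zexpgD !mulgA zexpgN zexpg1r mulgV mul1g.
  move/(congr1 (fun g => g^-1)); rewrite !invMg invgK -zexpgN mulgA => ->.
  rewrite -[in RHS]/(zexpg a k) -aV (zexpgN a); congr (_ * _); congr zexpg; lia.
have c24 n : a ^+ k * x ^^ ((3 + e * k%:Z) * n) = x ^^ ((3 - e * k%:Z) * n) * a ^+ k.
  by rewrite !zexpgM; apply: intertwine_zexpg.
(* The exponent $3ek$ is chosen because $(3\pm ek)\cdot3ek\equiv9ek\equiv ek$ modulo $4k$. *)
have ck : a ^+ k * x ^^ (e * k%:Z) = x ^^ (e * k%:Z) * a ^+ k.
  have := c24 (3 * (e * k%:Z))%R.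
  rewrite (zexpg_eqmod (n := (e * k%:Z)%R) (t := (2 * e + 6 * m%:Z)%R) xk); last first.
    by case: e1 => ->; rewrite ?kz4 ?kz; ring.
  rewrite (zexpg_eqmod (n := (e * k%:Z)%R) (t := (2 * e - 6 * m%:Z)%R) xk) //.
  by case: e1 => ->; rewrite ?kz4 ?kz; ring.
move: key; rewrite zexpgD mulgA => h; apply: (mulIg (x ^^ (e * k%:Z))).
rewrite h -mulgA ck mulgA -zexpgD.
congr (_ * _); case: e1 => ->; [apply: (zexpg_eqmod (t := (-1)%R) xk)|
  apply: (zexpg_eqmod (t := 0%R) xk)]; rewrite kz4 kz; ring.
Qed.

(** Raise the previous identity to the power [t], the inverse of 3 modulo $4k$; since [t] is odd,
    $2kt\equiv2k$. *)
Lemma facet_conj_x : a ^+ k * x = x ^^ (1 + 2 * k%:Z) * a ^+ k.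
Proof.
have ex : (x ^^ 3) ^^ t = x.
  rewrite -zexpgM -[RHS]zexpg1r; apply: (zexpg_eqmod (t := s) xk).
  by rewrite h3 kz4 kz; ring.
rewrite -{1}ex (intertwine_zexpg _ facet_conj_x3) -zexpgM; congr (_ * _).
have [u eu] : exists u, (t = 1 + 2 * u)%R by exists (16 * m%:Z * s - t)%R; move: h3; rewrite kz; lia.
apply: (zexpg_eqmod (t := (s + u)%R) xk).
have -> : ((3 + 2 * k%:Z) * t = 3 * t + 2 * k%:Z * t)%R by ring.
by rewrite h3 {1}eu kz4 kz; ring.
Qed.

Lemma facet_comm_x2 n : commute (a ^+ k) (x ^^ (2 * n)).
Proof.
rewrite /commute mulrC zexpgM (intertwine_zexpg _ (intertwine_zexpg n facet_conj_x)).
rewrite -!zexpgM; congr (_ * _); apply: (zexpg_eqmod (t := n) xk); lia.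
Qed.

Let xa : x * a = a^-1 * x^-1.
Proof. by apply: (mulgI a); rewrite !mulgA axa mulgV mul1g. Qed.

Lemma facet_x2_a : x ^^ 2 * a = a ^^ (1 + k%:Z) * x ^^ (2 + e * k%:Z).
Proof.
have -> : x ^^ 2 = x * x by [].
rewrite -mulgA xa mulgA R3 -mulgA -[x^-1]/((x ^^ 1)^-1) -zexpgN -zexpgD.
by congr (_ * _ ^^ _); ring.
Qed.

(** Passing $x^2$ across [a] twice yields two factors $a^k$, which cancel, and the exponent
    $4+2ek\equiv4+2k$ modulo $4k$. *)
Lemma facet_x4_a : x ^^ 4 * a = a * x ^^ (4 + 2 * k%:Z).
Proof.
have -> : x ^^ 4 = x ^^ 2 * x ^^ 2 by rewrite -zexpgD.
have ea : a ^^ (1 + k%:Z) = a * a ^+ k by rewrite zexpgD.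
rewrite -mulgA facet_x2_a {1}ea !mulgA facet_x2_a -(mulgA _ _ (a ^+ k)).
have -> : (2 + e * k%:Z = 2 * (1 + e * (4 * m%:Z)))%R by rewrite kz; ring.
rewrite -facet_comm_x2 -!mulgA -zexpgD mulgA -[a ^+ k]/(a ^^ k%:Z) -zexpgD.
rewrite (zexpg_eqmod (n := 1%R) (t := 1%R) ak); last by lia.
rewrite zexpg1r; case: e1 => ->.
  by rewrite (zexpg_eqmod (n := (4 + 2 * k%:Z)%R) (t := 0%R) xk) // kz4 kz; ring.
by rewrite (zexpg_eqmod (n := (4 + 2 * k%:Z)%R) (t := (-1)%R) xk) // kz4 kz; ring.
Qed.

Lemma facet_x4_ai (i : nat) n : exists n', x ^^ (4 * n) * a ^+ i = a ^+ i * x ^^ (4 * n').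
Proof.
elim: i n => [|i IH] n; first by exists n; rewrite mulg1 mul1g.
have e4 : x ^^ (4 * n) * a = a * x ^^ (4 * ((1 + 4 * m%:Z) * n)).
  have h : (x ^^ 4) ^ a = x ^^ (4 + 2 * k%:Z).
    by rewrite conjgE facet_x4_a mulKg.
  have -> : (4 * ((1 + 4 * m%:Z) * n) = (4 + 2 * k%:Z) * n)%R by rewrite kz; ring.
  by rewrite !zexpgM -h -zexpg_conj conjgE !mulgA mulgV mul1g.
have [n' en'] := IH ((1 + 4 * m%:Z) * n)%R; exists n'.
by rewrite expgS mulgA e4 -mulgA en' mulgA.
Qed.

Let k0 : 0 < 2 * k. Proof. by rewrite kE; lia. Qed.
Let k40 : 0 < 4 * k. Proof. by rewrite kE; lia. Qed.

(** Crossing one [a] turns $x$ into $x^{-1}$, and $x^{-1}$ into $x$ times a power of $x^4$. Hence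
    the joint induction; [facet_x4_ai] absorbs the power of $x^4$. *)
Lemma facet_x_ai (i : nat) :
  [/\ exists (i' : nat) j, x * a ^+ i = a ^+ i' * x ^^ j &
      exists (i' : nat) j, x^-1 * a ^+ i = a ^+ i' * x ^^ j].
Proof.
elim: i => [|i [[i1 [j1 IH1]] [i2 [j2 IH2]]]].
  by split; [exists 0, 1%R|exists 0, (-1)%R]; rewrite ?zexpgN mulg1 mul1g.
split.
  have [n en] := zexpg_nat (-1)%R k0 ak.
  exists (n + i2)%N, j2; rewrite expgS mulgA xa -mulgA IH2 mulgA expgnDr -en.
  by rewrite zexpgN.
have [n en] := zexpg_nat (-1 + k%:Z)%R k0 ak.
have [n' en'] := facet_x4_ai i1 (-1 + e * (2 * m%:Z))%R.
exists (n + i1)%N, (4 * n' + j1)%R.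
rewrite expgS mulgA R2 en expgnDr.
have -> : (-3 + e * k%:Z = 4 * (-1 + e * (2 * m%:Z)) + 1)%R by rewrite kz; ring.
by rewrite zexpgS -!mulgA IH1 (mulgA _ (a ^+ i1)) en' zexpgD !mulgA.
Qed.

Lemma facet_swap (i : nat) j : exists (i' : nat) j', x ^^ j * a ^+ i = a ^+ i' * x ^^ j'.
Proof.
have [n ->] := zexpg_nat j k40 xk.
elim: n => [|n [i1 [j1 IH]]]; first by exists i, 0%R; rewrite mulg1 mul1g.
have [[i2 [j2 h]] _] := facet_x_ai i1; exists i2, (j2 + j1)%R.
by rewrite expgS -mulgA IH mulgA h zexpgD mulgA.
Qed.

End Facet.

(** An inverse of 3 is lifted from one power of two to the next: it stays when [s] is even, and
    [2 ^ b] is added when [s] is odd. *)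
Lemma pow2_inv3 b : exists t s : int, (3 * t = 1 + (2 ^ b)%N%:Z * s)%R.
Proof.
elim: b => [|b [t [s h]]]; first by exists 1%R, 2%R.
have [u [hs|hs]] : exists u : int, s = (2 * u)%R \/ s = (2 * u + 1)%R.
  by exists (s %/ 2)%Z; lia.
  by exists t, u; rewrite h hs expnS PoszM; ring.
by exists (t + (2 ^ b)%N%:Z)%R, (u + 2)%R; rewrite mulrDr h hs expnS PoszM; ring.
Qed.

(** * Normal form and mirror in any group satisfying the relations *)

Section Gamma.
Variables (G : groupType) (a x y : G) (b : nat) (e1 e2 : int).
Hypotheses (b5 : 5 <= b) (he1 : e1 = 1%R \/ e1 = (-1)%R) (he2 : e2 = 1%R \/ e2 = (-1)%R).
Hypothesis rel : gamma3_rel b e1 e2 a x y.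
Let k := (2 ^ (b - 2))%N.
Let m := (2 ^ (b - 5))%N.

Let kE : k = (8 * m)%N.
Proof. by rewrite /k /m -[8]/(2 ^ 3)%N -expnD; congr (2 ^ _)%N; lia. Qed.
Let m0 : 0 < m. Proof. by rewrite expn_gt0. Qed.
Let pE : (2 ^ (b - 1))%N = (2 * k)%N.
Proof. by rewrite /k -expnS; congr (2 ^ _)%N; lia. Qed.
Let qE : (2 ^ b)%N = (4 * k)%N.
Proof. by rewrite /k -[4]/(2 ^ 2)%N -expnD; congr (2 ^ _)%N; lia. Qed.
Let inv3 : exists t s : int, (3 * t = 1 + 4 * k%:Z * s)%R.
Proof.
have [t [s h]] := pow2_inv3 b; by exists t, s; rewrite h qE PoszM.
Qed.

Let ak : a ^+ (2 * k) = 1. Proof. by case: rel => -[[h _ _] _] *; rewrite -pE. Qed.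
Let xk : x ^+ (4 * k) = 1. Proof. by case: rel => -[[_ h _] _] *; rewrite -qE. Qed.
Let yk : y ^+ (2 * k) = 1. Proof. by case: rel => -[[_ _ h] _] *; rewrite -pE. Qed.
Let axx : (a * x) ^+ 2 = 1. Proof. by case: rel => -[_ []]. Qed.
Let xyy : (x * y) ^+ 2 = 1. Proof. by case: rel => -[_ []]. Qed.
Let axy : (a * x * y) ^+ 2 = 1. Proof. by case: rel => -[_ []]. Qed.
Let yxx : (y * x) ^+ 2 = 1.
Proof.
have -> : y * x = (x * y) ^ x by rewrite conjgE !mulgA mulVg mul1g.
by rewrite -conjXg xyy conj1g.
Qed.
Let R2 : x^-1 * a = a ^^ (-1 + k%:Z) * x ^^ (-3 + e1 * k%:Z).
Proof. by case: rel. Qed.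
Let R3 : x * a^-1 = a ^^ (1 + k%:Z) * x ^^ (3 + e1 * k%:Z).
Proof. by case: rel. Qed.
Let R4 : y^-1 * x = x ^^ (3 + e2 * k%:Z) * y ^^ (1 + k%:Z).
Proof. by case: rel. Qed.
Let R5 : y * x^-1 = x ^^ (-3 + e2 * k%:Z) * y ^^ (-1 + k%:Z).
Proof. by case: rel. Qed.
(** Inverting the relations between [y] and [x], with $y^{-k}=y^k$, gives the facet relations for
    [y], [x] with sign [- e2]. One analysis thus serves both pairs. *)
Let R2y : x^-1 * y = y ^^ (-1 + k%:Z) * x ^^ (-3 + (- e2) * k%:Z).
Proof.
have /(congr1 (fun g => g^-1)) := R4; rewrite !invMg invgK -!zexpgN => ->.
rewrite (zexpg_eqmod (n := (-1 + k%:Z)%R) (t := (-1)%R) yk); last lia.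
by congr (_ * _ ^^ _); ring.
Qed.
Let R3y : x * y^-1 = y ^^ (1 + k%:Z) * x ^^ (3 + (- e2) * k%:Z).
Proof.
have /(congr1 (fun g => g^-1)) := R5; rewrite !invMg invgK -!zexpgN => ->.
rewrite (zexpg_eqmod (n := (1 + k%:Z)%R) (t := (-1)%R) yk); last lia.
by congr (_ * _ ^^ _); ring.
Qed.
Let he2N : (- e2)%R = 1%R \/ (- e2)%R = (-1)%R.
Proof. by case: he2 => ->; [right|left; rewrite opprK]. Qed.

(** By [facet_conj_x], a trivial $a^k$ gives $x=x^{1+2k}$. Conversely, a quotient in which $x^{2k}$
    survives keeps the full order of [a]. *)
Lemma gamma_a_kill : a ^+ (2 ^ (b - 2))%N = 1 -> x ^+ (2 ^ (b - 1))%N = 1.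
Proof.
case: inv3 => t [s h3] a1.
have := facet_conj_x kE m0 h3 he1 ak xk R2 R3.
rewrite -/k in a1; rewrite a1 mul1g mulg1 zexpgD => h; apply: (mulgI x).
by rewrite mulg1 pE [RHS]h; congr (_ * _ ^+ _); lia.
Qed.

Lemma gamma_y_kill : y ^+ (2 ^ (b - 2))%N = 1 -> x ^+ (2 ^ (b - 1))%N = 1.
Proof.
case: inv3 => t [s h3] y1.
have := facet_conj_x kE m0 h3 he2N yk xk R2y R3y.
rewrite -/k in y1; rewrite y1 mul1g mulg1 zexpgD => h; apply: (mulgI x).
by rewrite mulg1 pE [RHS]h; congr (_ * _ ^+ _); lia.
Qed.

Lemma gamma_y_conj_a : y * a = x^-1 * a^-1 * x * y.
Proof.
have : a * x * (y * a) * x * y = 1 by rewrite -axy expg2 !mulgA.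
move=> h; apply: (mulgI (a * x)); apply: (mulIg (x * y)); rewrite !mulgA mulgK mulgV mul1g.
by rewrite !mulgA in h; rewrite h -mulgA -expg2 xyy.
Qed.

Definition gamma_nf (g : G) := exists i l j : nat, g = a ^+ i * y ^+ l * x ^+ j.

Let k40 : 0 < 4 * k. Proof. by rewrite muln_gt0 expn_gt0. Qed.
Let k20 : 0 < 2 * k. Proof. by rewrite muln_gt0 expn_gt0. Qed.

Let nf_xy j (l j2 i : nat) : gamma_nf (a ^+ i * (x ^^ j * y ^+ l * x ^+ j2)).
Proof.
case: inv3 => t [s h3].
have [l' [j' ->]] := facet_swap kE m0 h3 he2N yk xk yxx R2y R3y l j.
have [n en] := zexpg_nat (j' + j2%:Z)%R k40 xk.
by exists i, l', n; rewrite -en zexpgD !mulgA.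
Qed.

Lemma gamma_swap_a (i : nat) : exists i' j' : nat, x * a ^+ i = a ^+ i' * x ^+ j'.
Proof.
case: inv3 => t [s h3].
have [i' [j' h]] := facet_swap kE m0 h3 he1 ak xk axx R2 R3 i 1%R.
by have [n en] := zexpg_nat j' k40 xk; exists i', n; rewrite -en -h.
Qed.

Lemma gamma_swap_y (l : nat) : exists l' j' : nat, x * y ^+ l = y ^+ l' * x ^+ j'.
Proof.
case: inv3 => t [s h3].
have [l' [j' h]] := facet_swap kE m0 h3 he2N yk xk yxx R2y R3y l 1%R.
by have [n en] := zexpg_nat j' k40 xk; exists l', n; rewrite -en -h.
Qed.

Lemma gamma_nf1 : gamma_nf 1.
Proof. by exists 0, 0, 0; rewrite !mulg1. Qed.

Lemma gamma_nf_a g : gamma_nf g -> gamma_nf (a * g).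
Proof. by case=> i [l [j ->]]; exists i.+1, l, j; rewrite expgS !mulgA. Qed.

Lemma gamma_nf_x g : gamma_nf g -> gamma_nf (x * g).
Proof.
case=> i [l [j ->]]; case: inv3 => t [s h3].
have [i' [j' h]] := facet_swap kE m0 h3 he1 ak xk axx R2 R3 i 1%R.
rewrite zexpg1r in h; rewrite !mulgA h -!mulgA (mulgA _ (y ^+ l)).
exact: nf_xy.
Qed.

(** Here $ya^i=x^{-1}a^{-i}xy$; the leading $x^{-1}$ is then pushed past the power of [a] by
    [facet_swap]. *)
Lemma gamma_nf_y g : gamma_nf g -> gamma_nf (y * g).
Proof.
case=> i [l [j ->]]; case: inv3 => t [s h3].
have [n en] := zexpg_nat (- i%:Z)%R k20 ak.
have [i' [j' h]] := facet_swap kE m0 h3 he1 ak xk axx R2 R3 n (-1)%R.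
have e : y * a ^+ i = x^-1 * a ^+ n * x * y.
  have -> : a ^+ n = (a ^+ i)^-1 by rewrite -en zexpgN.
  elim: i {en h} => [|i IH]; first by rewrite invg1 !mulg1 mulVg mul1g.
  by rewrite [in LHS]expgSr mulgA IH -mulgA gamma_y_conj_a (expgS _ i) invMg !mulgA mulgK.
rewrite zexpgN zexpg1r in h.
rewrite !mulgA e h -!mulgA (mulgA _ x) -zexpgS (mulgA y) -expgS (mulgA _ (y ^+ _)).
exact: nf_xy.
Qed.

(* If x^(2k) = 1 the signs of the exponents of x in the relations become
   irrelevant, and the relations are invariant under the mirror
   (a, x, y) -> (a^-1, x^-1, x^2 y). *)
Lemma gamma_mirror : x ^+ (2 ^ (b - 1))%N = 1 ->
  gamma3_rel b e1 e2 a^-1 x^-1 (x * x * y).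
Proof.
(* The image of [y] is $xy^{-1}x^{-1}$. It therefore has the order of [y], and its relations with
   $x^{-1}$ are conjugates of relations between $y^{-1}$ and $x^{-1}$. *)
rewrite pE => x2; have c2 : x * x * y = y^-1 ^ x^-1.
  have exy : x * y = y^-1 * x^-1.
    by apply: (mulIg (x * y)); rewrite -expg2 xyy !mulgA mulgVK mulVg.
  by rewrite conjgE invgK -mulgA exy.
have eqx n n' u : (n = n' + 2 * k%:Z * u)%R -> x ^^ n = x ^^ n'.
  by move=> h; apply: (zexpg_eqmod (t := u) x2); rewrite h; lia.
have ayy : y * a^-1 = x^-1 * a * x * y.
  by apply: (mulIg a); rewrite mulgVK -!mulgA gamma_y_conj_a !mulgA mulgK mulgK mulVg mul1g.
split.
- rewrite /rot_rel pE qE; split; split; rewrite ?expVgn ?ak ?xk ?invg1 //.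
  + by rewrite c2 -conjXg expVgn yk invg1 conj1g.
  + have -> : a^-1 * x^-1 = ((a * x)^-1) ^ a by rewrite conjgE invMg -!mulgA mulVg mulg1 .
    by rewrite -conjXg expVgn axx invg1 conj1g.
  + by rewrite !mulgA mulVg mul1g.
  + by rewrite mulgA mulgA mulgVK expg2 !mulgA -(mulgA _ y) ayy !mulgA mulgK mulVg mul1g -mulgA -expg2.
- rewrite !zexpgVl -!zexpgN invgK R3.
  rewrite (zexpg_eqmod (n := (- (-1 + k%:Z))%R) (t := 1%R) ak); last lia.
  by rewrite (eqx _ (- (-3 + e1 * k%:Z))%R e1) //; ring.
- rewrite !zexpgVl -!zexpgN invgK R2.
  rewrite (zexpg_eqmod (n := (- (1 + k%:Z))%R) (t := 1%R) ak); last lia.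
  by rewrite (eqx _ (- (3 + e1 * k%:Z))%R e1) //; ring.
- have xx : x^-1 = x^-1 ^ x^-1 by rewrite conjgE mulKg.
  rewrite c2 {2 3}xx -!zexpg_conj -conjVg -!conjMg; congr (_ ^ _).
  rewrite !zexpgVl -!zexpgN invgK R5.
  rewrite [y ^^ _](zexpg_eqmod (n := (- (1 + k%:Z))%R) (t := 1%R) yk); last lia.
  by rewrite (eqx _ (- (3 + e2 * k%:Z))%R e2) //; ring.
- have xx : x^-1 = x^-1 ^ x^-1 by rewrite conjgE mulKg.
  rewrite c2 {2 3}xx -!zexpg_conj -conjVg -!conjMg; congr (_ ^ _).
  rewrite !zexpgVl -!zexpgN invgK R4.
  rewrite [y ^^ _](zexpg_eqmod (n := (- (-1 + k%:Z))%R) (t := 1%R) yk); last lia.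
  by rewrite (eqx _ (- (-3 + e2 * k%:Z))%R e2) //; ring.
Qed.

(* The mirror image of the second relation contradicts the third unless x^(2k) = 1. *)
Lemma gamma_mirror_facet f : a ^ f = a^-1 -> x ^ f = x^-1 -> x ^+ (2 ^ (b - 1))%N = 1.
Proof.
move=> fa fx; have := congr1 (fun g => g ^ f) R2.
rewrite !conjMg conjVg !zexpg_conj fa fx invgK !zexpgVl -!zexpgN R3.
rewrite (zexpg_eqmod (n := (- (-1 + k%:Z))%R) (t := 1%R) ak); last lia.
move/mulgI => h; rewrite pE -[LHS]/(x ^^ (2 * k)%N%:Z).
case: he1 h => -> h.
  have -> : ((2 * k)%N%:Z = (3 + 1 * k%:Z) - (3 - 1 * k%:Z))%R by lia.
  by rewrite zexpgD h -zexpgD -[RHS]/(x ^^ 0); congr zexpg; lia.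
have -> : ((2 * k)%N%:Z = (- (-3 + -1 * k%:Z)) - (3 + -1 * k%:Z))%R by lia.
by rewrite zexpgD -h -zexpgD -[RHS]/(x ^^ 0); congr zexpg; lia.
Qed.

End Gamma.

Section Morph.
Variables (G H : groupType) (f : G -> H).
Hypothesis fM : {morph f : u v / u * v}.

Lemma morph_one : f 1 = 1.
Proof. by apply: (mulgI (f 1)); rewrite -fM !mulg1. Qed.

Lemma morph_inv u : f u^-1 = (f u)^-1.
Proof. by apply: (mulgI (f u)); rewrite -fM !mulgV morph_one. Qed.

Lemma morph_exp u n : f (u ^+ n) = f u ^+ n.
Proof. by elim: n => [|n IH]; rewrite ?morph_one // !expgS fM IH. Qed.

Lemma morph_zexpg u n : f (zexpg u n) = zexpg (f u) n.
Proof. by case: n => n /=; rewrite ?morph_inv morph_exp. Qed.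

Let fE := (fM, morph_inv, morph_zexpg, morph_exp).

Lemma gamma3_rel_morph b e1 e2 a x y :
  gamma3_rel b e1 e2 a x y -> gamma3_rel b e1 e2 (f a) (f x) (f y).
Proof.
case=> -[[h1 h2 h3] [h4 h5 h6]] h7 h8 h9 h10; split.
- by split; split; rewrite -?fM -morph_exp ?h1 ?h2 ?h3 ?h4 ?h5 ?h6 morph_one.
- by have := congr1 f h7; rewrite !fE.
- by have := congr1 f h8; rewrite !fE.
- by have := congr1 f h9; rewrite !fE.
- by have := congr1 f h10; rewrite !fE.
Qed.

Lemma gamma3_rel_inj b e1 e2 a x y : injective f ->
  gamma3_rel b e1 e2 (f a) (f x) (f y) -> gamma3_rel b e1 e2 a x y.
Proof.
move=> fI [[[h1 h2 h3] [h4 h5 h6]] h7 h8 h9 h10]; split.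
- by split; split; apply: fI; rewrite morph_exp ?fM morph_one.
- by apply: fI; rewrite !fE.
- by apply: fI; rewrite !fE.
- by apply: fI; rewrite !fE.
- by apply: fI; rewrite !fE.
Qed.

End Morph.

Section NormalForm.
Variables (G : groupType) (a x y : G) (b : nat) (e1 e2 : int).
Hypotheses (b5 : 5 <= b) (he1 : e1 = 1%R \/ e1 = (-1)%R) (he2 : e2 = 1%R \/ e2 = (-1)%R).
Hypothesis rel : gamma3_rel b e1 e2 a x y.

Lemma gamma_nfM g h : gamma_nf a x y g -> gamma_nf a x y h -> gamma_nf a x y (g * h).
Proof.
case=> i [l [j ->]] nh; rewrite -!mulgA.
have pow (u : G) n h' : (forall g, gamma_nf a x y g -> gamma_nf a x y (u * g)) ->
    gamma_nf a x y h' -> gamma_nf a x y (u ^+ n * h').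
  by move=> hu nh'; elim: n => [|n IH]; rewrite ?mul1g // expgS -mulgA; apply: hu.
apply: (pow); first exact: gamma_nf_a.
apply: (pow); first exact: (gamma_nf_y b5 he1 he2 rel).
by apply: (pow) nh; exact: (gamma_nf_x b5 he1 he2 rel).
Qed.

Lemma gamma_nfV g : gamma_nf a x y g -> gamma_nf a x y g^-1.
Proof.
have [[[ap xq yp] _] _ _ _ _] := rel.
have p0 c : 0 < (2 ^ c)%N by rewrite expn_gt0.
case=> i [l [j ->]]; rewrite !invMg.
have [i' ei] := zexpg_nat (- i%:Z)%R (p0 _) ap.
have [l' el] := zexpg_nat (- l%:Z)%R (p0 _) yp.
have [j' ej] := zexpg_nat (- j%:Z)%R (p0 _) xq.
have -> : (a ^+ i)^-1 = a ^+ i' by rewrite -ei zexpgN.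
have -> : (y ^+ l)^-1 = y ^+ l' by rewrite -el zexpgN.
have -> : (x ^+ j)^-1 = x ^+ j' by rewrite -ej zexpgN.
rewrite mulgA; apply: gamma_nfM; last by exists i', 0, 0; rewrite !mulg1.
by apply: gamma_nfM; [exists 0, 0, j'|exists 0, l', 0]; rewrite !(mulg1, mul1g).
Qed.

End NormalForm.

(** The model lies in a full symmetric group; only inside the subgroup generated by [a], [x], [y]
    does every element have the normal form. *)
Lemma gamma_group (b : nat) (e1 e2 : int) : 5 <= b ->
  (e1 = 1%R \/ e1 = (-1)%R) -> (e2 = 1%R \/ e2 = (-1)%R) ->
  exists (gT : finGroupType) (a x y : gT),
    [/\ gamma3_rel b e1 e2 a x y, forall g, gamma_nf a x y g &
      forall i l j : nat, a ^+ i * y ^+ l * x ^+ j = 1 ->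
        [/\ (2 ^ (b - 1) %| i)%N, (2 ^ (b - 1) %| l)%N & (2 ^ b %| j)%N]].
Proof.
move=> b5 he1 he2; have [gT [a [x [y [rel uq]]]]] := gamma_model b5 he1 he2.
pose G := <<[set a; x; y]>>%G.
have [Ga Gx Gy] : [/\ a \in G, x \in G & y \in G].
  by split; apply: mem_gen; rewrite !inE eqxx ?orbT.
have sM : {morph (@sgval _ G) : u v / u * v} by [].
have sI : injective (@sgval _ G) := val_inj.
have rel' : gamma3_rel b e1 e2 (subg G a) (subg G x) (subg G y).
  by apply: (gamma3_rel_inj sM sI); rewrite !subgK.
exists (subg_of G), (subg G a), (subg G x), (subg G y); split=> //.
- move=> g; have := subgP g; rewrite -{2}(sgvalK g); move: (sgval g) => {}g.
  case/gen_prodgP => n [c hc ->]; elim: n c hc => [|n IH] c hc.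
    by rewrite big_ord0 morph1; apply: gamma_nf1.
  have cG i : c i \in G by apply: mem_gen.
  rewrite big_ord_recl morphM ?group_prod //.
  have := IH (fun i => c (lift ord0 i)) (fun i => hc _) => nfc.
  by have := hc ord0; rewrite !inE => /orP[/orP[]|] /eqP->;
    [apply: gamma_nf_a|apply: (gamma_nf_x b5 he1 he2 rel')|apply: (gamma_nf_y b5 he1 he2 rel')].
- move=> i l j /(congr1 (@sgval _ G)).
  by rewrite !sM !(morph_exp sM) !subgK // => /uq.
Qed.

Section Universal.
Variables (b : nat) (e1 e2 : int) (gT : finGroupType) (a x y : gT).
Hypotheses (b5 : 5 <= b) (he1 : e1 = 1%R \/ e1 = (-1)%R) (he2 : e2 = 1%R \/ e2 = (-1)%R).
Hypothesis rel : gamma3_rel b e1 e2 a x y.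
Hypothesis nfP : forall g, gamma_nf a x y g.
Hypothesis uq : forall i l j : nat, a ^+ i * y ^+ l * x ^+ j = 1 ->
  [/\ (2 ^ (b - 1) %| i)%N, (2 ^ (b - 1) %| l)%N & (2 ^ b %| j)%N].

Let pair_morph1 (H : groupType) : {morph (fun u : gT * H => u.1) : u v / u * v}.
Proof. by []. Qed.
Let pair_morph2 (H : groupType) : {morph (fun u : gT * H => u.2) : u v / u * v}.
Proof. by []. Qed.

(* The normal form elements of the subgroup of gT * H generated by the pairs of
   generators are the graph of the homomorphism. *)
Lemma gamma_universal (H : groupType) (t1 t2 t3 : H) : gamma3_rel b e1 e2 t1 t2 t3 ->
  exists f : gT -> H, [/\ {morph f : u v / u * v}, f a = t1, f x = t2 & f y = t3].
Proof.
move=> relH; pose A : (gT * H)%type := (a, t1); pose X : (gT * H)%type := (x, t2).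
pose Y : (gT * H)%type := (y, t3).
have relP : gamma3_rel b e1 e2 A X Y.
  have z n (u : gT * H) : zexpg u n = (zexpg u.1 n, zexpg u.2 n).
    rewrite -(morph_zexpg (@pair_morph1 H)) -(morph_zexpg (@pair_morph2 H)).
    by case: (zexpg u n).
  have ex n (u : gT * H) : u ^+ n = (u.1 ^+ n, u.2 ^+ n).
    by have := z n u.
  case: rel relH => -[[h1 h2 h3] [h4 h5 h6]] h7 h8 h9 h10.
  case=> -[[k1 k2 k3] [k4 k5 k6]] k7 k8 k9 k10; split.
  - split; split; rewrite ex /=; congr (_, _); assumption.
  - rewrite !z; congr (_, _); assumption.
  - rewrite !z; congr (_, _); assumption.
  - rewrite !z; congr (_, _); assumption.
  - rewrite !z; congr (_, _); assumption.
have tot (g : gT) : exists h : H, gamma_nf A X Y (g, h).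
  have [i [l [j ->]]] := nfP g; exists (t1 ^+ i * t3 ^+ l * t2 ^+ j); exists i, l, j.
  have m1 := morph_exp (@pair_morph1 H); have m2 := morph_exp (@pair_morph2 H).
  have ex n (u : gT * H) : u ^+ n = (u.1 ^+ n, u.2 ^+ n).
    by rewrite -m1 -m2; case: (u ^+ n).
  by rewrite !ex.
(* The graph is single-valued: over [1] the exponents are multiples of the exponents that the
   relations impose on the generators, so the second component is trivial too. *)
have ker h : gamma_nf A X Y (1, h) -> h = 1.
  case=> i [l [j e]].
  have e1' := congr1 (fun u : gT * H => u.1) e; have e2' := congr1 (fun u : gT * H => u.2) e.
  rewrite /= ?(morph_exp (@pair_morph1 H)) /= in e1'.
  have m1 := morph_exp (@pair_morph1 H); have m2 := morph_exp (@pair_morph2 H).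
  have : a ^+ i * y ^+ l * x ^+ j = 1.
    by rewrite -[a]/(A.1) -[y]/(Y.1) -[x]/(X.1) -!m1 -!pair_morph1 -e.
  have : h = t1 ^+ i * t3 ^+ l * t2 ^+ j.
    by rewrite -[t1]/(A.2) -[t3]/(Y.2) -[t2]/(X.2) -!m2 -!pair_morph2 -e.
  move=> -> /uq[/dvdnP[i' ->] /dvdnP[l' ->] /dvdnP[j' ->]].
  have [[[k1 k2 k3] _] _ _ _ _] := relH.
  by rewrite !(mulnC _ (2 ^ _)%N) !(expgnA _ (2 ^ _)%N) k1 k2 k3 !expg1n !mulg1.
have fun_nf g h h' : gamma_nf A X Y (g, h) -> gamma_nf A X Y (g, h') -> h = h'.
  move=> n1 n2; have := gamma_nfM b5 he1 he2 relP n1 (gamma_nfV b5 he1 he2 relP n2).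
  have -> : (g, h) * (g, h')^-1 = (g * g^-1, h * h'^-1) by [].
  by rewrite mulgV => /ker /divg1_eq.
have [f fP] := fin_all_exists tot; exists f; split.
- by move=> g g'; apply: fun_nf (fP _) _; exact: (gamma_nfM b5 he1 he2 relP (fP g) (fP g')).
- by apply: fun_nf (fP _) _; exists 1%N, 0, 0; rewrite !mulg1.
- by apply: fun_nf (fP _) _; exists 0, 0, 1%N; rewrite !mul1g.
- by apply: fun_nf (fP _) _; exists 0, 1%N, 0; rewrite mulg1 mul1g.
Qed.

End Universal.

Lemma gen2_prod (gT : finGroupType) (u v : gT) :
  (forall i : nat, exists i' j' : nat, v * u ^+ i = u ^+ i' * v ^+ j') ->
  forall g, g \in <<[set u; v]>> -> exists i j : nat, g = u ^+ i * v ^+ j.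
Proof.
move=> swap g /gen_prodgP[n [c hc ->]]; elim: n c hc => [|n IH] c hc.
  by exists 0, 0; rewrite big_ord0 mulg1.
rewrite big_ord_recl; have [i [j ->]] := IH (fun i => c (lift ord0 i)) (fun i => hc _).
have := hc ord0; rewrite !inE => /orP[] /eqP->; first by exists i.+1, j; rewrite expgS mulgA.
by have [i' [j' h]] := swap i; exists i', (j' + j)%N; rewrite mulgA h -mulgA expgnDr.
Qed.

Lemma expg_involution (gT : groupType) (u : gT) (n : nat) :
  u ^+ 2 = 1 -> u ^+ n = 1 \/ u ^+ n = u.
Proof.
move=> u2; rewrite -(odd_double_half n) expgnDr -mul2n expgnA u2 expg1n mulg1.
by case: (odd n); [right|left].
Qed.

(** * Face stabilizers and the intersection property *)

Section Subgroups.
Variables (b : nat) (e1 e2 : int) (gT : finGroupType) (a x y : gT).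
Hypotheses (b5 : 5 <= b) (he1 : e1 = 1%R \/ e1 = (-1)%R) (he2 : e2 = 1%R \/ e2 = (-1)%R).
Hypothesis rel : gamma3_rel b e1 e2 a x y.
Hypothesis nfP : forall g, gamma_nf a x y g.
Hypothesis uq : forall i l j : nat, a ^+ i * y ^+ l * x ^+ j = 1 ->
  [/\ (2 ^ (b - 1) %| i)%N, (2 ^ (b - 1) %| l)%N & (2 ^ b %| j)%N].

(* The stabilizers of the faces of the base flag, indexed by rank plus one. *)
Definition stab (i : nat) : {group gT} :=
  match i with
  | 1 => <<[set y; x]>>%G
  | 2 => <<[set y; (a * x)%g]>>%G
  | 3 => <<[set (x * y)%g; a]>>%G
  | 4 => <<[set a; x]>>%G
  | _ => [set: gT]%G
  end.

(* [rotW i j] maps the base flag to its image under the moves j then i. *)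
Definition rotW (i j : nat) : gT :=
  match i, j with
  | 0, 1 => a
  | 0, 2 => a * x
  | 0, 3 => a * x * y
  | 1, 2 => x
  | 1, 3 => x * y
  | _, _ => y
  end.

Let ap : a ^+ (2 ^ (b - 1))%N = 1. Proof. by case: rel => -[[]]. Qed.
Let yp : y ^+ (2 ^ (b - 1))%N = 1. Proof. by case: rel => -[[]]. Qed.
Let xq : x ^+ (2 ^ b)%N = 1. Proof. by case: rel => -[[]]. Qed.
Let B2 : (a * x) ^+ 2 = 1. Proof. by case: rel => -[_ []]. Qed.
Let D2 : (x * y) ^+ 2 = 1. Proof. by case: rel => -[_ []]. Qed.
Let C2 : (a * x * y) ^+ 2 = 1. Proof. by case: rel => -[_ []]. Qed.
Let c2 n : 0 < (2 ^ n)%N. Proof. by rewrite expn_gt0. Qed.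

Let pow0 (u : gT) (n i : nat) : u ^+ n = 1 -> (n %| i)%N -> u ^+ i = 1.
Proof. by move=> un /dvdnP[k ->]; rewrite mulnC expgnA un expg1n. Qed.

Let inv_pow (u : gT) n (i : nat) : u ^+ (2 ^ n)%N = 1 -> exists i' : nat, (u ^+ i)^-1 = u ^+ i'.
Proof. by move=> un; have [i' e] := zexpg_nat (- i%:Z)%R (c2 n) un; exists i'; rewrite -e zexpgN. Qed.

Let one_lt n : 0 < n -> ~~ (2 ^ n %| 1)%N.
Proof. by move=> n0; rewrite dvdn1 -[X in _ == X](expn0 2) eqn_exp2l // -lt0n. Qed.

Let a_neq1 : a <> 1.
Proof.
move=> h; have := @uq 1 0 0; rewrite expg1 h !mulg1 => /(_ erefl)[d _ _].
by move: d; apply/negP/one_lt; rewrite subn_gt0 (leq_trans _ b5).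
Qed.
Let y_neq1 : y <> 1.
Proof.
move=> h; have := @uq 0 1 0; rewrite expg1 h !mulg1 => /(_ erefl)[_ d _].
by move: d; apply/negP/one_lt; rewrite subn_gt0 (leq_trans _ b5).
Qed.
Let x_neq1 : x <> 1.
Proof.
move=> h; have := @uq 0 0 1; rewrite expg1 h !mulg1 => /(_ erefl)[_ _ d].
by move: d; apply/negP/one_lt; rewrite (leq_trans _ b5).
Qed.

Let by_inv : (a * x) * y = y^-1 * (a * x).
Proof.
have bV : (a * x)^-1 = a * x by apply: mulg1_eq; rewrite -expg2.
by rewrite -{2}bV -invMg; symmetry; apply: mulg1_eq; rewrite -expg2.
Qed.

Let da_inv : x * y * a = a^-1 * (x * y).
Proof. by rewrite -mulgA (gamma_y_conj_a rel) !mulgA mulgV mul1g. Qed.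

Let stab1P g : g \in stab 1 -> exists l j : nat, g = y ^+ l * x ^+ j.
Proof. by move=> hg; exact: (gen2_prod (gamma_swap_y b5 he1 he2 rel) hg). Qed.
Let stab4P g : g \in stab 4 -> exists i j : nat, g = a ^+ i * x ^+ j.
Proof. by move=> hg; exact: (gen2_prod (gamma_swap_a b5 he1 he2 rel) hg). Qed.
(** The involution [a * x] inverts [y], so this stabilizer is dihedral; in [stab 3] the involution
    [x * y] inverts [a] likewise. *)
Let stab2P g : g \in stab 2 -> exists l : nat, g = y ^+ l \/ g = y ^+ l * (a * x).
Proof.
move=> hg; have [|l [j ->]] := @gen2_prod _ y (a * x) _ _ hg.
  move=> i; have [i' e] := inv_pow i yp; exists i', 1%N.
  rewrite -e expg1; elim: i {i' e} => [|i IH]; first by rewrite invg1 mulg1 mul1g.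
  by rewrite expgSr mulgA IH -mulgA by_inv mulgA -invMg -expgS expgSr.
by exists l; case: (expg_involution j B2) => ->; [left; rewrite mulg1|right].
Qed.
Let stab3P g : g \in stab 3 -> exists i : nat, g = a ^+ i \/ g = x * y * a ^+ i.
Proof.
move=> hg; have [|i [j ->]] := @gen2_prod _ (x * y) a _ _ hg.
  move=> i; have [i' e] := inv_pow 1 ap.
  case: (expg_involution i D2) => ->; first by exists 0, 1%N; rewrite mulg1 mul1g.
  exists 1%N, i'; rewrite -e expg1 expg1; apply: (mulgI a^-1); rewrite mulKg mulgA -da_inv -mulgA.
  by rewrite mulgV mulg1.
by exists j; case: (expg_involution i D2) => ->; [left; rewrite mul1g|right].
Qed.

Let s1x : x \in stab 1. Proof. by apply: mem_gen; rewrite !inE eqxx orbT. Qed.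
Let s1y : y \in stab 1. Proof. by apply: mem_gen; rewrite !inE eqxx. Qed.
Let s2y : y \in stab 2. Proof. by apply: mem_gen; rewrite !inE eqxx. Qed.
Let s2b : a * x \in stab 2. Proof. by apply: mem_gen; rewrite !inE eqxx orbT. Qed.
Let s3d : x * y \in stab 3. Proof. by apply: mem_gen; rewrite !inE eqxx. Qed.
Let s3a : a \in stab 3. Proof. by apply: mem_gen; rewrite !inE eqxx orbT. Qed.
Let s4a : a \in stab 4. Proof. by apply: mem_gen; rewrite !inE eqxx. Qed.
Let s4x : x \in stab 4. Proof. by apply: mem_gen; rewrite !inE eqxx orbT. Qed.
Let s1d : x * y \in stab 1. Proof. by rewrite groupM. Qed.
Let s4b : a * x \in stab 4. Proof. by rewrite groupM. Qed.
Let s2c : a * x * y \in stab 2. Proof. by rewrite groupM. Qed.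
Let s3c : a * x * y \in stab 3. Proof. by rewrite -mulgA groupM. Qed.

(** Uniqueness of the normal form enters through this lemma and [y_stab4]; the intersections below
    follow from them. *)
Let a_stab1 (i : nat) : a ^+ i \in stab 1 -> a ^+ i = 1.
Proof.
move/stab1P => [l [j e]]; have [i' ei] := inv_pow i ap.
have [] := uq (i := i') (l := l) (j := j); first by rewrite -ei -mulgA -e mulVg.
by move=> d _ _; apply: invg_inj; rewrite ei invg1 (pow0 ap).
Qed.

Let y_stab4 (l : nat) : y ^+ l \in stab 4 -> y ^+ l = 1.
Proof.
move/stab4P => [i [j e]]; have [i' ei] := inv_pow i ap; have [j' ej] := inv_pow j xq.
have [] := uq (i := i') (l := l) (j := j'); last by move=> _ d _; apply: pow0 d.
by rewrite -ei -ej e mulKg mulgV.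
Qed.

Let x_notin_y l : x <> y ^+ l.
Proof.
move=> e; apply: x_neq1; rewrite e; apply: y_stab4; rewrite -e; exact: s4x.
Qed.
Let x_notin_a i : x <> a ^+ i.
Proof.
move=> e; apply: x_neq1; rewrite e; apply: a_stab1; rewrite -e; exact: s1x.
Qed.
Let x_y_a l i : y ^+ l = x * y * a ^+ i -> False.
Proof.
move=> e; have ai : a ^+ i = 1.
  by apply: a_stab1; rewrite -(groupMl _ s1d) -e groupX.
have [l' el] := inv_pow 1 yp; move: e; rewrite ai mulg1 => e.
by apply: (@x_notin_y (l + l')); rewrite expgnDr e -el expg1 mulgK.
Qed.

Let y_stab3 (l : nat) : y ^+ l \in stab 3 -> y ^+ l = 1.
Proof.
by move/stab3P => [i [e|/x_y_a//]]; apply: y_stab4; rewrite e groupX.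
Qed.

Let nb1 : a * x \notin stab 1.
Proof.
apply/negP; rewrite groupMr // => h; apply: a_neq1; rewrite -[a]expg1; exact: a_stab1.
Qed.
Let nd4 : x * y \notin stab 4.
Proof.
apply/negP; rewrite groupMl // => h; apply: y_neq1; rewrite -[y]expg1; exact: y_stab4.
Qed.

(** This lemma and the next five are the intersection property for pairs: two stabilizers meet in
    the powers of the rotation that [rotW] assigns to the two remaining ranks. *)
Let I12 g : g \in stab 1 -> g \in stab 2 -> exists l : nat, g = y ^+ l.
Proof.
move=> h1 /stab2P[l [e|e]]; exists l => //.
by move: h1; rewrite e (groupMl _ (groupX l s1y)) (negPf nb1).
Qed.
Let I13 g : g \in stab 1 -> g \in stab 3 -> g = 1 \/ g = x * y.
Proof.
move=> h1 /stab3P[i [e|e]]; [left|right]; move: h1; rewrite e.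
  exact: a_stab1.
by rewrite groupMl // => /a_stab1->; rewrite mulg1.
Qed.
Let I14 g : g \in stab 1 -> g \in stab 4 -> exists j : nat, g = x ^+ j.
Proof.
move=> /stab1P[l [j ->]]; rewrite (groupMr _ (groupX j s4x)) => /y_stab4->.
by exists j; rewrite mul1g.
Qed.
Let I23 g : g \in stab 2 -> g \in stab 3 -> g = 1 \/ g = a * x * y.
Proof.
move=> /stab2P[l [->|->]]; first by move/y_stab3; left.
have -> : y ^+ l * (a * x) = y ^+ l.+1 * (a * x * y) by rewrite by_inv [RHS]mulgA expgSr mulgK.
by rewrite groupMr // => /y_stab3->; right; rewrite mul1g.
Qed.
Let I24 g : g \in stab 2 -> g \in stab 4 -> g = 1 \/ g = a * x.
Proof.
move=> /stab2P[l [->|->]]; first by move/y_stab4; left.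
by rewrite groupMr // => /y_stab4->; right; rewrite mul1g.
Qed.
Let I34 g : g \in stab 3 -> g \in stab 4 -> exists i : nat, g = a ^+ i.
Proof.
move=> /stab3P[i [->|->]]; first by exists i.
by rewrite (groupMr _ (groupX i s4a)) (negPf nd4).
Qed.

Let I234 g : g \in stab 2 -> g \in stab 3 -> g \in stab 4 -> g = 1.
Proof.
move=> h2 h3 h4; case: (I23 h2 h3) => // e.
move: h4; rewrite e groupMl // => h; case: y_neq1.
by rewrite -[y]expg1; apply: y_stab4.
Qed.

(** With three distinct proper ranks the middle stabilizer is one of the dihedral ones, and it
    splits by $y^l\,ax=y^{l+1}\,axy$ or $xy\,a^i=axy\,a^{i+1}$, or directly. *)
Lemma stab_T i j k : i <= j -> j <= k -> k <= 5 ->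
  stab j \subset (stab i :&: stab j) * (stab j :&: stab k).
Proof.
move=> ij jk k5; apply/subsetP => g hg.
have triv1 : stab i = [set: gT]%G \/ i = j -> g \in (stab i :&: stab j) * (stab j :&: stab k).
  move=> h; apply/mulsgP; exists g 1; rewrite ?mulg1 // inE ?group1 //.
  by case: h => [->|->]; rewrite hg ?inE.
have triv2 : stab k = [set: gT]%G \/ j = k -> g \in (stab i :&: stab j) * (stab j :&: stab k).
  move=> h; apply/mulsgP; exists 1 g; rewrite ?mul1g // inE ?group1 //.
  by case: h => [->|<-]; rewrite hg ?inE.
have cut u v : g = u * v -> u \in stab i -> u \in stab j -> v \in stab j -> v \in stab k ->
    g \in (stab i :&: stab j) * (stab j :&: stab k).
  by move=> e ui uj vj vk; apply/mulsgP; exists u v; rewrite ?inE ?ui ?uj ?vj ?vk.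
have [e|nij] := eqVneq i j; first by apply: triv1; right.
have [e|njk] := eqVneq j k; first by apply: triv2; right.
have {}ij : i < j by rewrite ltn_neqAle nij.
have {}jk : j < k by rewrite ltn_neqAle njk.
move: i j k ij jk k5 {nij njk} hg triv1 triv2 cut.
move=> [|i] j k ij jk k5 hg triv1 triv2 cut; first by apply: triv1; left.
have [k5'|k5'] := eqVneq k 5; first by apply: triv2; left; rewrite k5'.
have {k5 k5'} k4 : k < 5 by rewrite ltn_neqAle k5'.
case: i j k ij jk k4 hg cut {triv1 triv2} => [|[|i]] [|[|[|[|j]]]] [|[|[|[|[|k]]]]] // _ _ _ hg cut.
- have [l [e|e]] := stab2P hg; first by apply: (cut g 1); rewrite ?mulg1 ?group1 // e groupX.
  apply: (cut (y ^+ l.+1) (a * x * y)); rewrite ?groupX //.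
  by rewrite e by_inv [RHS]mulgA expgSr mulgK.
- have [l [e|e]] := stab2P hg; first by apply: (cut g 1); rewrite ?mulg1 ?group1 // e groupX.
  by apply: (cut (y ^+ l) (a * x)); rewrite ?groupX.
- have [i [e|e]] := stab3P hg; first by apply: (cut 1 g); rewrite ?mul1g ?group1 // e groupX.
  by apply: (cut (x * y) (a ^+ i)); rewrite ?groupX.
- have [i [e|e]] := stab3P hg; first by apply: (cut 1 g); rewrite ?mul1g ?group1 // e groupX.
  apply: (cut (a * x * y) (a ^+ i.+1)); rewrite ?groupX //.
  have -> : a * x * y * a ^+ i.+1 = a * (x * y * a) * a ^+ i by rewrite expgS !mulgA.
  by rewrite e da_inv !mulgA mulgV mul1g.
Qed.

(** The half-turns [a * x] and [x * y] fix the base faces of stored ranks 2, 4 and 1, 3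
    respectively, so they serve alternately as [d]. *)
Lemma stab_D i : i < 4 -> exists d, [/\ d \in stab i, d \in stab i.+2, d \notin stab i.+1 &
  forall g, g \in stab i -> g \in stab i.+2 -> (g \in stab i.+1) || (g * d^-1 \in stab i.+1)].
Proof.
case: i => [|[|[|[|]]]] // _.
- exists (a * x); split; rewrite ?inE // => g _ /stab2P[l [->|->]]; first by rewrite groupX.
  by rewrite mulgK (groupX _ s1y) orbT.
- exists (x * y); split=> //.
    apply/negP => /(I12 s1d)[l e]; apply: (@x_y_a l 0); by rewrite -e mulg1.
  by move=> g h1 h3; case: (I13 h1 h3) => ->; rewrite ?group1 // mulgV group1 orbT.
- exists (a * x); split=> //.
    apply/negP => h; have [i e] := I34 h s4b.
    have [i' ei] := inv_pow 1 ap; apply: (@x_notin_a (i' + i)).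
    by rewrite expgnDr -ei -e expg1 mulKg.
  by move=> g h1 h3; case: (I24 h1 h3) => ->; rewrite ?group1 // mulgV group1 orbT.
- exists (x * y); split; rewrite ?inE // => g /stab3P[i [->|->]] _; first by rewrite groupX.
  suff -> : x * y * a ^+ i * (x * y)^-1 = (a ^+ i)^-1 by rewrite groupV (groupX _ s4a) orbT.
  apply: (mulIg (x * y)); rewrite mulgVK; elim: i => [|i IH]; first by rewrite invg1 mulg1 mul1g.
  by rewrite expgSr mulgA IH -mulgA da_inv mulgA -invMg -expgS expgSr.
Qed.

Lemma stab_W i j : i < j -> j < 4 ->
  [/\ forall l, l < 4 -> l != i -> l != j -> rotW i j \in stab l.+1,
      rotW i j \notin stab i.+1, rotW i j \notin stab j.+1 &
      rotW i j \in stab j.+1 * stab i.+1].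
Proof.
have na1 : a \notin stab 1 by apply/negP => h; apply: a_neq1; rewrite -[a]expg1; apply: a_stab1.
have na2 : a \notin stab 2 by apply/negP => h; apply: a_neq1; apply: I234.
have nb3 : a * x \notin stab 3.
  by apply/negP; rewrite groupMl // => h; case: (I34 h s4x) => n /x_notin_a.
have nc1 : a * x * y \notin stab 1 by rewrite groupMr.
have ny4 : y \notin stab 4 by apply/negP => h; apply: y_neq1; rewrite -[y]expg1; apply: y_stab4.
have nc4 : a * x * y \notin stab 4 by rewrite groupMl.
have nx2 : x \notin stab 2 by apply/negP => h; case: (I12 s1x h) => l /x_notin_y.
have nx3 : x \notin stab 3 by apply/negP => h; case: (I34 h s4x) => n /x_notin_a.
have nd2 : x * y \notin stab 2 by rewrite groupMr.
have ny3 : y \notin stab 3 by apply/negP => h; apply: y_neq1; rewrite -[y]expg1; apply: y_stab3.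
case: i j => [|[|[|i]]] [|[|[|[|j]]]] // _ _; split=> //;
  try by case=> [|[|[|[|]]]].
- by apply/mulsgP; exists (a * x) x^-1; rewrite ?groupV ?mulgK.
- by apply/mulsgP; exists a x.
- by apply/mulsgP; exists a (x * y); rewrite ?mulgA.
- by apply/mulsgP; exists (x * y) y^-1; rewrite ?groupV ?mulgK.
- by apply/mulsgP; exists x y.
- by apply/mulsgP; exists x^-1 (x * y); rewrite ?groupV ?mulKg.
Qed.

(** Sixteen cases by the free ranks. One free rank leaves the trivial group, two leave the powers of
    one rotation, three a single stabilizer, and four the whole group in normal form. *)
Lemma stab_C (I : pred nat) (K : {group gT}) :
  (forall i j, i < j -> j < 4 -> ~~ I i -> ~~ I j -> rotW i j \in K) ->
  (exists2 i, i < 4 & ~~ I i) ->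
  forall g, (forall i, i < 4 -> I i -> g \in stab i.+1) -> g \in K.
Proof.
move=> hK [i0 i04 ni0] g hg.
have [h1 h2 h3 h4] := And4 (hg 0 isT) (hg 1%N isT) (hg 2 isT) (hg 3 isT).
have k01 := hK 0 1%N isT isT; have k02 := hK 0 2 isT isT; have k03 := hK 0 3 isT isT.
have k12 := hK 1%N 2 isT isT; have k13 := hK 1%N 3 isT isT; have k23 := hK 2 3 isT isT.
have hI : ~~ [&& I 0, I 1%N, I 2 & I 3].
  by apply: contra ni0; case/and4P; case: i0 i04 => [|[|[|[|]]]].
rewrite /= in k01 k02 k03 k12 k13 k23.
case: (boolP (I 0)) => n0; case: (boolP (I 1%N)) => n1;
case: (boolP (I 2)) => n2; case: (boolP (I 3)) => n3.
- by rewrite n0 n1 n2 n3 in hI.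
- have [l e] := I12 (h1 n0) (h2 n1); have := h3 n2; rewrite e => /y_stab3->; exact: group1.
- have [l e] := I12 (h1 n0) (h2 n1); have := h4 n3; rewrite e => /y_stab4->; exact: group1.
- by have [l ->] := I12 (h1 n0) (h2 n1); rewrite groupX // k23.
- have [i e] := I34 (h3 n2) (h4 n3); have := h1 n0; rewrite e => /a_stab1->; exact: group1.
- by case: (I13 (h1 n0) (h3 n2)) => ->; rewrite ?group1 // k13.
- by have [j ->] := I14 (h1 n0) (h4 n3); rewrite groupX // k12.
- by have [l [j ->]] := stab1P (h1 n0); rewrite groupM ?groupX ?k12 ?k23.
- by rewrite (I234 (h2 n1) (h3 n2) (h4 n3)) group1.
- by case: (I23 (h2 n1) (h3 n2)) => ->; rewrite ?group1 // k03.
- by case: (I24 (h2 n1) (h4 n3)) => ->; rewrite ?group1 // k02.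
- have [l [->|->]] := stab2P (h2 n1); first by rewrite groupX ?k23.
  by apply: groupM; [apply: groupX; exact: k23|exact: k02].
- by have [i ->] := I34 (h3 n2) (h4 n3); rewrite groupX // k01.
- have [i [->|->]] := stab3P (h3 n2); first by rewrite groupX ?k01.
  by apply: groupM; [exact: k13|apply: groupX; exact: k01].
- by have [i [j ->]] := stab4P (h4 n3); rewrite groupM ?groupX ?k12 ?k01.
- by have [i [l [j ->]]] := nfP g; rewrite !groupM ?groupX ?k01 ?k12 ?k23.
Qed.

Lemma order_a : #[a] = (2 ^ (b - 1))%N.
Proof.
apply/eqP; rewrite eqn_dvd order_dvdn ap eqxx /=.
by have [|-> //] := uq (i := #[a]) (l := 0) (j := 0); rewrite expg_order !mulg1.
Qed.

Lemma order_y : #[y] = (2 ^ (b - 1))%N.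
Proof.
apply/eqP; rewrite eqn_dvd order_dvdn yp eqxx /=.
by have [|_ -> //] := uq (i := 0) (l := #[y]) (j := 0); rewrite expg_order !mulg1.
Qed.

Lemma order_x : #[x] = (2 ^ b)%N.
Proof.
apply/eqP; rewrite eqn_dvd order_dvdn xq eqxx /=.
by have [|_ _ -> //] := uq (i := 0) (l := 0) (j := #[x]); rewrite expg_order !mulg1.
Qed.

Lemma card_gamma : #|[set: gT]| = (#[a] * #[x] * #[y])%N.
Proof.
have -> : [set: gT] = <[a]> * stab 1.
  apply/eqP; rewrite eqEsubset subsetT andbT; apply/subsetP => g _.
  have [i [l [j ->]]] := nfP g; rewrite -mulgA mem_mulg ?mem_cycle //.
  by rewrite groupM ?groupX.
rewrite TI_cardMg; last first.
  apply/trivgP/subsetP => _ /setIP[/cycleP[i ->] h]; by rewrite inE a_stab1.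
have -> : stab 1 = <[y]> * <[x]> :> {set gT}.
  apply/eqP; rewrite eqEsubset mul_subG ?cycle_subG // andbT; apply/subsetP => g.
  by case/stab1P => l [j ->]; rewrite mem_mulg ?mem_cycle.
rewrite TI_cardMg ?mulnA; first by rewrite -[LHS]mulnA (mulnC #|<[y]>|) mulnA.
apply/trivgP/subsetP => _ /setIP[/cycleP[l ->] /cycleP[j e]].
by rewrite inE y_stab4 // e groupX.
Qed.

Lemma stab_all g : (forall i, i < 4 -> g \in stab i.+1) -> g = 1.
Proof. by move=> h; apply: I234; [apply: (h 1%N)|apply: (h 2)|apply: (h 3)]. Qed.

End Subgroups.

End Relations.

(** * The polytope *)

Lemma order_pow2 (gT : finGroupType) (u : gT) n :
  (u ^+ (2 ^ n.+1) = 1)%g -> (u ^+ (2 ^ n) <> 1)%g -> #[u]%g = 2 ^ n.+1.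
Proof.
move=> u1 u0; have /dvdn_pfactor[//|c cn ec] : #[u]%g %| 2 ^ n.+1 by rewrite order_dvdn u1.
rewrite ec; congr (2 ^ _); apply/eqP; rewrite eqn_leq cn ltnNge.
by apply/negP => cn'; apply: u0; apply/eqP; rewrite -order_dvdn ec dvdn_exp2l.
Qed.

Section GammaPolytope.
Variables (b : nat) (e1 e2 : int) (gT : finGroupType) (a x y : gT).
Hypotheses (b5 : 5 <= b) (he1 : e1 = 1%R \/ e1 = (-1)%R) (he2 : e2 = 1%R \/ e2 = (-1)%R).
Hypothesis relG : gamma3_rel b e1 e2 a x y.
Hypothesis nfP : forall g, gamma_nf a x y g.
Hypothesis uq : forall i l j : nat, (a ^+ i * y ^+ l * x ^+ j = 1)%g ->
  [/\ 2 ^ (b - 1) %| i, 2 ^ (b - 1) %| l & 2 ^ b %| j].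

Let H := stab a x y.
Let F := cface H.
Let le : rel F := @cle gT H.
Let rk : F -> nat := @crk gT H.
Let Phi : {set F} := flagOf H 1.
Let rot (g : gT) : {perm F} := cact H g.
Local Notation adjF := (adj le rk).

Let HT := stab_T relG.
Let HD := stab_D b5 he1 he2 relG uq.
Let HW := stab_W b5 he1 he2 relG uq.
Let HC := stab_C b5 he1 he2 relG nfP uq.

Lemma gamma_poly : polytope4 le rk.
Proof. exact: (cpolytope (erefl : H 0 = _) (erefl : H 5 = _) HT HD HW HC). Qed.
Let preP := polytope4_pre gamma_poly.

Lemma gamma_flag : is_flag le Phi.
Proof. exact: (flagOf_flag (erefl : H 0 = _) (erefl : H 5 = _) HT HD). Qed.

(** The action is faithful because the stabilizers of the base faces meet trivially. *)
Lemma rot_inj : injective rot.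
Proof.
suff ker g : rot g = 1%g -> g = 1%g.
  move=> g h e; apply/eqP; rewrite eq_mulgV1; apply/eqP/ker.
  by rewrite /rot cactM (morph_inv (@cactM gT H)) -/(rot g) e mulgV.
move=> e; apply: (stab_all b5 he1 he2 relG uq) => i i4.
have i6 : i.+1 < 6 by apply: ltn_trans (i4 : i.+1 < 5) _.
have := congr1 (fun s : {perm F} => s (face H (Ordinal i6) 1)) e.
by rewrite /rot cact_face perm1 mul1g => /faceE; rewrite invg1 mulg1.
Qed.

Lemma rot_W i j : i < j -> j < 4 -> rot (rotW a x y i j) @: Phi = adjF i (adjF j Phi).
Proof.
move=> ij j4; rewrite /rot cact_flagOf mul1g.
have [P jP iP] := W_jadj (erefl : H 0 = _) (erefl : H 5 = _) HT HD HW ij j4.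
by rewrite (adjE preP j4 jP) (adjE preP (ltn_trans ij j4) iP).
Qed.

(** The rotation realizing move [j] followed by move 1. At [j = 0] the order of moves is opposite to
    that of [rotW 0 1], hence the inverse. *)
Definition rotV j : gT := match j with 0 => a^-1 | 1 => 1 | 2 => x | _ => x * y end%g.

Lemma rot_V j : j < 4 -> rot (rotV j) @: Phi = adjF 1 (adjF j Phi).
Proof.
have fP := gamma_flag.
case: j => [|[|[|[|]]]] // _; last first.
- exact: (@rot_W 1 3).
- exact: (@rot_W 1 2).
- by rewrite adjK // /rot cact_flagOf mulg1.
have ra : rot a \in paut le by exact: cact_paut.
have f1 := adj_flag preP fP (isT : 1 < 4); have f0 := adj_flag preP fP (isT : 0 < 4).
rewrite /rot (morph_inv (@cactM gT H)) -/(rot a).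
have e := @rot_W 0 1 isT isT; rewrite /= in e.
have e' : rot a @: adjF 1 (adjF 0 Phi) = Phi.
  by rewrite -!(paut_adj preP) // e !adjK.
by rewrite -{1}e' imset_permK.
Qed.

Let rotM : {morph rot : g h / (g * h)%g} := @cactM gT H.

Lemma rot_paut g : rot g \in paut le.
Proof. exact: cact_paut. Qed.

Lemma rot_group_set : group_set (rot @: [set: gT]).
Proof.
apply/group_setP; split; first by apply/imsetP; exists 1%g; rewrite ?(morph_one rotM).
move=> _ _ /imsetP[g _ ->] /imsetP[h _ ->]; apply/imsetP; exists (g * h)%g => //.
Qed.
Let rotG := Group rot_group_set.

Let sG : rotG \subset paut le.
Proof. by apply/subsetP => _ /imsetP[g _ ->]; exact: rot_paut. Qed.

Let mem_rot g : rot g \in rotG. Proof. exact: imset_f. Qed.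

Let vP j : j < 4 -> rot (rotV j) \in rotG /\ rot (rotV j) @: Phi = adjF 1 (adjF j Phi).
Proof. by move=> j4; split; [exact: mem_rot|exact: rot_V]. Qed.

Let two_orbits A : is_flag le A ->
  exists2 g, g \in rotG & A = g @: Phi \/ A = g @: adjF 1 Phi.
Proof.
move=> fA; have fP := gamma_flag.
have [g eg] := flag_white (erefl : H 0 = _) (erefl : H 5 = _) HT HD fA (isT : 1 < 4).
exists (rot g); first exact: mem_rot.
have e : flagOf H g = rot g @: Phi by rewrite /rot cact_flagOf mul1g.
case: eg => [->|<-]; [by left|right].
by rewrite -/le -/rk e (paut_adj preP) // rot_paut.
Qed.

Let relP : gamma3_rel b e1 e2 (rot a) (rot x) (rot y).
Proof. exact: gamma3_rel_morph rotM _ _ _ _ _ _ relG. Qed.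

(** The cases [j = 0] and [j = 2] of [mirror_conj] invert [a] and [x], so [gamma_mirror_facet] gives
    $x^{2k}=1$, against the uniqueness of the normal form. *)
Lemma gamma_no_mirror f : f \in paut le -> f @: Phi <> adjF 1 Phi.
Proof.
move=> hf ef.
have conj j (j4 : j < 4) := mirror_conj gamma_poly gamma_flag sG vP hf ef j4.
have ca : (rot a ^ f = (rot a)^-1)%g.
  have := conj 0 isT; rewrite /= (morph_inv rotM) conjVg => h.
  by apply: invg_inj; rewrite h.
have cx : (rot x ^ f = (rot x)^-1)%g := conj 2 isT.
have := gamma_mirror_facet b5 he1 he2 relP ca cx.
rewrite -(morph_exp rotM) -(morph_one rotM) => /rot_inj h.
have := @uq 0 0 (2 ^ (b - 1)); rewrite h !mulg1 => /(_ erefl)[_ _].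
by rewrite dvdn_Pexp2l // leqNgt subn1 prednK ?leqnn // (leq_trans _ b5).
Qed.

Lemma gamma_chiral : chiral le.
Proof. exact: criterion_chiral gamma_poly gamma_flag sG vP two_orbits gamma_no_mirror. Qed.

Lemma gamma_paut : paut le = rot @: [set: gT].
Proof. exact: criterion_paut gamma_poly gamma_flag sG two_orbits gamma_no_mirror. Qed.

Lemma order_rot g : #[rot g]%g = #[g]%g.
Proof.
apply/eqP; rewrite eqn_dvd !order_dvdn -!(morph_exp rotM) expg_order (morph_one rotM) eqxx /=.
apply/eqP; apply: rot_inj; by rewrite (morph_exp rotM) expg_order (morph_one rotM).
Qed.

Lemma gamma_type : type4 le rk (2 ^ (b - 1)) (2 ^ b) (2 ^ (b - 1)).
Proof.
have key i u v : i < 3 -> le u v -> rk u = i -> rk v = i.+3 ->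
    sect_count le rk i.+1 u v = #[rotW a x y i i.+1]%g.
  move=> i3 luv ru rv; rewrite -order_rot.
  apply: (sect_count_chiral gamma_poly gamma_chiral gamma_flag i3) => //; first exact: rot_paut.
  exact: rot_W.
split=> u v luv ru rv.
- by rewrite (key 0) //= (order_a relG uq).
- by rewrite (key 1) //= (order_x relG uq).
- by rewrite (key 2) //= (order_y relG uq).
Qed.

Lemma card_paut : #|paut le| = 2 ^ (b - 1) * 2 ^ b * 2 ^ (b - 1).
Proof.
rewrite gamma_paut card_imset; last exact: rot_inj.
by rewrite (card_gamma b5 he1 he2 relG nfP uq) (order_a relG uq) (order_x relG uq) (order_y relG uq).
Qed.

Lemma gamma_tight : tight le rk.
Proof.
exists (2 ^ (b - 1)), (2 ^ b), (2 ^ (b - 1)); split; first exact: gamma_type.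
by rewrite (nflags_chiral gamma_poly gamma_chiral gamma_flag) card_paut !mulnA.
Qed.

Definition unrot (s : {perm F}) : gT := odflt 1%g [pick g | rot g == s].

Lemma rotK : cancel rot unrot.
Proof.
move=> g; rewrite /unrot; case: pickP => [h /eqP /rot_inj //|/(_ g)].
by rewrite eqxx.
Qed.

Lemma gamma_std : std_gens le rk Phi (rot a) (rot x) (rot y).
Proof.
split; [exact: gamma_flag|by split; exact: rot_paut|].
have key i j (ij : i < j) (j4 : j < 4) :
    exists2 P, jadj le rk j Phi P & jadj le rk i P (rot (rotW a x y i j) @: Phi).
  have [P jP iP] := W_jadj (erefl : H 0 = _) (erefl : H 5 = _) HT HD HW ij j4.
  by exists P; rewrite // /rot cact_flagOf mul1g.
by split; [exact: (key 0 1)|exact: (key 1 2)|exact: (key 2 3)].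
Qed.

Lemma gamma_presents : presents_gamma3 b e1 e2 (paut le) (rot a) (rot x) (rot y).
Proof.
split; [|exact: relP|].
  apply/eqP; rewrite eqEsubset; apply/andP; split; last first.
    by rewrite gen_subG; apply/subsetP => s; rewrite !inE => /orP[/orP[]|] /eqP->;
      have := rot_paut; rewrite /paut => h; have := h a; have := h x; have := h y; rewrite !inE.
  rewrite gamma_paut; apply/subsetP => _ /imsetP[g _ ->].
  have [i [l [j ->]]] := nfP g; rewrite !rotM !(morph_exp rotM).
  by rewrite !groupM ?groupX // mem_gen // !inE eqxx ?orbT.
move=> K t1 t2 t3 relK.
have [f [fM fa fx fy]] := gamma_universal b5 he1 he2 relG nfP uq relK.
exists (f \o unrot); split; rewrite /= ?rotK //.
by rewrite gamma_paut => _ _ /imsetP[g _ ->] /imsetP[h _ ->]; rewrite /= -rotM !rotK fM.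
Qed.

Lemma gamma_atomic_cover (F' : finType) (le' : rel F') (rk' : F' -> nat) :
  polytope4 le' rk' -> chiral le' -> tight le' rk' -> ~ properly_covers le rk le' rk'.
Proof.
move=> polyP' chirP' [p' [q' [r' [ty' nf']]]] [c [[c_onto c_rk c_le c_jadj] ninj]].
apply: ninj; have hc : flag_hom le le' rk rk' c := conj c_rk c_jadj.
have fP := gamma_flag; have polyP := gamma_poly; have preP' := polytope4_pre polyP'.
have [pi [piM pi_onto piE]] := cover_morphism polyP polyP' gamma_chiral chirP' hc c_onto fP.
pose rho g := pi (rot g).
have rhoM : {morph rho : g h / (g * h)%g}.
  by move=> g h; rewrite /rho rotM piM ?rot_paut.
have rel' := gamma3_rel_morph rhoM relG.
have fP' : is_flag le' (c @: Phi) := flag_hom_flag polyP hc fP.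
have rhoP g : rho g \in paut le' by rewrite -pi_onto /rho imset_f ?rot_paut.
have rho_im g : rho g @: (c @: Phi) = c @: (rot g @: Phi).
  by rewrite /rho (cover_intertwine_imset piE) ?rot_paut.
have rho_onto s : s \in paut le' -> exists g, s = rho g.
  rewrite -pi_onto => /imsetP[t]; rewrite gamma_paut => /imsetP[g _ ->] ->.
  by exists g.
(* The sections at the image of the base flag identify the entries of the covered type with the
   orders of the image rotations. *)
have ord' i : i < 3 -> exists u v, [/\ le' u v, rk' u = i, rk' v = i.+3 &
    sect_count le' rk' i.+1 u v = #[rho (rotW a x y i i.+1)]%g].
  move=> i3; have [j4 i6 j6] : [/\ i.+1 < 4, i < 6 & i.+3 < 6].
    by case: i i3 => [|[|[|]]].
  have i4 := ltnW j4.
  have [u Pu ru] := flag_face preP' fP' i6; have [v Pv rv] := flag_face preP' fP' j6.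
  have luv : le' u v.
    by apply: (flag_le preP' fP'); rewrite // ru rv; apply: leq_trans (leqnSn _) (leqW (leqnSn _)).
  exists u, v; split=> //; apply: (sect_count_flag polyP' chirP' fP' i3); rewrite ?rhoP //.
  rewrite rho_im rot_W // (flag_hom_adj polyP polyP') //; last exact: adj_flag.
  by rewrite (flag_hom_adj polyP polyP').
have oa : #[rho a]%g = p'.
  by have [u [v [l ru rv <-]]] := ord' 0 isT; case: ty' => h _ _; apply: h.
have ox : #[rho x]%g = q'.
  by have [u [v [l ru rv <-]]] := ord' 1 isT; case: ty' => _ h _; apply: h.
have oy : #[rho y]%g = r'.
  by have [u [v [l ru rv <-]]] := ord' 2 isT; case: ty' => _ _ h; apply: h.
have cP : #|paut le'| = (#[rho a]%g * #[rho x]%g * #[rho y]%g)%N.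
  apply/eqP; rewrite -(eqn_pmul2l (isT : 0 < 2)) -(nflags_chiral polyP' chirP' fP') nf'.
  by rewrite oa ox oy !mulnA.
have [[[pa qx py] [ra rx _]] _ _ _ _] := rel'.
have b1 : (b - 1 = (b - 2).+1)%N by rewrite -subnSK // (leq_trans _ b5).
have b0 : (b = (b - 1).+1)%N by rewrite subn1 prednK // (leq_trans _ b5).
(* If this power survives, the contrapositives of [gamma_a_kill] and [gamma_y_kill] keep all orders
   full; by [cP] the two groups then have the same order. *)
have [x2|/eqP x2] := eqVneq (rho x ^+ (2 ^ (b - 1)))%g 1%g; last first.
  apply: (cover_inj polyP polyP' gamma_chiral chirP' hc fP pi_onto piE).
  rewrite cP card_paut; congr (_ * _ * _)%N.
  - rewrite b1; apply: order_pow2; first by rewrite -b1.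
    by move/(gamma_a_kill b5 he1 he2 rel').
  - by rewrite b0; apply: order_pow2 => //; rewrite -b0.
  - rewrite b1; apply: order_pow2; first by rewrite -b1.
    by move/(gamma_y_kill b5 he1 he2 rel').
have [tau0 [tM ta tx ty]] :=
  gamma_universal b5 he1 he2 relG nfP uq (gamma_mirror b5 he1 he2 rel' x2).
exfalso.
have tau0P g : tau0 g \in paut le'.
  have [i [l [j ->]]] := nfP g.
  by rewrite !tM !(morph_exp tM) ta tx ty !groupM ?groupX ?groupV ?groupM ?rhoP.
(* Tightness makes each factor of the normal form trivial under [rho], and [tau0] sends each factor
   to the inverse of its image or to a conjugate of that inverse. *)
have ker g : rho g = 1%g -> tau0 g = 1%g.
  have [i [l [j ->]]] := nfP g; rewrite !rhoM !(morph_exp rhoM) => e.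
  have [||ea ey ex] := @tight_triv _ (paut le') (rho a) (rho y) (rho x) i l j _ _ e.
  - move=> s /rho_onto[h ->]; have [i' [l' [j' ->]]] := nfP h.
    by exists i', l', j'; rewrite !rhoM !(morph_exp rhoM).
  - by rewrite cP -!mulnA (mulnC #[rho y]%g).
  rewrite !tM !(morph_exp tM) ta tx ty !expVgn ea ex !invg1 mulg1 mul1g.
  have exy : (rho x * rho y = (rho y)^-1 * (rho x)^-1)%g.
    by rewrite -invMg; symmetry; apply: mulg1_eq; rewrite -expg2.
  have -> : (rho x * rho x * rho y = (rho y)^-1 ^ (rho x)^-1)%g.
    by rewrite conjgE invgK -mulgA exy.
  by rewrite -conjXg expVgn ey invg1 conj1g.
apply: (cover_mirror polyP polyP' chirP' hc fP piM pi_onto piE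
          (tau := tau0 \o unrot) (v := rot \o rotV)).
- by rewrite gamma_paut => _ _ /imsetP[g _ ->] /imsetP[h _ ->]; rewrite /= -rotM !rotK tM.
- by move=> s _; apply: tau0P.
- by rewrite gamma_paut => _ /imsetP[g _ ->] /= /ker; rewrite rotK.
- move=> j j4; split; [exact: rot_paut|exact: rot_V|rewrite /= rotK -/(rho _)].
  case: j j4 => [|[|[|[|]]]] // _ /=.
  + by rewrite (morph_inv tM) ta (morph_inv rhoM).
  + by rewrite (morph_one tM) (morph_one rhoM) invg1.
  + rewrite tM tx ty rhoM !mulgA mulVg mul1g.
    by symmetry; apply: mulg1_eq; rewrite -expg2.
Qed.

End GammaPolytope.

Theorem theorem4p9 (b : nat) (e1 e2 : int) :
  (5 <= b)%N ->
  (e1 = 1%R \/ e1 = (-1)%R) -> (e2 = 1%R \/ e2 = (-1)%R) ->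
  exists (F : finType) (le : rel F) (rk : F -> nat) (Phi : {set F})
         (s1 s2 s3 : {perm F}),
    [/\ polytope4 le rk /\ chiral le,
        type4 le rk (2 ^ (b - 1)) (2 ^ b) (2 ^ (b - 1)), atomic le rk,
        std_gens le rk Phi s1 s2 s3 &
        presents_gamma3 b e1 e2 (paut le) s1 s2 s3].
Proof.
move=> b5 he1 he2; have [gT [a [x [y [relG nfP uq]]]]] := gamma_group b5 he1 he2.
exists (cface (stab a x y)), (@cle gT (stab a x y)), (@crk gT (stab a x y)), (flagOf (stab a x y) 1),
  (cact (stab a x y) a), (cact (stab a x y) x), (cact (stab a x y) y).
split.
- split; [exact: (gamma_poly b5 he1 he2 relG nfP uq)|exact: (gamma_chiral b5 he1 he2 relG nfP uq)].
- exact: (gamma_type b5 he1 he2 relG nfP uq).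
- split; [exact: (gamma_tight b5 he1 he2 relG nfP uq)|exact: (gamma_chiral b5 he1 he2 relG nfP uq)|].
  by move=> F' le' rk'; apply: (gamma_atomic_cover b5 he1 he2 relG nfP uq).
- exact: (gamma_std b5 he1 he2 relG uq).
- exact: (gamma_presents b5 he1 he2 relG nfP uq).
Qed.
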